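(* Let $X,Y\subset\mathbb{R}^n$ be bounded convex regions, and let $\mu$ and $\nu$ be probability measures on $X$ and $Y$ respectively, each absolutely continuous with respect to Lebesgue measure with density bounded away from zero. Let $s(x,y)=e^{-|x-y|^2/2}$. For each $N$ let $P_N=\{p_1,\dots,p_N\}\subset X$ be a set of $N$ (distinct) points (depending on $N$), and assume that $\mu_N:=\frac1N\sum_{i=1}^N\delta_{p_i}$ converges weakly to $\mu$ on $X$. For each $N$ let $\pi_N$ be a maximizer of $$F(\pi)=\ln N+\frac1N\sum_{i=1}^N\ln\int_{\{p_i\}\times Y}s(p_i,y)\,d\pi$$ over all $\pi\in P(P_N\times Y)$ with second marginal $\pi_Y=\nu$, and let $\beta_N\in P(Y)$ be the absolutely continuous measure associated to $\pi_N$ (defined in the context). Let $\hat\beta$ be the unique maximizer over $P(Y)$ of $$\hat F(\beta)=-H_\nu(\beta)-W^2(\mu,\beta).$$ Then $$\hat F(\beta_N)\to\hat F(\hat\beta)\quad\text{as }N\to\infty,$$ and in particular $\beta_N\to\hat\beta$ weakly.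
   Context: $P(Z)$ denotes the set of Borel probability measures on $Z$. By convention $F(\pi)=-\infty$ if $\pi(\{p_i\}\times Y)=0$ for some $i$. Relative entropy: $H_\nu(\beta)=\int_Y \ln\left(\frac{d\beta}{d\nu}\right)\frac{d\beta}{d\nu}\,d\nu$ if $\beta\ll\nu$, and $H_\nu(\beta)=+\infty$ otherwise. $W^2(\mu,\beta)$ is the optimal transport cost for the cost $c(x,y)=|x-y|^2/2$: $W^2(\mu,\beta)=\min\int_{X\times Y}\frac{|x-y|^2}{2}\,d\pi$ over $\pi\in P(X\times Y)$ with marginals $\pi_X=\mu$, $\pi_Y=\beta$. Associated measure $\beta_N$: a maximizer $\pi_N$ has the form $\pi_N=\sum_{i=1}^N\delta_{p_i}\otimes\nu|_{E_i}$, where, for some function $\varphi_N:P_N\to\mathbb{R}$, $E_i=\{y\in Y:\ \varphi_N(q)\ge\varphi_N(p_i)+\langle q-p_i, y\rangle\ \ \forall q\in P_N\}$ are the Laguerre cells of $\varphi_N$ (they cover $Y$, overlap only in $\nu$-null sets, and $\nu(E_i)>0$). Then for measurable $Z\subset Y$, $$\beta_N(Z)=\frac1N\sum_{i=1}^N\frac{\nu(E_i\cap Z)}{\nu(E_i)}.$$ Equivalently, $\beta_N=\frac1N\sum_i \nu_i/\nu_i(Y)$ where $\nu_i(Z)=\pi_N(\{p_i\}\times Z)$. Terminology: $\hat\beta$ determines the continuum Nash bargaining solution (the map solution is $\nabla\hat\varphi$ with $\hat\varphi$ convex and $\hat\beta=(\nabla\hat\varphi)_\#\mu$). *)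

(* Defs.v *)
From HB Require Import structures.
From mathcomp Require Import all_boot all_order all_algebra.
From mathcomp Require Import all_classical all_reals all_analysis.
From mathcomp Require Import measurable_realfun.

Set Implicit Arguments.
Unset Strict Implicit.
Unset Printing Implicit Defensive.

Import Order.TTheory GRing.Theory Num.Theory.
Import numFieldTopology.Exports numFieldNormedType.Exports.

Local Open Scope classical_set_scope.
Local Open Scope ring_scope.
Local Open Scope charge_scope.

HB.instance Definition _ (R : realType) (m n : nat) :=
  Measurable.copy 'M[R]_(m, n) (g_sigma_algebraType (@open 'M[R]_(m, n))).

Lemma open_measurable_mx (R : realType) m n (A : set 'M[R]_(m, n)) :
  open A -> measurable A.
Proof. by move=> oA; exact: sub_sigma_algebra. Qed.

Lemma measurable_fun_open (R : realType) m n d (T : measurableType d)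
    (f : T -> 'M[R]_(m, n)) :
  (forall A, open A -> measurable (f @^-1` A)) -> measurable_fun setT f.
Proof.
move=> mf; apply: (@measurability _ _ _ _ setT f open) => //.
by move=> _ [A oA <-]; rewrite setTI; exact: mf.
Qed.

Section lebesgue_rV.
Context (R : realType).

Definition rV_cons n (z : R * 'rV[R]_n) : 'rV[R]_n.+1 :=
  \row_j (if unlift ord0 j is Some k then z.2 ord0 k else z.1).

Definition rV_uncons n (v : 'rV[R]_n.+1) : R * 'rV[R]_n :=
  (v ord0 ord0, \row_j v ord0 (lift ord0 j)).

Lemma rV_consK n : cancel (@rV_cons n) (@rV_uncons n).
Proof.
move=> [x v]; rewrite /rV_uncons mxE unlift_none; congr (_, _).
by apply/rowP => j; rewrite 2!mxE liftK.
Qed.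

Lemma measurable_coord m n i j :
  measurable_fun setT (fun M : 'M[R]_(m, n) => M i j).
Proof.
apply: (measurability _ (measurable_realfun.RGenOpens.measurableE R)) => //.
move=> _ [_ [a [b ->]] <-]; rewrite setTI; apply: open_measurable_mx.
by apply: open_comp => [M _|]; [exact: coord_continuous|exact: interval_open].
Qed.

Let qball n (q : 'rV[rat]_n * nat) : set 'rV[R]_n :=
  ball (map_mx ratr q.1 : 'rV[R]_n) (q.2.+1%:R^-1 : R).

Let open_qball n (A : set 'rV[R]_n) : open A ->
  A = \bigcup_q (if `[< qball q `<=` A >] then qball q else set0).
Proof.
move=> oA; apply/seteqP; split => [x Ax|x [q _]]; last first.
  by case: asboolP => // qA; exact: qA.
have /nbhs_ballP[e /= e0 xeA] : nbhs x A by apply: open_nbhs_nbhs; split.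
have [k ke] : exists k : nat, (k.+1%:R^-1 : R) < e / 2.
  exists (Num.truncn (e / 2)^-1).
  by rewrite invf_plt ?posrE ?divr_gt0// truncnS_gt.
have k0 : 0 < (k.+1%:R^-1 : R) by rewrite invr_gt0.
have rq j : exists q : rat, `|x ord0 j - ratr q| < k.+1%:R^-1.
  have [|q] := @rat_in_itvoo R (x ord0 j - k.+1%:R^-1) (x ord0 j + k.+1%:R^-1).
    by rewrite ltrBlDr -addrA ltrDl addr_gt0.
  by rewrite in_itv/= => qx; exists q; rewrite distrC ltr_distl.
pose q : 'rV[rat]_n := \row_j sval (cid (rq j)).
have xq j : `|x ord0 j - ratr (q ord0 j)| < k.+1%:R^-1.
  by rewrite mxE; case: cid.
exists (q, k) => //; rewrite ifT.
  by split=> // i j; rewrite ord1 mxE; apply: ball_sym; exact: xq.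
apply/asboolP => y [_ yq]; apply: xeA; split => // i j.
rewrite ord1; change (`|x ord0 j - y ord0 j| < e).
apply: le_lt_trans (ler_distD (ratr (q ord0 j)) _ _) _.
rewrite [e]splitr ltrD// (lt_trans _ ke)//.
by have := yq ord0 j; rewrite mxE.
Qed.

Lemma measurable_rV n d (T : measurableType d) (f : T -> 'rV[R]_n) :
  (forall j, measurable_fun setT (fun t => f t ord0 j)) -> measurable_fun setT f.
Proof.
move=> mf; apply: measurable_fun_open => A /open_qball ->.
rewrite preimage_bigcup; apply: countable_bigcupT_measurable => // q.
case: ifP => _; last by rewrite preimage_set0.
rewrite (_ : _ @^-1` _ = \big[setI/setT]_(j < n)
    ((fun t => f t ord0 j) @^-1` ball (ratr (q.1 ord0 j) : R) (q.2.+1%:R^-1 : R))).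
  apply: bigsetI_measurable => j _; rewrite -[X in measurable X]setTI.
  by apply: mf => //; exact: measurable_ball.
apply/seteqP; split=> [t [_ qt]|t qt].
  apply: (big_ind (fun S : set T => S t)) => [//|B C Bt Ct|j _]; first by split.
  by have := qt ord0 j; rewrite mxE.
split; first by rewrite invr_gt0.
move=> i j; rewrite ord1 mxE.
by move: qt; rewrite (bigD1 j)//= => -[].
Qed.

Lemma measurable_rV_cons n : measurable_fun setT (@rV_cons n).
Proof.
apply: measurable_rV => j.
rewrite (_ : (fun _ => _) = fun z : R * 'rV[R]_n =>
   if unlift ord0 j is Some k then z.2 ord0 k else z.1); last first.
  by apply/funext => z; rewrite mxE.
case: unlift => [k|]; last exact: measurable_fst.
exact: measurableT_comp (measurable_coord _ _) measurable_snd.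
Qed.

Lemma measurable_rV_uncons n : measurable_fun setT (@rV_uncons n).
Proof.
apply: measurable_fun_pair; first exact: measurable_coord.
apply: measurable_rV => j.
rewrite (_ : (fun _ => _) = fun v : 'rV[R]_n.+1 => v ord0 (lift ord0 j)).
  exact: measurable_coord.
by apply/funext => z; rewrite mxE.
Qed.

Section rV_cons_measure.
Context n (m : {sigma_finite_measure set 'rV[R]_n -> \bar R}).

Definition rV_cons_measure : set 'rV[R]_n.+1 -> \bar R :=
  pushforward (lebesgue_measure \x m)%E (@rV_cons n).

HB.instance Definition _ := Measure.copy rV_cons_measure
  (@measure_function_pushforward__canonical__measure_function_Measure
    _ _ _ _ _ (lebesgue_measure \x m)%E (@rV_cons n) (@measurable_rV_cons n)).

Let rV_cons_measure_sigma_finite : sigma_finite setT rV_cons_measure.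
Proof.
have /sigma_finiteP[F [FT ndF Ffin]] := sigma_finiteT (@lebesgue_measure R).
have /sigma_finiteP[G [GT ndG Gfin]] := sigma_finiteT m.
exists (fun k => @rV_uncons n @^-1` (F k `*` G k)).
  apply/seteqP; split => // v _.
  have [i _ Fi] : (\bigcup_k F k) (rV_uncons v).1 by rewrite -FT.
  have [j _ Gj] : (\bigcup_k G k) (rV_uncons v).2 by rewrite -GT.
  exists (maxn i j) => //; split.
    by move: Fi; exact/subsetPset/ndF/leq_maxl.
  by move: Gj; exact/subsetPset/ndG/leq_maxr.
move=> k; have [mF Fk] := Ffin k; have [mG Gk] := Gfin k; split.
  rewrite -[X in measurable X]setTI; apply: measurable_rV_uncons => //.
  exact: measurableX.
rewrite /rV_cons_measure /pushforward -comp_preimage.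
rewrite (_ : _ \o _ = id); last by apply/funext => z; exact: rV_consK.
by rewrite preimage_id product_measure1E// lte_mul_pinfty// ge0_fin_numE.
Qed.

HB.instance Definition _ := Measure_isSigmaFinite.Build _ _ _ rV_cons_measure
  rV_cons_measure_sigma_finite.

End rV_cons_measure.

Fixpoint lebesgue_rV n : {sigma_finite_measure set 'rV[R]_n -> \bar R} :=
  match n with
  | 0 => \d_(0 : 'rV[R]_0)
  | k.+1 => rV_cons_measure (lebesgue_rV k)
  end.

Lemma lebesgue_rV_box n (a b : 'rV[R]_n) : (forall j, a ord0 j <= b ord0 j) ->
  lebesgue_rV n [set v | forall j, v ord0 j \in `[a ord0 j, b ord0 j]] =
  (\prod_j (b ord0 j - a ord0 j))%:E.
Proof.
elim: n a b => [|n IH] a b ab.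
  by rewrite big_ord0 /= diracE mem_set// => -[].
rewrite /= /rV_cons_measure /pushforward big_ord_recl EFinM.
transitivity ((@lebesgue_measure R \x lebesgue_rV n)%E
    (`[a ord0 ord0, b ord0 ord0]%classic `*`
    [set v : 'rV[R]_n | forall j, v ord0 j \in
      `[(rV_uncons a).2 ord0 j, (rV_uncons b).2 ord0 j]])).
  congr (_ _); apply/seteqP; split => [z zab|[x v] [/= xab vab] j].
    split; first by have := zab ord0; rewrite mxE unlift_none.
    by move=> j; have := zab (lift ord0 j); rewrite !mxE liftK.
  rewrite mxE; case: unliftP => [k ->|->//].
  by have := vab k; rewrite !mxE.
rewrite product_measure1E//; last first.
  rewrite (_ : mkset _ = \bigcap_(j in [set: 'I_n]) ((fun v : 'rV[R]_n => v ord0 j) @^-1`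
    `[(rV_uncons a).2 ord0 j, (rV_uncons b).2 ord0 j]%classic)); last first.
    by apply/seteqP; split => [v vab j _|v vab j]; [exact: vab|exact: (vab j I)].
  apply: fin_bigcap_measurable => // j _; rewrite -[X in measurable X]setTI.
  by apply: measurable_coord => //; exact: measurable_itv.
rewrite IH; last by move=> j; rewrite !mxE.
congr (_ * _)%E.
  apply: etrans (lebesgue_measure_itv _) _; rewrite /= lte_fin.
  case: ltP => // ba; have -> : a ord0 ord0 = b ord0 ord0 by apply/le_anti/andP.
  by rewrite subrr.
by congr (_%:E); apply: eq_bigr => j _; rewrite !mxE.
Qed.

End lebesgue_rV.

Section definitions.
Context (R : realType) (n : nat).
Local Notation E := 'rV[R]_n.

Definition dotv (x y : E) : R := \sum_(k < n) x ord0 k * y ord0 k.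

(* The library norm on ['rV[R]_n] is the supremum norm, hence this
   Euclidean squared distance. *)
Definition sqdist (x y : E) : R := dotv (x - y) (x - y).

Definition convex_region (Z : set E) :=
  [/\ measurable Z, bounded_set Z, convex_set Z & Z^° !=set0].

(* [P(Z)]: a Borel probability measure on a Borel set [Z] is a probability
   measure on the whole space that gives mass 1 to [Z]. *)
Definition prob_on d (T : measurableType d) (Z : set T) : set (probability T R) :=
  [set P | P Z = 1%E].

Definition ac_bounded_below (Z : set E) (m : probability E R) :=
  m `<< lebesgue_rV R n /\
  exists2 c : R, 0 < c & {ae lebesgue_rV R n, forall x, Z x ->
    (c%:E <= ('d (charge_of_finite_measure m) '/d (lebesgue_rV R n)) x)%E}.

Definition empirical N (p : 'I_N -> E) (A : set E) : \bar R :=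
  ((N%:R^-1)%:E * \sum_(i < N) \d_(p i) A)%E.

Lemma empiricalE N (p : 'I_N -> E) : empirical p =
  mscale (N%:R^-1)%:nng (msum (fun k => \d_((codom p)`_k)) N).
Proof.
apply/funext => A; rewrite /empirical /mscale/=; congr (_ * _)%E.
apply: eq_bigr => i _; rewrite /= (nth_map i) ?size_enum_ord//.
by rewrite nth_ord_enum.
Qed.

Let empirical0 N (p : 'I_N -> E) : empirical p set0 = 0%E.
Proof. by rewrite empiricalE measure0. Qed.

Let empirical_ge0 N (p : 'I_N -> E) A : (0 <= empirical p A)%E.
Proof. by rewrite empiricalE measure_ge0. Qed.

Let empirical_semi_sigma_additive N (p : 'I_N -> E) :
  semi_sigma_additive (empirical p).
Proof. by rewrite empiricalE; exact: measure_semi_sigma_additive. Qed.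

HB.instance Definition _ N (p : 'I_N -> E) := isMeasure.Build _ _ _
  (empirical p) (empirical0 p) (@empirical_ge0 N p)
  (@empirical_semi_sigma_additive N p).

Definition weak_cvg_on (Z : set E) (u : nat -> set E -> \bar R)
    (m : set E -> \bar R) :=
  forall f : E -> R, {within Z, continuous f} -> [bounded f x | x in Z] ->
    (\int[u N]_(x in Z) (f x)%:E)%E @[N --> \oo] --> (\int[m]_(x in Z) (f x)%:E)%E.

Definition maximizer d (T : measurableType d) (D : set (probability T R))
    (G : probability T R -> \bar R) (P : probability T R) :=
  D P /\ forall Q, D Q -> (G Q <= G P)%E.

(* Uniqueness is up to equality on measurable sets, since the values of a
   library measure on the other sets are irrelevant. *)
Definition unique_maximizer d (T : measurableType d) (D : set (probability T R))
    (G : probability T R -> \bar R) (P : probability T R) :=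
  maximizer D G P /\
  forall Q, maximizer D G Q -> forall A, measurable A -> Q A = P A.

Definition surplus (x y : E) : R := expR (- (sqdist x y / 2)).

Definition plans N (p : 'I_N -> E) (Y : set E) (nu : probability E R) :
    set (probability (E * E)%type R) :=
  [set pi | prob_on (range p `*` Y) pi /\
    forall B, measurable B -> pushforward pi snd B = nu B].

(* [lne 0 = -oo], so [nash_objective] is [-oo] as soon as some
   [{p_i} `*` Y] has mass 0. *)
Definition nash_objective N (p : 'I_N -> E) (Y : set E)
    (pi : probability (E * E)%type R) : \bar R :=
  ((ln N%:R)%:E + (N%:R^-1)%:E * \sum_(i < N)
    lne (\int[pi]_(z in [set p i] `*` Y) (surplus z.1 z.2)%:E))%E.

(* See [associated_measure_laguerre] for the expression in terms of the
   Laguerre cells when [pi] is the sum of the [\d_(p i) \x nu] restricted to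
   those cells. *)
Definition associated_measure N (p : 'I_N -> E) (Y : set E)
    (pi : probability (E * E)%type R) (beta : probability E R) :=
  prob_on Y beta /\
  forall Z, measurable Z -> Z `<=` Y ->
    beta Z = ((N%:R^-1)%:E * \sum_(i < N)
      (pi ([set p i] `*` Z) / pi ([set p i] `*` Y)))%E.

(* Where the density vanishes the integrand is 0, since [ln 0 = 0]. *)
Definition relative_entropy (Y : set E) (nu beta : probability E R) : \bar R :=
  if `[< beta `<< nu >] then
    (\int[nu]_(y in Y)
      let r := fine (('d (charge_of_finite_measure beta) '/d nu) y) in
      (ln r * r)%:E)%E
  else +oo%E.

Definition couplings (X Y : set E) (mu beta : probability E R) :
    set (probability (E * E)%type R) :=
  [set pi | [/\ prob_on (X `*` Y) pi,
    forall A, measurable A -> pushforward pi fst A = mu A &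
    forall B, measurable B -> pushforward pi snd B = beta B]].

Definition transport_cost (X Y : set E) (mu beta : probability E R) : \bar R :=
  ereal_inf [set (\int[pi]_z (sqdist z.1 z.2 / 2)%:E)%E |
    pi in couplings X Y mu beta].

Definition limit_objective (X Y : set E) (mu nu beta : probability E R) : \bar R :=
  (- relative_entropy Y nu beta - transport_cost X Y mu beta)%E.

Definition laguerre_cell N (p : 'I_N -> E) (Y : set E) (phi : 'I_N -> R)
    (i : 'I_N) : set E :=
  [set y | Y y /\ forall j, phi j >= phi i + dotv (p j - p i) y].

Lemma measurable_rV_set1 (x : E) : measurable [set x].
Proof.
rewrite -[X in measurable X]setCK; apply: measurableC; apply: open_measurable_mx.
by apply: closed_openC; apply: accessible_closed_set1;
  apply: hausdorff_accessible; exact: norm_hausdorff.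
Qed.

Lemma associated_measure_laguerre N (p : 'I_N -> E) (Y : set E)
    (nu : probability E R) (pi : probability (E * E)%type R)
    (beta : probability E R) (phi : 'I_N -> R) :
  injective p -> measurable Y ->
  (forall A B, measurable A -> measurable B ->
    pi (A `*` B) =
      (\sum_(i < N) \d_(p i) A * nu (laguerre_cell p Y phi i `&` B))%E) ->
  associated_measure p Y pi beta <->
  prob_on Y beta /\
  forall Z, measurable Z -> Z `<=` Y ->
    beta Z = ((N%:R^-1)%:E * \sum_(i < N)
      (nu (laguerre_cell p Y phi i `&` Z) / nu (laguerre_cell p Y phi i)))%E.
Proof.
move=> pI mY piE.
have piZ i Z : measurable Z ->
    pi ([set p i] `*` Z) = nu (laguerre_cell p Y phi i `&` Z).
  move=> mZ; rewrite piE//; last exact: measurable_rV_set1.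
  rewrite (bigD1 i)//= big1 ?adde0 => [|j ji].
    by rewrite diracE mem_set// mul1e.
  rewrite diracE memNset ?mul0e// => /= /pI ij.
  by move: ji; rewrite ij eqxx.
have piY i : pi ([set p i] `*` Y) = nu (laguerre_cell p Y phi i).
  by rewrite piZ//; congr (nu _); apply/seteqP; split => [y []|y []].
rewrite /associated_measure; split => -[bY bE]; split => // Z mZ ZY;
  by rewrite bE//; congr (_ * _)%E; apply: eq_bigr => i _; rewrite piY piZ.
Qed.

End definitions.

(* Main.v *)
(* The first-order conditions say that a maximizer [pi_N] splits [nu] along the
   Laguerre cells of the logarithms of the players' payoffs (corrected by
   [|p_i|^2 / 2]).  These logarithms are also dual variables for the limit
   problem: their Legendre transforms, normalized by [ln N], form an admissible
   pair for the Kantorovich dual of the transport cost together with the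
   Gibbs variational principle for the relative entropy, so that every [beta]
   satisfies [limit_objective beta <= e_N] for an explicit dual value [e_N].

   Conversely [limit_objective (beta_N)] is almost [e_N]: [beta_N] is an explicit
   mixture, so its entropy is bounded by convexity, and its transport cost is
   bounded by moving [mu] to the empirical measure and then each [p_i] to its
   cell.  On a cell the cost oscillates at most by the width of the cell.  The
   cell of [p_i] consists of subgradients at [p_i] of a convex Lipschitz
   function, so its width is at most a second difference quotient of this
   function, and for a convex Lipschitz function the mean of these quotients
   against an absolutely continuous measure is small, uniformly in the function.

   Hence the values converge.  Weak convergence follows from a quantitative form
   of the duality, which plays the role of uniqueness: any [beta] whose value is
   almost [e_N] is close to the same measure [expR gam_N * nu], by comparing the
   relative entropy with the total variation distance. *)

Require Import Defs.
From HB Require Import structures.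
From mathcomp Require Import all_boot all_order all_algebra.
From mathcomp Require Import all_classical all_reals all_analysis.
From mathcomp Require Import measurable_realfun ring lra.

Set Implicit Arguments.
Unset Strict Implicit.
Unset Printing Implicit Defensive.

Import Order.TTheory GRing.Theory Num.Theory.
Import numFieldTopology.Exports numFieldNormedType.Exports.
Local Open Scope classical_set_scope.
Local Open Scope ring_scope.
Local Open Scope charge_scope.

(** * Probability measures *)

(** The obstacle is that the potentials and the dual values change with [N], and no limit of them is
    taken. The values of [beta N] and of the maximizer are confined to one short interval, and both
    measures are compared with the same [expR gam * nu], whatever it is for this [N]. This dictates
    the order of the choices: [eta] comes from the accuracy, the step [t] from [eta] and [mu], the
    transport error [eps] from [t], and [N] last. The step must precede [eps] because the mean of a
    second difference over the points differs from its [mu]-integral by up to [4 * L * eps], which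
    is then divided by [t]. Finite differences replace derivatives for the same reason: at a fixed
    step they are Lipschitz in the point, so that their means can be moved between [mu] and the
    empirical measure, whereas subdifferentials do not vary continuously. *)

Section probability_constructions.
Context d (T : measurableType d) (R : realType).
Implicit Types P : probability T R.

(** Normalizing a measure of mass 1 does not change it, so [mnormalize] just supplies the bundled
    structure; its fallback, here a Dirac mass, is never selected. *)
Lemma probability_of_measure (m : {measure set T -> \bar R}) :
  m setT = 1%E -> exists Q : probability T R, forall A, Q A = m A.
Proof.
move=> m1; pose P : probability T R := \d_(@point T).
have mE A : mnormalize m P A = m A.
  rewrite /mnormalize m1; case: ifPn => [/orP[]//|_]; first by rewrite onee_eq0.
  by rewrite [fine _]/(1 : R) invr1 mule1.
by exists (mnormalize m P).
Qed.

Lemma probability_pushforward d' (T' : measurableType d') P (f : T -> T') :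
  measurable_fun setT f ->
  exists Q : probability T' R, (forall A, Q A = P (f @^-1` A)) /\
    forall g : T' -> \bar R, measurable_fun setT g -> (forall y, 0 <= g y)%E ->
      (\int[Q]_y g y = \int[P]_x g (f x))%E.
Proof.
move=> mf.
pose F : {mfun T >-> T'} := HB.pack f (isMeasurableFun.Build _ _ _ _ f mf).
exists (distribution P F); split=> // g mg g0.
by rewrite ge0_integral_pushforward.
Qed.

Lemma probability_density P (f : T -> R) :
  measurable_fun setT f -> (forall x, 0 <= f x) ->
  (\int[P]_x (f x)%:E = 1)%E ->
  exists Q : probability T R,
    forall g : T -> \bar R, measurable_fun setT g -> (forall x, 0 <= g x)%E ->
      (\int[Q]_x g x = \int[P]_x (g x * (f x)%:E))%E.
Proof.
move=> mf f0 f1.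
pose m A := (\int[P]_(x in A) (f x)%:E)%E.
have mEf : measurable_fun setT (fun x => (f x)%:E) by exact/measurable_EFinP.
have m0 : m set0 = 0%E by rewrite /m integral_set0.
have m_ge0 A : (0 <= m A)%E by apply: integral_ge0 => x _; rewrite lee_fin.
have m_sigma : semi_sigma_additive m.
  move=> F mF tF mUF; rewrite /m ge0_integral_bigcup//; last 2 first.
  - exact: measurable_funTS.
  - by move=> x _; rewrite lee_fin.
  have /cvg_ex[l ml] : cvgn (fun k => \sum_(0 <= i < k) \int[P]_(x in F i) (f x)%:E)%E.
    by apply: is_cvg_ereal_nneg_natsum_cond => k _ _; exact: m_ge0.
  by rewrite (cvg_lim _ ml).
pose M : {measure set T -> \bar R} :=
  HB.pack m (isMeasure.Build _ _ _ m m0 m_ge0 m_sigma).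
have [Q QE] := @probability_of_measure M f1.
exists Q => g mg g0.
have QP : Q `<< P.
  apply/null_content_dominatesP => A mA PA0; rewrite (QE A)/= /m.
  by apply: null_set_integral => //; exact: measurable_funTS.
rewrite -(Radon_Nikodym_SigmaFinite.change_of_variables QP)//.
apply: ge0_ae_eq_integral => //.
- apply: emeasurable_funM => //.
  exact: measurable_int (Radon_Nikodym_SigmaFinite.f_integrable QP).
- by apply: emeasurable_funM.
- by move=> x _; rewrite mule_ge0//; exact: Radon_Nikodym_SigmaFinite.f_ge0.
- by move=> x _; rewrite mule_ge0// lee_fin.
(* The Radon-Nikodym derivative and [f] agree almost everywhere, since both integrate to [Q A] over
   each measurable [A]. *)
apply: ae_eqe_mul2l.
apply: integral_ae_eq => //.
- exact: Radon_Nikodym_SigmaFinite.f_integrable.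
- by move=> A _ mA; rewrite -Radon_Nikodym_SigmaFinite.f_integral//; exact: (QE A).
Qed.

Lemma integral_mixture m (w : 'I_m.+1 -> R) (P : 'I_m.+1 -> probability T R)
    (Q : {measure set T -> \bar R}) (D : set T) (g : T -> \bar R) :
  (forall i, 0 <= w i) ->
  (forall A, measurable A -> Q A = \sum_i (w i)%:E * P i A)%E ->
  measurable D -> measurable_fun D g -> (forall x, D x -> 0 <= g x)%E ->
  (\int[Q]_(x in D) g x = \sum_i (w i)%:E * \int[P i]_(x in D) g x)%E.
Proof.
move=> w0 QE mD mg g0.
(* [msum] sums a sequence indexed by [nat], hence the passage through [inord]. *)
pose mu_ (k : nat) : {measure set T -> \bar R} :=
  mscale (NngNum (w0 (inord k))) (P (inord k)).
have muE A : msum mu_ m.+1 A = (\sum_i (w i)%:E * P i A)%E.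
  by rewrite /msum/=; apply: eq_bigr => i _; rewrite /mscale/= inord_val.
rewrite (eq_measure_integral (msum mu_ m.+1)) => [|A mA _]; last first.
  exact: etrans (QE A mA) (esym (muE A)).
rewrite ge0_integral_measure_sum//; apply: eq_bigr => i _.
by rewrite ge0_integral_mscale//= inord_val.
Qed.

Lemma probability_mixture m (w : 'I_m.+1 -> R) (P : 'I_m.+1 -> probability T R) :
  (forall i, 0 <= w i) -> \sum_i w i = 1 ->
  exists Q : probability T R, (forall A, Q A = \sum_i (w i)%:E * P i A)%E /\
    forall g : T -> \bar R, measurable_fun setT g -> (forall x, 0 <= g x)%E ->
      (\int[Q]_x g x = \sum_i (w i)%:E * \int[P i]_x g x)%E.
Proof.
move=> w0 w1.
pose mu_ (k : nat) : {measure set T -> \bar R} :=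
  mscale (NngNum (w0 (inord k))) (P (inord k)).
have muE A : msum mu_ m.+1 A = (\sum_i (w i)%:E * P i A)%E.
  by rewrite /msum/=; apply: eq_bigr => i _; rewrite /mscale/= inord_val.
have [] := @probability_of_measure (msum mu_ m.+1).
  apply: etrans (muE _) _; under eq_bigr do rewrite probability_setT mule1.
  by rewrite sumEFin w1.
move=> Q QE; have QE' A : Q A = (\sum_i (w i)%:E * P i A)%E.
  exact: etrans (QE A) (muE A).
exists Q; split => // g mg g0.
exact: (integral_mixture w0 (fun A _ => QE' A) measurableT mg (fun x _ => g0 x)).
Qed.

(** The representative is finite and nonnegative everywhere, which allows pointwise inequalities
    between real numbers later on. *)
Lemma density_of_dominated (nu beta : probability T R) : beta `<< nu ->
  exists r : T -> R, [/\ measurable_fun setT r, (forall x, 0 <= r x),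
    ae_eq nu setT (EFin \o r) ('d (charge_of_finite_measure beta) '/d nu)
    & forall (D : set T) (g : T -> \bar R), measurable D -> measurable_fun D g ->
      (forall x, 0 <= g x)%E ->
      (\int[beta]_(x in D) g x = \int[nu]_(x in D) (g x * (r x)%:E))%E].
Proof.
move=> bnu; pose r0 := Radon_Nikodym_SigmaFinite.f beta nu.
have r0_ge0 := Radon_Nikodym_SigmaFinite.f_ge0 bnu.
have r0E x : r0 x = (fine (r0 x))%:E.
  by rewrite fineK//; exact: Radon_Nikodym_SigmaFinite.f_fin_num.
have mr0 : measurable_fun setT r0.
  exact: measurable_int (Radon_Nikodym_SigmaFinite.f_integrable bnu).
exists (fine \o r0); split.
- exact: measurableT_comp.
- by move=> x /=; rewrite fine_ge0//; exact: r0_ge0.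
- rewrite (_ : EFin \o _ = r0); last by apply/funext => x /=; rewrite -r0E.
  by apply: ae_eq_Radon_Nikodym_SigmaFinite.
- move=> D g mD mg g0.
  rewrite -(Radon_Nikodym_SigmaFinite.change_of_variables bnu)//.
  by apply: eq_integral => x _; rewrite /= -r0E.
Qed.

End probability_constructions.

(** * Euclidean estimates *)

Section euclidean.
Context (R : realType) (n : nat).
Local Notation E := 'rV[R]_n.
Implicit Types x y z : E.

Lemma coord_le_norm x j : `|x ord0 j| <= `|x|.
Proof.
by rewrite [leRHS]/Num.norm /= mx_normrE; apply/bigmax_geP; right => /=; exists (ord0, j).
Qed.

Lemma bounded_set_coord (X : set E) : bounded_set X ->
  exists2 B : R, 0 < B & forall x, X x -> forall j, `|x ord0 j| <= B.
Proof.
move=> [M [_ MX]]; exists (`|M| + 1); first by rewrite ltr_wpDl.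
move=> x Xx j; apply: le_trans (coord_le_norm _ _) _.
by apply: MX => //; rewrite ltr_pwDr// ler_norm.
Qed.

Definition half_sq x : R := dotv x x / 2.

Lemma dotvC x y : dotv x y = dotv y x.
Proof. by apply: eq_bigr => k _; rewrite mulrC. Qed.

Lemma dotvDl x y z : dotv (x + y) z = dotv x z + dotv y z.
Proof. by rewrite -big_split; apply: eq_bigr => k _; rewrite mxE mulrDl. Qed.

Lemma dotvBl x y z : dotv (x - y) z = dotv x z - dotv y z.
Proof. by rewrite -sumrB; apply: eq_bigr => k _; rewrite !mxE mulrBl. Qed.

Lemma dotvZl (a : R) x z : dotv (a *: x) z = a * dotv x z.
Proof. by rewrite /dotv mulr_sumr; apply: eq_bigr => k _; rewrite mxE mulrA. Qed.

Lemma dotv_delta k y : dotv (delta_mx ord0 k) y = y ord0 k.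
Proof.
rewrite /dotv (bigD1 k)//= mxE !eqxx mul1r big1 ?addr0// => j jk.
by rewrite mxE eqxx (negbTE jk) mul0r.
Qed.

(** This expansion replaces the quadratic cost by a bilinear one: corrected by [half_sq], dual
    potentials become Legendre conjugates. *)
Lemma half_sqdist x y : sqdist x y / 2 = half_sq x + half_sq y - dotv x y.
Proof.
rewrite /sqdist /half_sq dotvBl (dotvC x (x - y)) (dotvC y (x - y)) !dotvBl.
rewrite (dotvC y x); lra.
Qed.

Lemma half_sqdist_ge0 x y : 0 <= sqdist x y / 2.
Proof.
by rewrite divr_ge0//; apply: sumr_ge0 => k _; rewrite -expr2 sqr_ge0.
Qed.

(** The norm is the supremum norm, so the product is bounded coordinate by coordinate; this is the
    origin of the factors [n%:R] in the constants below. *)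
Lemma ler_dotv x y (B : R) : (forall j, `|y ord0 j| <= B) ->
  `|dotv x y| <= n%:R * B * `|x|.
Proof.
move=> yB; apply: le_trans (ler_norm_sum _ _ _) _.
apply: le_trans (_ : \sum_(k < n) (B * `|x|) <= _); last first.
  by rewrite sumr_const card_ord -mulrA mulr_natl.
apply: ler_sum => k _; rewrite normrM mulrC.
by apply: ler_pM => //; exact: coord_le_norm.
Qed.

Section box.
Context (B : R) (B0 : 0 < B).
Local Notation inB x := (forall j, `|x ord0 j| <= B).

Lemma half_sq_box x : inB x -> `|half_sq x| <= n%:R * B ^+ 2.
Proof.
move=> xB; rewrite /half_sq normrM ger0_norm ?sumr_ge0//; last first.
  by move=> k _; rewrite -expr2 sqr_ge0.
have : dotv x x <= n%:R * B ^+ 2.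
  rewrite -[n in leRHS]card_ord mulr_natl -sumr_const; apply: ler_sum => k _.
  rewrite -expr2 -real_normK ?num_real// lerXn2r ?nnegrE ?xB//.
  exact: le_trans (xB k).
have : 0 <= n%:R * B ^+ 2 by rewrite mulr_ge0// sqr_ge0.
rewrite ger0_norm//; lra.
Qed.

Lemma half_sq_lip x y : inB x -> inB y ->
  `|half_sq x - half_sq y| <= n%:R * B * `|x - y|.
Proof.
move=> xB yB.
have -> : half_sq x - half_sq y = dotv (x - y) (2^-1 *: (x + y)).
  rewrite /half_sq dotvBl !(dotvC _ (_ *: _)) !dotvZl !dotvDl (dotvC y x); lra.
apply: ler_dotv => j; rewrite !mxE normrM ger0_norm//.
have := ler_normD (x ord0 j) (y ord0 j); have := xB j; have := yB j; lra.
Qed.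

Lemma half_sqdist_box x y : inB x -> inB y ->
  sqdist x y / 2 <= n%:R * (2 * B) ^+ 2.
Proof.
move=> xB yB.
have H : `|sqdist x y / 2| <= n%:R * (2 * B) ^+ 2; last exact: le_trans (ler_norm _) H.
rewrite /sqdist normrM ger0_norm ?sumr_ge0//; last first.
  by move=> k _; rewrite -expr2 sqr_ge0.
have : dotv (x - y) (x - y) <= n%:R * (2 * B) ^+ 2.
  rewrite -[n in leRHS]card_ord mulr_natl -sumr_const; apply: ler_sum => k _.
  rewrite -expr2 -real_normK ?num_real// lerXn2r ?nnegrE//; first by rewrite mulr_ge0 ?ltW.
  rewrite !mxE; apply: le_trans (ler_normB _ _) _.
  by have := xB k; have := yB k; lra.
have : 0 <= n%:R * (2 * B) ^+ 2 by rewrite mulr_ge0// sqr_ge0.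
rewrite ger0_norm//; lra.
Qed.

Lemma half_sqdist_lipl x x' y : inB x -> inB x' -> inB y ->
  `|sqdist x y / 2 - sqdist x' y / 2| <= 2 * n%:R * B * `|x - x'|.
Proof.
move=> xB x'B yB; rewrite !half_sqdist.
have -> : half_sq x + half_sq y - dotv x y - (half_sq x' + half_sq y - dotv x' y) =
  (half_sq x - half_sq x') - dotv (x - x') y by rewrite dotvBl; lra.
apply: le_trans (ler_normB _ _) _.
have := half_sq_lip xB x'B; have := ler_dotv (x - x') yB; lra.
Qed.

(** The bound is a sum over coordinates because the widths of the cells will be estimated one
    coordinate at a time. *)
Lemma half_sqdist_osc x y y' : inB x -> inB y -> inB y' ->
  sqdist x y / 2 - sqdist x y' / 2 <= 2 * B * \sum_k `|y ord0 k - y' ord0 k|.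
Proof.
move=> xB yB y'B; rewrite /sqdist /dotv -mulrBl -sumrB mulr_suml mulr_sumr.
apply: ler_sum => k _; rewrite !mxE.
have [/andP[x1 x2] /andP[y1 y2] /andP[y1' y2']] :
  [/\ - B <= x ord0 k <= B, - B <= y ord0 k <= B & - B <= y' ord0 k <= B].
  by split; rewrite -ler_norml.
have [h|h] := lerP 0 (y ord0 k - y' ord0 k).
  by rewrite ger0_norm//; nra.
by rewrite ltr0_norm//; nra.
Qed.

End box.

Lemma measurable_dotv d (T : measurableType d) (f g : T -> E) :
  measurable_fun setT f -> measurable_fun setT g ->
  measurable_fun setT (fun t => dotv (f t) (g t)).
Proof.
move=> mf mg; rewrite /dotv; apply: measurable_sum => k.
by apply: measurable_funM; apply: measurableT_comp (measurable_coord _ _) _.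
Qed.

Lemma measurable_half_sq d (T : measurableType d) (f : T -> E) :
  measurable_fun setT f -> measurable_fun setT (fun t => half_sq (f t)).
Proof. by move=> mf; apply: measurable_funM => //; exact: measurable_dotv. Qed.

Lemma measurable_half_sqdist d (T : measurableType d) (f g : T -> E) :
  measurable_fun setT f -> measurable_fun setT g ->
  measurable_fun setT (fun t => sqdist (f t) (g t) / 2).
Proof.
move=> mf mg.
rewrite (_ : (fun _ => _) = fun t => half_sq (f t) + half_sq (g t) - dotv (f t) (g t)).
  apply: measurable_funB; last exact: measurable_dotv.
  by apply: measurable_funD; exact: measurable_half_sq.
by apply/funext => t; rewrite half_sqdist.
Qed.

Lemma within_continuous_measurable_rV (Z : set E) (f : E -> R) : measurable Z ->
  {within Z, continuous f} -> measurable_fun Z f.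
Proof.
move=> mZ /continuousP cf.
apply: (measurability _ (measurable_realfun.RGenOpens.measurableE R)) => //.
move=> _ [_ [a [b ->]] <-].
have oab : open (`]a, b[%classic : set R) by exact: interval_open.
have /open_subspaceP[U oU UE] := cf _ oab.
rewrite setIC -UE; apply: measurableI => //; exact: open_measurable_mx.
Qed.

Lemma continuous_measurable_rV (f : E -> R) : continuous f -> measurable_fun setT f.
Proof.
move=> cf; apply: within_continuous_measurable_rV => //.
exact: continuous_subspaceT.
Qed.

Lemma lipschitz_continuous_rV (f : E -> R) (L : R) :
  (forall x y, `|f x - f y| <= L * `|x - y|) -> continuous f.
Proof.
move=> fL x.
apply/(@cvgrPdist_le _ _ _ (nbhs x) (nbhs_filter x)) => e e0.
apply/nbhs_ballP; exists (e / (`|L| + 1)) => /=.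
  by rewrite divr_gt0// ltr_wpDl.
move=> y; rewrite mx_norm_ball /ball_/= => /ltW xy.
apply: le_trans (fL _ _) _; move: xy.
rewrite ler_pdivlMr ?ltr_wpDl// => h; apply: le_trans h.
rewrite mulrC; apply: ler_wpM2l => //.
by rewrite ler_wpDr// ler_norm.
Qed.

Lemma lipschitz_measurable_rV (f : E -> R) (L : R) :
  (forall x y, `|f x - f y| <= L * `|x - y|) -> measurable_fun setT f.
Proof. by move=> /lipschitz_continuous_rV; exact: continuous_measurable_rV. Qed.

Lemma continuous_dist_rV z : continuous (fun x : E => `|x - z|).
Proof.
apply: (@lipschitz_continuous_rV _ 1) => x y; rewrite mul1r.
by apply: le_trans (ler_dist_dist _ _) _; rewrite opprB addrA subrK.
Qed.

Lemma measurable_bigmax d (T : measurableType d) m (F : 'I_m.+1 -> T -> R) :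
  (forall j, measurable_fun setT (F j)) ->
  measurable_fun setT (fun t => \big[Num.max/F ord0 t]_j F j t).
Proof.
move=> mF; rewrite [X in measurable_fun _ X](_ : _ = fun t =>
  \big[Num.max/F ord0 t]_(j <- index_enum 'I_m.+1) F j t)//.
elim: (index_enum _) => [|j s IH].
  by under eq_fun do rewrite big_nil; exact: mF.
by under eq_fun do rewrite big_cons; apply: measurable_maxr.
Qed.

End euclidean.

(** * Scalar inequalities for the logarithm and the entropy *)

Section real_inequalities.
Context (R : realType).

Lemma ln_le_sub1 (x : R) : 0 < x -> ln x <= x - 1.
Proof. by move=> x0; have := @le_ln1Dx R (x - 1); rewrite subrKC; apply; lra. Qed.

Lemma ln_ge_1subV (x : R) : 0 < x -> 1 - x^-1 <= ln x.
Proof.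
move=> x0; have := @ln_le_sub1 x^-1; rewrite invr_gt0 lnV// => /(_ x0); lra.
Qed.

Lemma mul_ln_ge (r : R) : 0 <= r -> r - 1 <= ln r * r.
Proof.
rewrite le_eqVlt => /predU1P[<-|r0]; first by rewrite mulr0; lra.
have := ln_ge_1subV r0.
by rewrite -(ler_pM2r r0) mulrBl mulVf ?gt_eqF// mul1r.
Qed.

(* With [u = Num.sqrt r] and [v = Num.sqrt g], the entropy gap is at least
   [(u - v) ^+ 2], and [|r - g| = |u - v| * (u + v)]. *)
Lemma dist_le_entropy (r g dl : R) : 0 <= r -> 0 < g -> 0 < dl ->
  `|r - g| <= (ln r * r - r * ln g - r + g) / (2 * dl) + dl * (r + g).
Proof.
move=> r0 g0 dl0; set u := Num.sqrt r; set v := Num.sqrt g.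
have u0 : 0 <= u by exact: sqrtr_ge0.
have v0 : 0 < v by rewrite sqrtr_gt0.
have rE : r = u ^+ 2 by rewrite sqr_sqrtr.
have gE : g = v ^+ 2 by rewrite sqr_sqrtr// ltW.
have gap : (u - v) ^+ 2 <= ln r * r - r * ln g - r + g.
  have [u_eq0|u_neq0] := eqVneq u 0.
    by rewrite rE gE u_eq0 expr0n/= !mulr0 mul0r; lra.
  have u1 : 0 < u by rewrite lt0r u_neq0.
  rewrite rE gE !lnXn// -mulr_natl -[ln v *+ 2]mulr_natl.
  (* Multiplied by [- 2 * u ^+ 2], this gives [r * ln r - r * ln g >= 2 * u ^+ 2 - 2 * u * v];
     adding [v ^+ 2 - u ^+ 2] completes the square. *)
  have : ln (v / u) <= v / u - 1 by apply: ln_le_sub1; rewrite divr_gt0.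
  rewrite ln_div// -(ler_pM2r (exprn_gt0 2 u1)).
  have -> : (v / u - 1) * u ^+ 2 = v * u - u ^+ 2 by field.
  by nra.
(* Young's inequality with weight [dl] for the product of [|u - v|] and [u + v]. *)
have : `|r - g| <= (u - v) ^+ 2 / (2 * dl) + dl / 2 * (u + v) ^+ 2.
  have -> : r - g = (u - v) * (u + v) by rewrite rE gE; ring.
  rewrite normrM (ger0_norm (_ : 0 <= u + v)); last by rewrite addr_ge0// ltW.
  rewrite -[(u - v) ^+ 2]real_normK ?num_real//.
  set a := `|u - v|; set b := u + v.
  have -> : a ^+ 2 / (2 * dl) + dl / 2 * b ^+ 2 =
    a * b + (a - dl * b) ^+ 2 / (2 * dl) by field; lra.
  by rewrite lerDl divr_ge0 ?sqr_ge0// mulr_ge0// ltW.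
move=> /le_trans; apply; apply: lerD.
  by rewrite ler_pM2r// invr_gt0 mulr_gt0.
rewrite -mulrA ler_pM2l// rE gE; have : 0 <= (u - v) ^+ 2 by exact: sqr_ge0.
by nra.
Qed.

End real_inequalities.

(** * Second differences of convex Lipschitz functions *)

Section translation.
Context (R : realType).

Lemma lebesgue_measure_translate (a : R) (A : set R) : measurable A ->
  lebesgue_measure ((fun x : measurableTypeR R => x + a) @^-1` A) = lebesgue_measure A.
Proof.
move=> mA; apply/esym.
have mt : measurable_fun setT ((fun x => x + a) : measurableTypeR R -> measurableTypeR R).
  exact: measurable_funD.
apply: (@lebesgue_measure_unique R (@measure_function_pushforward__canonical__measure_function_Measure
    _ _ _ _ _ (@lebesgue_measure R) _ mt)) => // _ [[b c]] _ <- /=.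
rewrite /pushforward (_ : _ @^-1` _ = `]b - a, c - a]%classic); last first.
  by apply/seteqP; split => x /=; rewrite !in_itv/= ltrBlDr lerBrDr.
rewrite !lebesgue_measure_itv/= !lte_fin ltrD2r; case: ifP => // _.
by congr EFin; lra.
Qed.

(** By induction on [n]: the translated product measure agrees with the original one on rectangles,
    and these determine it. *)
Lemma lebesgue_rV_translate n (v : 'rV[R]_n) (A : set 'rV[R]_n) : measurable A ->
  lebesgue_rV R n ((fun x => x + v) @^-1` A) = lebesgue_rV R n A.
Proof.
elim: n v A => [|n IH] v A mA.
  rewrite (_ : _ @^-1` _ = A)//; apply/seteqP.
  by split => x /=; have -> : x + v = x by apply/rowP => -[].
rewrite /= /rV_cons_measure /pushforward.
set C := rV_cons (n:=n) @^-1` A.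
have mC : measurable C.
  by rewrite -[C]setTI; apply: measurable_rV_cons.
(* The translation by [v], read in the coordinates head and tail. *)
pose tau (z : measurableTypeR R * 'rV[R]_n) : measurableTypeR R * 'rV[R]_n :=
  (z.1 + v ord0 ord0, z.2 + (rV_uncons v).2).
have mtau : measurable_fun setT tau.
  apply: measurable_fun_pair.
    exact: measurable_funD.
  apply: measurable_rV => j; under eq_fun do rewrite mxE.
  apply: measurable_funD => //.
  exact: measurableT_comp (measurable_coord _ _) _.
rewrite (_ : _ @^-1` (_ @^-1` A) = tau @^-1` C); last first.
  apply/seteqP; split => -[x w] /=; rewrite /C/= => h.
    rewrite (_ : rV_cons _ = rV_cons (x, w) + v)//.
    apply/rowP => j; rewrite !mxE/=; case: unliftP => [k ->|->] //=.
    by rewrite !mxE.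
  rewrite (_ : rV_cons _ + v = rV_cons (tau (x, w)))//.
  apply/rowP => j; rewrite !mxE/=; case: unliftP => [k ->|->] //=.
  by rewrite !mxE.
pose M := @measure_function_pushforward__canonical__measure_function_Measure
    _ _ _ _ _ (@lebesgue_measure R \x lebesgue_rV R n)%E _ mtau.
suff ME : forall X, measurable X -> (@lebesgue_measure R \x lebesgue_rV R n)%E X = M X.
  exact: esym (ME C mC).
apply: product_measure_unique => A1 A2 mA1 mA2.
rewrite [LHS](_ : _ = (@lebesgue_measure R \x lebesgue_rV R n)%E
  ((fun x : measurableTypeR R => x + v ord0 ord0) @^-1` A1 `*`
   (fun w => w + (rV_uncons v).2) @^-1` A2))//.
rewrite product_measure1E//; last 2 first.
- rewrite -[X in measurable X]setTI.
  have : measurable_fun setT ((fun x => x + v ord0 ord0) : measurableTypeR R -> measurableTypeR R).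
    exact: measurable_funD.
  exact.
- rewrite -[X in measurable X]setTI.
  have : measurable_fun setT (fun w : 'rV[R]_n => w + (rV_uncons v).2).
    apply: measurable_rV => j; under eq_fun do rewrite mxE.
    by apply: measurable_funD => //; exact: measurable_coord.
  exact.
by rewrite IH//; congr (_ * _)%E; exact: lebesgue_measure_translate.
Qed.

End translation.

(** The epsilon-delta form of absolute continuity, which makes use of sets that are small without
    being null. *)
Lemma dominated_continuous (R : realType) d (T : measurableType d)
    (mu : probability T R) (la : {measure set T -> \bar R}) : mu `<< la ->
  forall e : R, 0 < e -> exists2 dl : R, 0 < dl &
    forall A, measurable A -> (la A < dl%:E)%E -> (mu A < e%:E)%E.
Proof.
move=> mula e e0.
have [P [N PN]] := Hahn_decomposition (charge_of_finite_measure mu).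
have [dl [dl0 dlE]] := charge_variation_continuous PN mula e0.
exists dl => // A mA /(dlE _ mA); apply: le_lt_trans.
by apply: le_trans (abse_charge_variation PN mA); exact: lee_abs.
Qed.

Section second_difference.
Context (R : realType) (n : nat).
Local Notation E := 'rV[R]_n.
Local Notation la := (lebesgue_rV R n).
Local Notation dir k := (delta_mx ord0 k : E).

Lemma norm_delta_le1 k : `|dir k| <= 1.
Proof.
rewrite /Num.norm/= mx_normrE; apply/bigmax_leP; split => // -[i j] _ /=.
by rewrite mxE; case: (_ && _); rewrite ?normr0 ?normr1.
Qed.

Lemma measurable_translate (v : E) : measurable_fun setT (fun x : E => x + v).
Proof.
apply: measurable_rV => j; under eq_fun do rewrite mxE.
by apply: measurable_funD => //; exact: measurable_coord.
Qed.

Let box (a b : E) : set E := [set v | forall j, v ord0 j \in `[a ord0 j, b ord0 j]].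

Let measurable_box a b : measurable (box a b).
Proof.
rewrite (_ : box a b = \bigcap_(j in [set: 'I_n])
    ((fun v : E => v ord0 j) @^-1` `[a ord0 j, b ord0 j]%classic)); last first.
  by apply/seteqP; split => [v vab j _|v vab j]; [exact: vab|exact: (vab j I)].
apply: fin_bigcap_measurable => // j _; rewrite -[X in measurable X]setTI.
by apply: measurable_coord => //; exact: measurable_itv.
Qed.

(** Divided by [t], this bounds the width in coordinate [k] of the subdifferential at [x] of a
    convex function, differentiable or not. *)
Definition second_diff (phi : E -> R) (k : 'I_n) (t : R) (x : E) : R :=
  phi (x + t *: dir k) + phi (x - t *: dir k) - 2 * phi x.

Let Q (B : R) : set E := box (const_mx (- B)) (const_mx B).

Section bound.
Context (B L t : R) (k : 'I_n) (phi : E -> R).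
Hypotheses (B0 : 0 < B) (t0 : 0 < t).
Hypothesis phiL : forall x y, `|phi x - phi y| <= L * `|x - y|.
Hypothesis phi_cvx : forall k t x, 0 <= second_diff phi k t x.

Let L0 : 0 <= L.
Proof.
have := phiL (dir k) 0; rewrite subr0 => h; have {}h := le_trans (normr_ge0 _) h.
have e0 : 0 < `|dir k|.
  by rewrite normr_gt0; apply/eqP => /rowP/(_ k); rewrite !mxE !eqxx; exact/eqP/oner_neq0.
by rewrite -(pmulr_lge0 _ e0).
Qed.

Let phi_step x : `|phi (x + t *: dir k) - phi x| <= L * t.
Proof.
apply: le_trans (phiL _ _) _; rewrite addrAC subrr add0r mx_normZ gtr0_norm//.
by rewrite ler_wpM2l// ler_piMr ?norm_delta_le1// ltW.
Qed.

Let mphi : measurable_fun setT phi.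
Proof. exact: lipschitz_measurable_rV phiL. Qed.

(** The shift by [L * t] puts the increment in [[0, 2 * L * t]], so that integrals of nonnegative
    functions suffice. *)
Let D (x : E) := phi (x + t *: dir k) - phi x + L * t.

Let D_ge0 x : 0 <= D x.
Proof. by have := phi_step x; rewrite /D ler_norml => /andP[]; lra. Qed.

Let D_le x : D x <= 2 * L * t.
Proof. by have := phi_step x; rewrite /D ler_norml => /andP[]; lra. Qed.

Let mD : measurable_fun setT D.
Proof.
apply: measurable_funD => //; apply: measurable_funB => //.
exact: measurableT_comp mphi (measurable_translate _).
Qed.

Lemma measurable_second_diff : measurable_fun setT (second_diff phi k t).
Proof.
apply: measurable_funB; last exact: measurable_funM.
apply: measurable_funD; apply: measurableT_comp mphi _; exact: measurable_translate.
Qed.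

Let second_diffE x : second_diff phi k t x = D x - D (x - t *: dir k).
Proof. by rewrite /second_diff /D subrK; lra. Qed.

Lemma second_diff_le x : second_diff phi k t x <= 2 * L * t.
Proof. by rewrite second_diffE; have := D_le x; have := D_ge0 (x - t *: dir k); lra. Qed.

(* A second difference is a first difference of the increments [D] of [phi];
   by translation invariance its integral telescopes to a boundary layer of
   width [t], which gives a bound of order [t ^+ 2]. *)
Lemma integral_second_diff_le :
  (\int[la]_(x in Q B) (second_diff phi k t x)%:E <=
   (2 * L * t * (t * (2 * B) ^+ n.-1))%:E)%E.
Proof.
have mQ : measurable (Q B) by exact: measurable_box.
have mE (f : E -> R) (A : set E) : measurable_fun setT f ->
    measurable_fun A (fun x => (f x)%:E).
  by move=> mf; apply/measurable_funTS/measurable_EFinP.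
pose W : set E := (fun x => x + t *: dir k) @^-1` Q B.
have mW : measurable W.
  by rewrite -[W]setTI; apply: measurable_translate.
(* The slab of thickness [t] along the face where coordinate [k] equals [B]. A point of the cube
   outside [W] leaves the cube when moved by [t] in direction [k], so it lies in [S]. *)
pose S : set E := box (\row_j if j == k then B - t else - B) (const_mx B).
have mS : measurable S by exact: measurable_box.
have mDt : measurable_fun setT (fun x : E => D (x - t *: dir k)).
  exact: measurableT_comp mD (measurable_translate _).
have shift : (\int[la]_(x in Q B) (D (x - t *: dir k))%:E = \int[la]_(x in W) (D x)%:E)%E.
  have mtr := @measurable_translate (- (t *: dir k)).
  transitivity (\int[pushforward la (fun x : E => (x - t *: dir k)%R)]_(x in W) (D x)%:E)%E.
    rewrite ge0_integral_pushforward//.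
    - congr integral; apply/seteqP; split => x; rewrite /W/= ?subrK//.
    - exact: mE.
    - by move=> x _; rewrite lee_fin.
  apply: (@eq_measure_integral _ _ _ W la (@measure_function_pushforward__canonical__measure_function_Measure
    _ _ _ _ _ la _ mtr)) => A mA _.
  by rewrite /= /pushforward lebesgue_rV_translate.
have lS : la S = (t * (2 * B) ^+ n.-1)%:E.
  rewrite lebesgue_rV_box; last first.
    have NBB : - B <= B by rewrite (le_trans _ (ltW B0))// oppr_le0 ltW.
    by move=> j; rewrite !mxE; case: ifP => _ //; rewrite gerBl ltW.
  congr EFin; rewrite (bigD1 k)//= !mxE eqxx; congr (_ * _).
    by rewrite ?mxE opprB addrC subrK.
  rewrite (eq_bigr (fun=> 2 * B)); last first.
    by move=> j /negbTE jk; rewrite !mxE jk opprK mulr_natl mulr2n.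
  by rewrite prodr_const cardC1 card_ord.
have QWS : Q B `<=` W `|` (S `\` W).
  move=> x Qx; have [Wx|Wx] := pselect (W x); [by left|right; split=> //].
  move=> j; rewrite !mxE; have := Qx j; rewrite !mxE !in_itv/= => /andP[xB1 xB2].
  have [jk|jk] := eqVneq j k; last by rewrite xB1.
  rewrite xB2 andbT leNgt; apply/negP => xk; apply: Wx => i.
  have := Qx i; rewrite !mxE !in_itv/= ?eqxx/=; have [ik|ik] := eqVneq i k.
    rewrite ik -jk mulr1 => /andP[h1 h2]; clear -xk h1 h2 t0.
    by apply/andP; split; [rewrite (le_trans h1)// lerDl ltW|rewrite -lerBrDr ltW].
  by rewrite mulr0 addr0.
(* Finiteness is what allows the integral over [W] to be cancelled from both sides. *)
have fin : (\int[la]_(x in W) (D x)%:E \is a fin_num)%E.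
  rewrite ge0_fin_numE; last by apply: integral_ge0 => x _; rewrite lee_fin.
  apply: le_lt_trans (_ : \int[la]_(x in W) (2 * L * t)%:E < +oo)%E.
    apply: ge0_le_integral => //.
    - by move=> x _; rewrite lee_fin.
    - exact: mE.
    - by move=> x _; rewrite lee_fin D_le.
  rewrite [ltLHS](_ : _ = (2 * L * t)%:E * la (Q B))%E; last first.
    by rewrite integral_cst//; congr (_ * _)%E; exact: lebesgue_rV_translate.
  rewrite lebesgue_rV_box ?ltry//.
  by have NBB : - B <= B by [rewrite (le_trans _ (ltW B0))// oppr_le0 ltW]; move=> j; rewrite !mxE.
rewrite -(leeD2rE _ _ fin) -{1}shift -ge0_integralD//; last 4 first.
- by move=> x _; rewrite lee_fin.
- by apply: mE; exact: measurable_second_diff.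
- by move=> x _; rewrite lee_fin.
- exact: mE.
rewrite (_ : \int[la]_(x in Q B) _ = \int[la]_(x in Q B) (D x)%:E)%E; last first.
  by apply: eq_integral => x _; rewrite -EFinD second_diffE subrK.
apply: (@le_trans _ _ (\int[la]_(x in W `|` (S `\` W)) (D x)%:E)%E).
  apply: ge0_subset_integral => //.
  - by apply: measurableU => //; exact: measurableD.
  - exact: mE.
  - by move=> x _; rewrite lee_fin.
rewrite ge0_integral_setU//; last 4 first.
- exact: measurableD.
- exact: mE.
- by move=> x _; rewrite lee_fin.
- by apply/disj_set2P; rewrite setDE setIC -setIA setICl setI0.
rewrite addeC leeD2r//.
apply: (@le_trans _ _ (\int[la]_(x in S) (2 * L * t)%:E)%E).
  apply: (@le_trans _ _ (\int[la]_(x in S) (D x)%:E)%E).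
    apply: ge0_subset_integral => //; first exact: measurableD.
    - exact: mE.
    - by move=> x _; rewrite lee_fin.
  apply: ge0_le_integral => //.
  - by move=> x _; rewrite lee_fin.
  - exact: mE.
  - by move=> x _; rewrite lee_fin D_le.
rewrite integral_cst// [leRHS]EFinM; apply: lee_wpmul2l.
  by rewrite lee_fin !mulr_ge0// ltW.
by rewrite -lS.
Qed.

End bound.

(* The step [t] does not depend on [phi]: this uniformity is what makes the
   estimate applicable to the potentials of all the discrete problems at once. *)
Lemma second_diff_small (X : set E) (mu : probability E R) (B L eta : R) k :
  measurable X -> 0 < B -> (forall x, X x -> forall j, `|x ord0 j| <= B) ->
  mu `<< la -> 0 < L -> 0 < eta ->
  exists2 t : R, 0 < t & forall phi : E -> R,
    (forall x y, `|phi x - phi y| <= L * `|x - y|) ->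
    (forall k t x, 0 <= second_diff phi k t x) ->
    (\int[mu]_(x in X) (second_diff phi k t x)%:E <= (eta * t)%:E)%E.
Proof.
move=> mX B0 XB mula L0 eta0.
(* A set of [mu]-measure at most [eta / (4 * L)] contributes at most [eta * t / 2], since a second
   difference never exceeds [2 * L * t]. *)
have e0 : 0 < eta / (4 * L) by rewrite divr_gt0// mulr_gt0.
have [dl dl0 dlP] := dominated_continuous mula e0.
(* By Markov's inequality the set where the second difference exceeds [eta * t / 2] has Lebesgue
   measure at most [t * C / eta] in the cube; the choice of [t] makes this [dl / 2]. *)
pose C := 4 * L * (2 * B) ^+ n.-1.
have C0 : 0 < C by rewrite /C mulr_gt0 ?exprn_gt0 ?mulr_gt0.
pose t := eta * dl / (2 * C).
have t0 : 0 < t by apply: divr_gt0; apply: mulr_gt0.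
have tC : t * C < eta * dl.
  rewrite (_ : t * C = eta * dl / 2); last by rewrite /t; field; rewrite gt_eqF.
  have : 0 < eta * dl by rewrite mulr_gt0.
  lra.
have et0 : 0 < eta * t / 2 by apply: divr_gt0 => //; apply: mulr_gt0.
have Lt0 : 0 <= 2 * L * t.
  by apply/ltW; apply: mulr_gt0 => //; apply: mulr_gt0.
exists t => // phi phiL phi_cvx.
have mS : measurable_fun setT (second_diff phi k t).
  exact: measurable_second_diff phiL.
have mSE A : measurable_fun A (fun x => (second_diff phi k t x)%:E).
  exact/measurable_funTS/measurable_EFinP.
pose A := Q B `&` [set x | eta * t / 2 < second_diff phi k t x].
have mQ : measurable (Q B) by exact: measurable_box.
have mA : measurable A.
  apply: measurableI => //.
  rewrite (_ : [set x | _] = second_diff phi k t @^-1` `]eta * t / 2, +oo[%classic).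
    by rewrite -[X in measurable X]setTI; apply: mS => //; exact: measurable_itv.
  by apply/seteqP; split => x /=; rewrite in_itv/= andbT.
have laA : (la A < dl%:E)%E.
  have : ((eta * t / 2)%:E * la A <= (2 * L * t * (t * (2 * B) ^+ n.-1))%:E)%E.
    have isd := @integral_second_diff_le B L t k phi B0 t0 phiL phi_cvx.
    apply: (le_trans _ isd).
    rewrite -integral_cst//.
    apply: (@le_trans _ _ (\int[la]_(x in A) (second_diff phi k t x)%:E)%E).
      apply: ge0_le_integral => //.
      - by move=> x _; rewrite lee_fin; exact: ltW.
      - by move=> x [_ /ltW]; rewrite lee_fin.
    apply: ge0_subset_integral => //.
    - by move=> x _; rewrite lee_fin.
    - by move=> x [].
  rewrite muleC -lee_pdivlMr//; move=> /le_lt_trans; apply.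
  rewrite -EFinM lte_fin ltr_pdivrMr//.
  rewrite -(ltr_pM2r t0) in tC.
  have -> : 2 * L * t * (t * (2 * B) ^+ n.-1) = t * C * t / 2 by rewrite /C; field.
  lra.
have muA := dlP _ mA laA.
have XQ : X `<=` Q B.
  by move=> x Xx j; rewrite !mxE in_itv/= -ler_norml XB.
have mi : measurable_fun X (fun x => (2 * L * t * \1_A x)%:E).
  by apply/measurable_EFinP; apply: measurable_funM => //; exact: measurable_indic.
apply: (@le_trans _ _ (\int[mu]_(x in X) ((eta * t / 2)%:E + (2 * L * t * \1_A x)%:E))%E).
  apply: ge0_le_integral => //.
  - by move=> x _; rewrite lee_fin.
  - by apply: emeasurable_funD.
  - move=> x Xx; rewrite -EFinD lee_fin indicE; have [xA|xA] := boolP (x \in A).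
      rewrite mulr1; have := @second_diff_le L t k phi t0 phiL x.
      lra.
    rewrite mulr0 addr0 leNgt; apply: contra xA => h.
    by rewrite inE; split => //; exact: XQ.
rewrite ge0_integralD//; last 2 first.
- by move=> x _; rewrite lee_fin; exact: ltW.
- by move=> x _; rewrite lee_fin mulr_ge0// indicE ler0n.
rewrite integral_cst//.
under eq_integral do rewrite EFinM.
rewrite ge0_integralZl_EFin//; last by apply/measurable_EFinP; exact: measurable_indic.
rewrite integral_indic//.
apply: (@le_trans _ _ ((eta * t / 2)%:E * 1 + (2 * L * t)%:E * (eta / (4 * L))%:E)%E).
  apply: leeD.
    rewrite lee_wpmul2l//; last exact: probability_le1.
    by rewrite lee_fin; exact: ltW.
  apply: lee_wpmul2l; first by rewrite lee_fin.
  apply: le_trans (ltW muA); apply: le_measure; rewrite ?inE//.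
  exact: measurableI.
rewrite mule1 -EFinM -EFinD lee_fin.
have -> : 2 * L * t * (eta / (4 * L)) = eta * t / 2 by field; rewrite gt_eqF.
lra.
Qed.

End second_difference.

(** * Transport to the empirical measures *)

Section continuity.
Context (R : realType) (T : topologicalType).

Lemma continuous_maxr (f g : T -> R) : continuous f -> continuous g ->
  continuous (fun x => Num.max (f x) (g x)).
Proof.
move=> cf cg; under eq_fun do rewrite maxr_absE.
move=> x; apply: cvgM; last exact: cvg_cst.
apply: cvgD; first by apply: cvgD; [exact: cf|exact: cg].
by apply: cvg_norm; apply: cvgB; [exact: cf|exact: cg].
Qed.

Lemma continuousB_fun (f g : T -> R) : continuous f -> continuous g ->
  continuous (fun x => f x - g x).
Proof. by move=> cf cg x; apply: cvgB; [exact: cf|exact: cg]. Qed.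

Lemma continuous_div_fun (f g : T -> R) : continuous f -> continuous g ->
  (forall x, g x != 0) -> continuous (fun x => f x / g x).
Proof.
move=> cf cg g0 x; apply: cvgM; first exact: cf.
by apply: cvgV => //; exact: cg.
Qed.

Lemma continuous_sumr (I : Type) (s : seq I) (f : I -> T -> R) :
  (forall i, continuous (f i)) -> continuous (fun x => \sum_(i <- s) f i x).
Proof.
move=> cf; elim: s => [|i s IH].
  by under eq_fun do rewrite big_nil; move=> x; exact: cvg_cst.
under eq_fun do rewrite big_cons.
by move=> x; apply: cvgD; [exact: cf|exact: IH].
Qed.

End continuity.

(** * Sets of full measure for a probability measure *)

Section full_measure.
Context d (T : measurableType d) (R : realType) (P : probability T R) (X : set T).
Hypotheses (mX : measurable X) (PX : P X = 1%E).

Lemma probability_setC_full : P (~` X) = 0%E.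
Proof. by rewrite probability_setC// PX subee. Qed.

Lemma probability_setI_full A : measurable A -> P (A `&` X) = P A.
Proof.
move=> mA; have PD0 : P (A `\` X) = 0%E.
  apply: (subset_measure0 _ _ _ probability_setC_full); [|exact: measurableC|].
    exact: measurableD.
  by move=> x [].
apply/esym/(etrans (measureDI P mA mX)); rewrite -[RHS]add0e.
by congr (_ + _)%E; exact: PD0.
Qed.

Lemma ge0_integral_full (f : T -> \bar R) : measurable_fun setT f ->
  (forall x, 0 <= f x)%E -> (\int[P]_(x in X) f x = \int[P]_x f x)%E.
Proof.
move=> mf f0; rewrite [RHS](@ge0_negligible_integral _ _ _ _ _ (~` X))//.
- by rewrite setTD setCK.
- exact: measurableC.
- exact: probability_setC_full.
Qed.

Lemma integral_cst_full (c : \bar R) : (\int[P]_(x in X) c = c)%E.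
Proof.
apply: etrans (integral_cst _ mX c) _; rewrite -[RHS]mule1.
by congr (_ * _)%E; exact: PX.
Qed.

Lemma full_measure_nonempty : X !=set0.
Proof.
apply/set0P; apply/negP => /eqP X0; have := PX.
by rewrite X0 measure0 => /eqP; rewrite eq_sym onee_eq0.
Qed.

End full_measure.

Section transport.
Context (R : realType) (n : nat).
Local Notation E := 'rV[R]_n.
Context (X : set E) (mu : probability E R) (p : forall N : nat, 'I_N -> E) (B : R).
Arguments p : clear implicits.
Hypotheses (mX : measurable X) (B0 : 0 < B).
Hypothesis XB : forall x, X x -> forall j, `|x ord0 j| <= B.
Hypotheses (muX : mu X = 1%E) (pX : forall N i, X (p N i)).
Hypothesis p_cvg : weak_cvg_on X (fun N => empirical (p N)) mu.

Lemma ge0_empirical_integral N (q : 'I_N -> E) (f : E -> R) :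
  (forall i, X (q i)) -> measurable_fun setT f -> (forall x, 0 <= f x) ->
  (\int[empirical q]_(x in X) (f x)%:E = (N%:R^-1 * \sum_i f (q i))%:E)%E.
Proof.
move=> qX mf f0; have mEf : measurable_fun X (fun x => (f x)%:E).
  exact/measurable_funTS/measurable_EFinP.
rewrite empiricalE ge0_integral_mscale//; last first.
  by move=> x _; rewrite lee_fin.
rewrite EFinM -sumEFin; congr (_ * _)%E.
rewrite ge0_integral_measure_sum//; last by move=> x _; rewrite lee_fin.
apply: eq_bigr => i _; rewrite (nth_map i) ?size_enum_ord// nth_ord_enum.
by rewrite integral_dirac// diracE mem_set// mul1e.
Qed.

Lemma norm_le_box (x : E) : (forall j, `|x ord0 j| <= B) -> `|x| <= B.
Proof.
move=> xB; rewrite /Num.norm/= mx_normrE; apply/bigmax_leP.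
by split; [exact: ltW|move=> -[i j] _ /=; rewrite ord1].
Qed.

Lemma dist_le_box x y : X x -> X y -> `|x - y| <= 2 * B.
Proof.
move=> Xx Xy; apply: le_trans (ler_normB _ _) _.
by rewrite mulr_natl mulr2n lerD// norm_le_box//; exact: XB.
Qed.

Lemma finite_net (e : R) : 0 < e ->
  exists zs : seq E, forall x, X x -> exists2 z, z \in zs & `|x - z| < e.
Proof.
move=> e0.
have : compact [set v : E | forall i, v ord0 i \in `[- B, B]].
  by apply: (@rV_compact _ _ (fun=> `[- B, B]%classic)) => _; exact: segment_compact.
rewrite compact_cover => /(_ E setT (fun z => ball z e)) [||D _ DX].
- by move=> z _; exact: ball_open.
- by move=> x _; exists x => //; exact: ballxx.
exists (finmap.enum_fset D) => x Xx.
have [|z /= zD] := DX x; first by move=> i; rewrite /= in_itv/= -ler_norml XB.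
by rewrite mx_norm_ball /ball_/= distrC => zx; exists z.
Qed.

Section partition_of_unity.
Context (e : R) (zs : seq E).
Hypothesis e0 : 0 < e.
Hypothesis net : forall x, X x -> exists2 z, z \in zs & `|x - z| < e.

(** The slope is such that the tent is at least [e] within distance [e] of [z], where the net
    condition places some center, and vanishes from distance [2 * e] on. *)
Definition tent (z x : E) : R := Num.max 0 (2 * e - `|x - z|).

(** On [X] the sum is at least [e], so the maximum is the sum and a partition of unity results.
    Elsewhere the maximum keeps the denominator positive, hence the quotient continuous on the whole
    space. *)
Definition tent_part (z x : E) : R :=
  tent z x / Num.max e (\sum_(z' <- zs) tent z' x).

Lemma tent_ge0 z x : 0 <= tent z x.
Proof. by rewrite /tent le_max lexx. Qed.

Let den_gt0 x : 0 < Num.max e (\sum_(z' <- zs) tent z' x).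
Proof. by rewrite lt_max e0. Qed.

Lemma tent_part_ge0 z x : 0 <= tent_part z x.
Proof. by rewrite divr_ge0 ?tent_ge0// ltW. Qed.

Lemma tent_part_far z x : 2 * e <= `|x - z| -> tent_part z x = 0.
Proof.
by move=> h; rewrite /tent_part /tent max_l ?mul0r// subr_le0.
Qed.

Lemma tent_part_sum x : X x -> \sum_(z <- zs) tent_part z x = 1.
Proof.
move=> /net[z zzs xz]; rewrite -mulr_suml max_r ?divff//; last first.
  apply: (@le_trans _ _ (tent z x)).
    have : e <= 2 * e - `|x - z| by rewrite lerBrDr mulr_natl mulr2n lerD2l ltW.
    by rewrite /tent le_max => ->; rewrite orbT.
  rewrite (perm_big _ (perm_to_rem zzs)) big_cons lerDl.
  by apply: sumr_ge0 => ? _; exact: tent_ge0.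
apply: lt0r_neq0; apply: (@lt_le_trans _ _ (tent z x)).
  have : 0 < 2 * e - `|x - z|.
    by rewrite subr_gt0 mulr_natl mulr2n (lt_trans xz)// ltrDl.
  by rewrite /tent lt_max => ->; rewrite orbT.
rewrite (perm_big _ (perm_to_rem zzs)) big_cons lerDl.
by apply: sumr_ge0 => ? _; exact: tent_ge0.
Qed.

Let continuous_tent z : continuous (tent z).
Proof.
apply: continuous_maxr; first exact: cst_continuous.
exact: (continuousB_fun (@cst_continuous _ _ _) (@continuous_dist_rV _ _ z)).
Qed.

Lemma continuous_tent_part z : continuous (tent_part z).
Proof.
apply: continuous_div_fun; first exact: continuous_tent.
  apply: continuous_maxr; first exact: cst_continuous.
  exact: continuous_sumr.
by move=> x; rewrite gt_eqF.
Qed.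

Lemma measurable_tent_part z : measurable_fun setT (tent_part z).
Proof. by apply: continuous_measurable_rV; exact: continuous_tent_part. Qed.

Let mEtent A z : measurable_fun A (fun x => (tent_part z x)%:E).
Proof.
by apply/measurable_funTS/measurable_EFinP; exact: measurable_tent_part.
Qed.

Lemma tent_part_le1 z x : X x -> z \in zs -> tent_part z x <= 1.
Proof.
move=> Xx zzs; rewrite -(tent_part_sum Xx) (perm_big _ (perm_to_rem zzs)) big_cons.
rewrite lerDl; apply: sumr_ge0 => y _; exact: tent_part_ge0.
Qed.

Definition tent_mass (z : E) : R := \int[mu]_(x in X) tent_part z x.

Lemma tent_massE z : z \in zs -> (\int[mu]_(x in X) (tent_part z x)%:E = (tent_mass z)%:E)%E.
Proof.
move=> zzs; rewrite /tent_mass /Rintegral fineK// ge0_fin_numE; last first.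
  by apply: integral_ge0 => x _; rewrite lee_fin tent_part_ge0.
apply: (@le_lt_trans _ _ (\int[mu]_(x in X) 1)%E); last first.
  by rewrite integral_cst_full// ltry.
apply: ge0_le_integral => //.
- by move=> x _; rewrite lee_fin tent_part_ge0.
- by move=> x Xx; rewrite lee_fin tent_part_le1.
Qed.

Lemma integral_tent_comb (a : E -> R) (b : R) : (forall z, 0 <= a z) -> 0 <= b ->
  (\int[mu]_(x in X) (\sum_(z <- zs) a z * tent_part z x + b)%:E =
   (\sum_(z <- zs) a z * tent_mass z + b)%:E)%E.
Proof.
move=> a0 b0; under eq_integral do rewrite EFinD -sumEFin.
have m1 z : measurable_fun X (fun x => (a z * tent_part z x)%:E).
  apply/measurable_funTS/measurable_EFinP; apply: measurable_funM => //.
  exact: measurable_tent_part.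
have p1 z x : (0 <= (a z * tent_part z x)%:E)%E.
  by rewrite lee_fin mulr_ge0// tent_part_ge0.
rewrite ge0_integralD//.
- rewrite ge0_integral_sum// integral_cst_full// EFinD -sumEFin.
  congr (_ + _)%E; rewrite !big_seq; apply: eq_bigr => z zzs.
  under eq_integral do rewrite EFinM.
  rewrite ge0_integralZl_EFin// ?tent_massE//.
  by move=> x _; rewrite lee_fin tent_part_ge0.
- by move=> x _; apply: sume_ge0.
- exact: emeasurable_sum.
Qed.

Lemma tent_mass_ge0 z : 0 <= tent_mass z.
Proof. by apply: Rintegral_ge0 => x _; exact: tent_part_ge0. Qed.

Lemma tent_mass_sum : \sum_(z <- zs) tent_mass z = 1.
Proof.
have := @integral_tent_comb (fun=> 1) 0 (fun=> ler01) (lexx _).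
rewrite addr0; under [X in _ = X%:E]eq_bigr do rewrite mul1r.
rewrite (eq_integral (fun=> 1%E)); last first.
  move=> x /[!inE] Xx; rewrite addr0; under eq_bigr do rewrite mul1r.
  by rewrite tent_part_sum.
by rewrite integral_cst_full// => -[].
Qed.

Definition tent_mean N (z : E) : R := N%:R^-1 * \sum_i tent_part z (p N i).

(** Weak convergence gives closeness of the masses; the factor [th < 1] turns it into a one-sided
    bound, which is trivial for tents of mass 0. The finitely many tents are treated one after the
    other. *)
Lemma tent_mean_near (th : R) : 0 < th < 1 -> \forall N \near \oo,
  forall z, z \in zs -> th * tent_mass z <= tent_mean N z.
Proof.
move=> /andP[th0 th1].
suff H : forall s : seq E, {subset s <= zs} -> \forall N \near \oo,
    forall z, z \in s -> th * tent_mass z <= tent_mean N z by exact: (H zs).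
elim => [_|z s IH szs]; first by near=> N => z; rewrite in_nil.
have zzs : z \in zs by rewrite szs// mem_head.
have /IH{}IH : {subset s <= zs} by move=> y ys; rewrite szs// in_cons ys orbT.
have {}H : \forall N \near \oo, th * tent_mass z <= tent_mean N z.
  have [u0|u0] := eqVneq (tent_mass z) 0.
    near=> N; rewrite u0 mulr0 mulr_ge0// ?invr_ge0//.
    by apply: sumr_ge0 => i _; exact: tent_part_ge0.
  have ct : {within X, continuous (tent_part z)}.
    by apply: continuous_subspaceT; exact: continuous_tent_part.
  have bt : [bounded tent_part z x | x in X].
    exists 1; split => // M M1 x Xx.
    by rewrite /= ger0_norm ?tent_part_ge0// (le_trans (tent_part_le1 Xx zzs))// ltW.
  have {}H := p_cvg ct bt.
  have : (tent_mean N z)%:E @[N --> \oo] --> (tent_mass z)%:E.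
    rewrite -tent_massE//; apply: cvg_trans H; apply: near_eq_cvg; near=> N.
    by rewrite ge0_empirical_integral//; [exact: measurable_tent_part|exact: tent_part_ge0].
  move=> /fine_cvgP[_ cv].
  have : th * tent_mass z < tent_mass z.
    by rewrite gtr_pMl// lt0r u0 tent_mass_ge0.
  move=> /(cvgr_gt _ cv); apply: filterS => N /=.
  by rewrite /comp/= => /ltW.
near=> N => y; rewrite in_cons => /predU1P[->|ys]; first by near: N.
by move: y ys; near: N.
Unshelve. all: by end_near. Qed.

End partition_of_unity.

(** A coupling of [mu] with the empirical measure, disintegrated over [x]: [t i x] is the fraction
    of the mass at [x] sent to [p N i]. The last condition bounds its cost for the distance. *)
Definition transport_weights N (e : R) (t : 'I_N -> E -> R) :=
  [/\ (forall i, measurable_fun setT (t i)), (forall i x, 0 <= t i x),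
    (forall x, X x -> \sum_i t i x = 1),
    (forall i, \int[mu]_(x in X) (t i x)%:E = (N%:R^-1)%:E)%E &
    (\sum_i \int[mu]_(x in X) (`|x - p N i| * t i x)%:E <= e%:E)%E].

(* The sets where two tents overlap have diameter at most [4 * e], and the
   fraction [th] of the mass is exchanged tent by tent; the remaining mass
   [1 - th], which absorbs the difference between the masses that [mu] and the
   empirical measure give to the tents, is moved arbitrarily. *)
Lemma transport_weights_exist (e : R) : 0 < e ->
  (* Two points of the same tent of radius [2 * e1] are at distance at most [4 * e1 = e / 2]. *)
  \forall N \near \oo, exists t : 'I_N -> E -> R, transport_weights e t.
Proof.
move=> e0; pose e1 := e / 8.
have e10 : 0 < e1 by rewrite divr_gt0.
have [zs net] := finite_net e10.
(* The mass [1 - th] travels at most [2 * B], and this [th] keeps the resulting cost below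
   [e / 2]. *)
pose th := 1 - Num.min (1 / 2) (e / (4 * B)).
have B4 : 0 < 4 * B by rewrite mulr_gt0.
have th01 : 0 < th < 1.
  rewrite /th; have m1 : Num.min (1 / 2) (e / (4 * B)) <= 1 / 2 by rewrite ge_min lexx.
  have m2 : 0 < Num.min (1 / 2) (e / (4 * B)) by rewrite lt_min !divr_gt0.
  by apply/andP; split; lra.
have thB : 2 * B * (1 - th) <= e / 2.
  rewrite /th subKr.
  apply: (@le_trans _ _ (2 * B * (e / (4 * B)))).
    by apply: ler_wpM2l; [rewrite mulr_ge0// ltW|rewrite ge_min lexx orbT].
  rewrite le_eqVlt; apply/orP; left; apply/eqP; field; by rewrite gt_eqF.
have /andP[th0 th1] := th01.
near=> N.
have N0 : (0 < N)%N by near: N; exact: nbhs_infty_gt.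
have wN : forall z, z \in zs -> th * tent_mass e1 zs z <= tent_mean e1 zs N z.
  by near: N; exact: tent_mean_near.
have N1 : N%:R != 0 :> R by rewrite pnatr_eq0 -lt0n.
pose u := tent_mass e1 zs; pose w := tent_mean e1 zs N.
pose chi := tent_part e1 zs.
have chi0 z x : 0 <= chi z x by exact: tent_part_ge0.
have w0 z : 0 <= w z.
  by rewrite mulr_ge0// ?invr_ge0//; apply: sumr_ge0 => i _; exact: tent_part_ge0.
have uw0 z : z \in zs -> w z = 0 -> u z = 0.
  move=> zzs wz; apply/eqP; rewrite eq_le tent_mass_ge0// andbT.
  by have := wN _ zzs; rewrite -/w -/u wz pmulr_rle0.
(* The distribution of tent [z] among the points, normalized to have mean 1. If [w z = 0] then
   [u z = 0] as well, so any choice of mean 1 works. *)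
pose c z i := if w z == 0 then 1 else chi z (p N i) / w z.
have c0 z i : 0 <= c z i by rewrite /c; case: ifP => // _; rewrite divr_ge0.
have csum z : \sum_i N%:R^-1 * c z i = 1.
  rewrite -mulr_sumr /c; have [wz|wz] := eqVneq (w z) 0.
    by rewrite sumr_const card_ord mulVf.
  by rewrite -mulr_suml mulrA -/(w z) divff.
pose I i := N%:R^-1 * \sum_(z <- zs) u z * c z i.
(* Since [th * u z <= w z], point [i] receives from the tents at most [N^-1] times the sum of the
   [chi z (p N i)], which is 1. What is missing to [N^-1] is filled by a term constant in [x]. *)
have Ile i : th * I i <= N%:R^-1.
  rewrite /I mulrCA ler_piMr ?invr_ge0// mulr_sumr.
  rewrite -(@tent_part_sum e1 zs e10 net _ (@pX N i)) !big_seq; apply: ler_sum => z zzs.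
  rewrite mulrA /c; case: ifPn => [/eqP wz|wz]; first by rewrite uw0// mulr0 mul0r.
  rewrite mulrCA ler_piMr// ler_pdivrMr ?mul1r ?wN//.
  by rewrite lt0r wz w0.
have I0 i : 0 <= N%:R^-1 - th * I i by rewrite subr_ge0.
have Nth0 : 0 <= th * N%:R^-1 by rewrite mulr_ge0 ?invr_ge0// ltW.
pose t i x := \sum_(z <- zs) (th * N%:R^-1 * c z i) * chi z x + (N%:R^-1 - th * I i).
have tE i x : t i x = \sum_(z <- zs) (th * N%:R^-1 * c z i) * chi z x + (N%:R^-1 - th * I i) by [].
have Isum : \sum_i I i = 1.
  under eq_bigr do rewrite /I mulr_sumr.
  rewrite exchange_big/=; apply: etrans (tent_mass_sum e10 net); apply: eq_bigr => z _.
  under eq_bigr do rewrite mulrCA.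
  by rewrite -mulr_sumr csum mulr1.
have Rsum : \sum_i (N%:R^-1 - th * I i) = 1 - th.
  rewrite sumrB -mulr_sumr Isum mulr1 sumr_const card_ord -[_^-1 *+ N]mulr_natl divff//.
have mt i : measurable_fun setT (t i).
  apply: measurable_funD => //; apply: measurable_sum => z.
  by apply: measurable_funM => //; exact: measurable_tent_part.
have t0 i x : 0 <= t i x.
  rewrite addr_ge0//; apply: sumr_ge0 => z _; apply: mulr_ge0 => //; exact: mulr_ge0.
exists t; split => //.
- move=> x Xx; rewrite big_split/= Rsum exchange_big/=.
  rewrite (eq_bigr (fun z => th * chi z x)); last first.
    move=> z _; rewrite -mulr_suml; under eq_bigr do rewrite -mulrA.
    by rewrite -mulr_sumr csum mulr1.
  by rewrite -mulr_sumr tent_part_sum// mulr1 subrKC.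
- move=> i; rewrite /t (integral_tent_comb e10 net)//; last first.
    by move=> z; rewrite mulr_ge0.
  congr EFin; rewrite (_ : \sum_(z <- zs) _ = th * I i) ?subrKC//.
  by rewrite /I !mulr_sumr; apply: eq_bigr => z _; rewrite -/(u z); ring.
(* A bound on the distance travelled inside tent [z]. The crude value for [w z = 0] disappears after
   integration, because then [u z = 0]. *)
- pose k z := e / 2 + 2 * B * (w z == 0)%:R.
  have k0 z : 0 <= k z by rewrite addr_ge0 ?divr_ge0 ?mulr_ge0// ltW.
  apply: (@le_trans _ _ (\sum_i (\sum_(z <- zs) (th * N%:R^-1 * c z i * k z) * u z +
      2 * B * (N%:R^-1 - th * I i))%:E)%E).
    apply: lee_sum => i _; rewrite -(integral_tent_comb e10 net); last 2 first.
    + by move=> z; rewrite !mulr_ge0 ?invr_ge0// ltW.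
    + by rewrite !mulr_ge0// ltW.
    apply: ge0_le_integral => //.
    + by move=> x _; rewrite lee_fin mulr_ge0.
    + apply/measurable_funTS/measurable_EFinP; apply: measurable_funM => //.
      by apply: continuous_measurable_rV; exact: continuous_dist_rV.
    + apply/measurable_funTS/measurable_EFinP; apply: measurable_funD => //.
      apply: measurable_sum => z.
      by apply: measurable_funM => //; exact: measurable_tent_part.
    move=> x Xx; rewrite lee_fin tE mulrDr; apply: lerD; last first.
      by rewrite ler_wpM2r// dist_le_box.
    rewrite mulr_sumr; apply: ler_sum => z _.
    rewrite (_ : _ * (_ * _) = th * N%:R^-1 * (`|x - p N i| * (c z i * chi z x))); last by ring.
    rewrite (_ : _ * _ * tent_part _ _ _ _ = th * N%:R^-1 * (k z * (c z i * chi z x))); last first.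
      by rewrite /chi; ring.
    apply: ler_wpM2l => //; rewrite /k; have [wz|wz] := eqVneq (w z) 0.
      apply: ler_wpM2r; first exact: mulr_ge0.
      by rewrite mulr1; apply: ler_wpDl; [rewrite ltW// divr_gt0|exact: dist_le_box].
    rewrite mulr0 addr0.
    have [xz|xz] := lerP (2 * e1) (`|x - z|).
      by rewrite /chi tent_part_far// !mulr0.
    have [pz|pz] := lerP (2 * e1) (`|p N i - z|).
      by rewrite /c (negbTE wz) /chi (tent_part_far _ pz) !mul0r !mulr0.
    apply: ler_wpM2r; first exact: mulr_ge0.
    apply: le_trans (ler_distD z _ _) _; rewrite (distrC z).
    apply: le_trans (lerD (ltW xz) (ltW pz)) _.
    by rewrite /e1; lra.
  rewrite sumEFin lee_fin big_split/= -mulr_sumr Rsum exchange_big/=.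
  have : \sum_(z <- zs) \sum_(i < N) th * N%:R^-1 * c z i * k z * u z <= e / 2.
    rewrite (eq_big_seq (fun z => th * (e / 2) * u z)); last first.
      move=> z zzs; rewrite -!mulr_suml; under eq_bigr do rewrite -mulrA.
      rewrite -mulr_sumr csum mulr1 /k; have [wz|wz] := eqVneq (w z) 0.
        by rewrite uw0// !mulr0.
      by rewrite mulr0 addr0.
    rewrite -mulr_sumr (tent_mass_sum e10 net) mulr1.
    by rewrite ler_piMl ?divr_ge0 ?ltW.
  lra.
Unshelve. all: by end_near. Qed.

End transport.

Lemma eqe_shift (R : realType) (A B : \bar R) (b c : R) :
  (A + b%:E = B + c%:E -> B - b%:E = A - c%:E)%E.
Proof.
move: A B => [A| |] [B| |] //= [h]; rewrite -!EFinB; congr EFin; lra.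
Qed.

Lemma maxr_opp (R : realType) (x : R) : Num.max x 0 = Num.max (- x) 0 + x.
Proof. by rewrite !maxr_absE !subr0 normrN !addr0; lra. Qed.

(** * Integrals of functions bounded below *)

Section integral_shift.
Context d (T : measurableType d) (R : realType) (P : probability T R) (X : set T).
Hypotheses (mX : measurable X) (PX : P X = 1%E).
Implicit Types f g h : T -> R.

Lemma bounded_integrable h (C : R) : measurable_fun X h ->
  (forall x, X x -> `|h x| <= C) -> P.-integrable X (EFin \o h).
Proof.
move=> mh hC; apply: measurable_bounded_integrable => //.
  by rewrite -ge0_fin_numE// fin_num_measure.
by exists C; split; rewrite ?num_real// => M /ltW CM x /hC /le_trans; exact.
Qed.

(** Since [h] is bounded only from below, both sides may be [+oo]; the negative part has a finite
    integral and is the only one to be cancelled. *)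
Lemma integral_shift h (c : R) : measurable_fun X h -> 0 <= c ->
  (forall x, X x -> 0 <= h x + c) ->
  (\int[P]_(x in X) (h x)%:E = \int[P]_(x in X) (h x + c)%:E - c%:E)%E.
Proof.
move=> mh c0 hc.
pose hp x := Num.max (h x) 0; pose hn x := Num.max (- h x) 0.
have mhn : measurable_fun X hn.
  by apply: measurable_maxr => //; exact: measurableT_comp.
have mhp : measurable_fun X hp by apply: measurable_maxr.
have hn0 x : 0 <= hn x by rewrite /hn le_max lexx orbT.
have hp0 x : 0 <= hp x by rewrite /hp le_max lexx orbT.
have hpn x : h x + c + hn x = hp x + c.
  by rewrite /hp /hn (maxr_opp (h x)); lra.
have E1 : (\int[P]_(x in X) (h x + c)%:E + \int[P]_(x in X) (hn x)%:E =
           \int[P]_(x in X) (hp x)%:E + c%:E)%E.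
  rewrite -[in RHS](integral_cst_full mX PX c%:E) -!ge0_integralD//.
  - by apply: eq_integral => x _; rewrite -!EFinD hpn.
  - by move=> x _; rewrite lee_fin.
  - exact/measurable_EFinP.
  - by apply/measurable_EFinP; exact: measurable_funD.
  - by move=> x _; rewrite lee_fin.
  - exact/measurable_EFinP.
have hnf : (\int[P]_(x in X) (hn x)%:E \is a fin_num)%E.
  rewrite ge0_fin_numE; last by apply: integral_ge0 => x _; rewrite lee_fin.
  apply: (@le_lt_trans _ _ (\int[P]_(x in X) c%:E)%E); last first.
    by rewrite integral_cst_full// ltry.
  apply: ge0_le_integral => //; first by move=> x _; rewrite lee_fin.
  - exact/measurable_EFinP.
  - by move=> x Xx; rewrite lee_fin /hn ge_max c0 andbT lerNl -subr_ge0 opprK hc.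
transitivity (\int[P]_(x in X) (hp x)%:E - \int[P]_(x in X) (hn x)%:E)%E.
  rewrite integralE; congr (_ - _)%E; apply: eq_integral => x _.
    by rewrite funeposE /hp EFin_max.
  by rewrite funenegE /hn EFin_max EFinN.
by move: E1; rewrite -(fineK hnf); exact: eqe_shift.
Qed.

Lemma ge0_le_integral_shift f g (c : R) :
  measurable_fun X f -> measurable_fun X g ->
  (forall x, X x -> 0 <= f x) -> (forall x, X x -> 0 <= g x) ->
  (forall x, X x -> f x <= g x + c) ->
  (\int[P]_(x in X) (f x)%:E <= \int[P]_(x in X) (g x)%:E + c%:E)%E.
Proof.
move=> mf mg f0 g0 fg.
(* The constant may be negative; its two parts are put on opposite sides so that all integrands stay
   nonnegative. *)
pose cp := Num.max c 0; pose cn := Num.max (- c) 0.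
have cE : cp = cn + c by exact: maxr_opp.
have cp0 : 0 <= cp by rewrite /cp le_max lexx orbT.
have cn0 : 0 <= cn by rewrite /cn le_max lexx orbT.
have : (\int[P]_(x in X) (f x)%:E + cn%:E <= \int[P]_(x in X) (g x)%:E + cp%:E)%E.
  rewrite -[in leLHS](integral_cst_full mX PX cn%:E).
  rewrite -[in leRHS](integral_cst_full mX PX cp%:E) -!ge0_integralD//.
  - apply: ge0_le_integral => //.
    + by move=> x Xx; rewrite adde_ge0// lee_fin f0.
    + by apply: emeasurable_funD => //; exact/measurable_EFinP.
    + by apply: emeasurable_funD => //; exact/measurable_EFinP.
    + by move=> x Xx; rewrite -!EFinD lee_fin cE; have := fg _ Xx; lra.
  - exact/measurable_EFinP.
  - exact/measurable_EFinP.
by rewrite cE EFinD addeA addeAC leeD2rE.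
Qed.

Lemma Rintegral_sum (I : finType) (F : I -> T -> R) :
  (forall i, P.-integrable X (EFin \o F i)) ->
  \int[P]_(x in X) (\sum_i F i x) = \sum_i \int[P]_(x in X) F i x.
Proof.
move=> iF; rewrite /Rintegral.
under eq_integral do rewrite -sumEFin.
rewrite integral_sum// (eq_bigr (fun i => (\int[P]_(x in X) F i x)%:E)) ?sumEFin//.
by move=> i _; rewrite /Rintegral fineK//; apply: (integrable_fin_num mX (iF i)).
Qed.

End integral_shift.

Section transport_consequences.
Context (R : realType) (n : nat).
Local Notation E := 'rV[R]_n.
Context (X : set E) (mu : probability E R) (B : R).
Hypotheses (mX : measurable X) (B0 : 0 < B).
Hypothesis XB : forall x, X x -> forall j, `|x ord0 j| <= B.
Hypotheses (muX : mu X = 1%E).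

Section fixed_weights.
Context (m : nat) (e : R) (p : forall N : nat, 'I_N -> E).
Arguments p : clear implicits.
Local Notation q := (p m.+1).
Hypotheses (pX : forall i, X (q i)).
Variable t : 'I_m.+1 -> E -> R.
Hypothesis ht : transport_weights X mu p e t.

Let mt i : measurable_fun setT (t i). Proof. by case: ht. Qed.
Let t0 i x : 0 <= t i x. Proof. by case: ht. Qed.
Let t1 x : X x -> \sum_i t i x = 1. Proof. by case: ht => _ _ + _ _; exact. Qed.
Let It i : (\int[mu]_(x in X) (t i x)%:E = (m.+1%:R^-1)%:E)%E. Proof. by case: ht. Qed.
Let te : (\sum_i \int[mu]_(x in X) (`|x - q i| * t i x)%:E <= e%:E)%E.
Proof. by case: ht. Qed.

Let t_le1 i x : X x -> t i x <= 1.
Proof.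
move=> Xx; rewrite -(t1 Xx) (bigD1 i)//= lerDl.
by apply: sumr_ge0 => j _; exact: t0.
Qed.

Let mdist i : measurable_fun setT (fun x : E => `|x - q i|).
Proof. by apply: continuous_measurable_rV; exact: continuous_dist_rV. Qed.

Let int_bounded (h : E -> R) (C : R) : measurable_fun setT h ->
  (forall x, X x -> `|h x| <= C) -> mu.-integrable X (EFin \o h).
Proof. by move=> mh; apply: bounded_integrable => //; exact: measurable_funTS. Qed.

(** Write [psi x] as the sum of the [psi x * t i x] and move [x] to [q i] in each term. Applied to
    the opposite of a function, it also bounds the mean over the points by the integral. *)
Lemma Rintegral_le_mean (psi : E -> R) (L : R) : measurable_fun setT psi -> 0 <= L ->
  (forall x y, X x -> X y -> `|psi x - psi y| <= L * `|x - y|) ->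
  \int[mu]_(x in X) psi x <= m.+1%:R^-1 * \sum_i psi (q i) + L * e.
Proof.
move=> mpsi L0 psiL.
have psi_bd x : X x -> `|psi x| <= `|psi (q ord0)| + L * (2 * B).
  move=> Xx; rewrite -[psi x](subrK (psi (q ord0))) addrC.
  apply: le_trans (ler_normD _ _) _; rewrite lerD2l.
  by apply: le_trans (psiL _ _ Xx (pX _)) _; rewrite ler_wpM2l// (dist_le_box B0 XB).
have i1 i : mu.-integrable X (EFin \o (fun x => psi x * t i x)).
  apply: (int_bounded (C := `|psi (q ord0)| + L * (2 * B))); first exact: measurable_funM.
  move=> x Xx; rewrite normrM (ger0_norm (t0 _ _)).
  by apply: le_trans (psi_bd _ Xx); rewrite ler_piMr// t_le1.
have i2 i : mu.-integrable X (EFin \o t i).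
  apply: (int_bounded (C := 1)) => // x Xx; by rewrite ger0_norm// t_le1.
have i3 i : mu.-integrable X (EFin \o (fun x => `|x - q i| * t i x)).
  apply: (int_bounded (C := 2 * B)); first exact: measurable_funM.
  move=> x Xx; rewrite ger0_norm ?mulr_ge0//.
  by rewrite -[leRHS]mulr1 ler_pM// ?t_le1// (dist_le_box B0 XB).
have i4 (a : R) (f : E -> R) : mu.-integrable X (EFin \o f) ->
    mu.-integrable X (EFin \o (fun x => a * f x)).
  by move=> fi; under [EFin \o _]eq_fun do rewrite /= EFinM; exact: integrableZl.
have i5 (f g : E -> R) : mu.-integrable X (EFin \o f) ->
    mu.-integrable X (EFin \o g) -> mu.-integrable X (EFin \o (fun x => f x + g x)).
  by move=> fi gi; under [EFin \o _]eq_fun do rewrite /= EFinD; exact: integrableD.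
rewrite (@eq_Rintegral _ _ _ mu X (fun x => \sum_i psi x * t i x)); last first.
  by move=> x /[!inE] Xx; rewrite -mulr_sumr t1// mulr1.
rewrite Rintegral_sum//.
apply: (@le_trans _ _ (\sum_i (m.+1%:R^-1 * psi (q i) +
    L * \int[mu]_(x in X) (`|x - q i| * t i x)))).
  apply: ler_sum => i _.
  apply: (@le_trans _ _ (\int[mu]_(x in X) (psi (q i) * t i x + L * (`|x - q i| * t i x)))).
    apply: le_Rintegral => //.
      by apply: i5; apply: i4.
    move=> x Xx; rewrite mulrA -mulrDl ler_wpM2r//.
    by have := psiL _ _ Xx (pX i); rewrite ler_norml => /andP[_]; rewrite lerBlDl.
  rewrite RintegralD//; [|exact: i4|exact: i4].
  rewrite !RintegralZl// (_ : \int[mu]_(x in X) t i x = m.+1%:R^-1).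
    by rewrite mulrC.
  by rewrite /Rintegral It.
rewrite big_split/= -!mulr_sumr lerD2l ler_wpM2l//.
rewrite -lee_fin -sumEFin; apply: le_trans te; apply: lee_sum => i _.
by rewrite /Rintegral fineK//; apply: (integrable_fin_num mX (i3 i)).
Qed.

Section coupling.
Context (Y : set E) (rho : 'I_m.+1 -> probability E R) (beta : probability E R).
Hypotheses (mY : measurable Y) (rhoY : forall i, rho i Y = 1%E).
Hypothesis YB : forall y, Y y -> forall j, `|y ord0 j| <= B.
Hypothesis betaE : forall A, measurable A ->
  beta A = (\sum_i (m.+1%:R^-1)%:E * rho i A)%E.

Let c (x y : E) : R := sqdist x y / 2.

(** The coupling is the mean of the products of [Q i] and [rho i], where [Q i] has density
    [m.+1%:R * t i] with respect to [mu]: the mass sent to [q i] is spread according to [rho i].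
    Replacing [x] by [q i] in the cost gives the error term. *)
Lemma transport_cost_le_mean : (transport_cost X Y mu beta <=
  \sum_i (m.+1%:R^-1)%:E * \int[rho i]_y (c (q i) y)%:E +
  (2 * n%:R * B * e)%:E)%E.
Proof.
have Nn0 : m.+1%:R != 0 :> R by rewrite pnatr_eq0.
have mEt i (A : set E) : measurable_fun A (fun x => (t i x)%:E).
  exact/measurable_funTS/measurable_EFinP.
have Ht i : (\int[mu]_x (m.+1%:R * t i x)%:E = 1)%E.
  rewrite -(ge0_integral_full mX muX).
  - under eq_integral do rewrite EFinM.
    rewrite ge0_integralZl_EFin//; first by rewrite It -EFinM divff.
    by move=> x _; rewrite lee_fin.
  - by apply/measurable_EFinP; exact: measurable_funM.
  - by move=> x; rewrite lee_fin mulr_ge0.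
have mNt i : measurable_fun setT (fun x => m.+1%:R * t i x) by exact: measurable_funM.
have Nt0 i x : 0 <= m.+1%:R * t i x by rewrite mulr_ge0.
pose Q i := sval (cid (probability_density (mNt i) (Nt0 i) (Ht i))).
have QE i (g : E -> \bar R) : measurable_fun setT g -> (forall x, 0 <= g x)%E ->
    (\int[Q i]_x g x = \int[mu]_(x in X) (g x * (m.+1%:R * t i x)%:E))%E.
  move=> mg g0; rewrite (svalP (cid (probability_density (mNt i) (Nt0 i) (Ht i))))//.
  rewrite (ge0_integral_full mX muX)//.
  - by apply: emeasurable_funM => //; exact/measurable_EFinP.
  - by move=> x; rewrite mule_ge0// lee_fin.
have QA i A : measurable A -> Q i A =
    (\int[mu]_(x in X) (\1_A x * (m.+1%:R * t i x))%:E)%E.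
  move=> mA; transitivity (\int[Q i]_x (\1_A x)%:E)%E.
    by rewrite integral_indic// setIT.
  by rewrite QE//; first [exact/measurable_EFinP|move=> x; rewrite lee_fin].
have w0 (i : 'I_m.+1) : 0 <= m.+1%:R^-1 :> R by rewrite invr_ge0.
have w1 : \sum_(i < m.+1) m.+1%:R^-1 = 1 :> R.
  by rewrite sumr_const card_ord -[_^-1 *+ _]mulr_natl divff.
have [k [kE kI]] := probability_mixture (fun i => (Q i \x rho i)%E) w0 w1.
have kX A1 A2 : measurable A1 -> measurable A2 ->
    k (A1 `*` A2) = (\sum_i (m.+1%:R^-1)%:E * (Q i A1 * rho i A2))%E.
  move=> mA1 mA2; rewrite kE; apply: eq_bigr => i _; congr (_ * _)%E.
  exact: product_measure1E.
have fst_k A : measurable A -> k (A `*` Y) = mu A.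
  move=> mA; rewrite kX//.
  transitivity (\sum_i \int[mu]_(x in X) (\1_A x * t i x)%:E)%E.
    apply: eq_bigr => i _; rewrite rhoY mule1 QA// -ge0_integralZl_EFin//.
    - by apply: eq_integral => x _; rewrite -EFinM mulrCA mulKf.
    - by move=> x _; rewrite lee_fin mulr_ge0.
    - apply/measurable_funTS/measurable_EFinP; apply: measurable_funM => //.
  rewrite -ge0_integral_sum//; last 2 first.
  - move=> i; apply/measurable_funTS/measurable_EFinP; apply: measurable_funM => //.
  - by move=> i x _; rewrite lee_fin mulr_ge0.
  rewrite (eq_integral (fun x => (\1_A x)%:E)); last first.
    by move=> x /[!inE] Xx; rewrite sumEFin -mulr_sumr t1// mulr1.
  rewrite ge0_integral_full//; last exact/measurable_EFinP.
  by rewrite integral_indic// setIT.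
have QX i : Q i X = 1%E.
  rewrite QA//.
  rewrite (eq_integral (fun x => (m.+1%:R * t i x)%:E)); last first.
    by move=> x xX; rewrite indicE xX mul1r.
  rewrite ge0_integral_full//; first exact/measurable_EFinP.
  by move=> x; rewrite lee_fin.
have snd_k A : measurable A -> k (X `*` A) = beta A.
  by move=> mA; rewrite kX// betaE//; apply: eq_bigr => i _; rewrite QX mul1e.
have kXY : k (X `*` Y) = 1%E by rewrite fst_k.
have mXY : measurable (X `*` Y) by exact: measurableX.
have betaY : beta Y = 1%E by rewrite -snd_k.
have cpl : couplings X Y mu beta k.
  split; first exact: kXY.
  - move=> A mA; have mA1 : measurable (@fst E E @^-1` A).
      by rewrite -[X in measurable X]setTI; exact: measurable_fst.
    rewrite -(probability_setI_full mX muX mA) -(fst_k _ (measurableI _ _ mA mX)).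
    rewrite /pushforward -(probability_setI_full mXY kXY mA1).
    by congr (k _); apply/seteqP; split => -[x y] /=; tauto.
  - move=> A mA; have mA2 : measurable (@snd E E @^-1` A).
      by rewrite -[X in measurable X]setTI; exact: measurable_snd.
    rewrite -(probability_setI_full mY betaY mA) -(snd_k _ (measurableI _ _ mA mY)).
    rewrite /pushforward -(probability_setI_full mXY kXY mA2).
    by congr (k _); apply/seteqP; split => -[x y] /=; tauto.
apply: le_trans (_ : \int[k]_z (c z.1 z.2)%:E <= _)%E.
  by apply: ereal_inf_lbound; exists k.
have mc : measurable_fun setT (fun z : E * E => c z.1 z.2).
  exact: measurable_half_sqdist.
have c0 x y : 0 <= c x y by exact: half_sqdist_ge0.
rewrite kI; [|exact/measurable_EFinP|by move=> z; rewrite lee_fin].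
have mcq i : measurable_fun setT (c (q i)).
  exact: measurable_half_sqdist.
pose C := 2 * n%:R * B.
have C0 : 0 <= C by rewrite !mulr_ge0// ltW.
apply: (@le_trans _ _ (\sum_i (m.+1%:R^-1)%:E * (\int[rho i]_y (c (q i) y)%:E +
   C%:E * \int[Q i]_x (`|x - q i|)%:E))%E).
  apply: lee_sum => i _; apply: lee_wpmul2l; first by rewrite lee_fin.
  have mF : measurable_fun setT (fun z : E * E => (c (q i) z.2 + C * `|z.1 - q i|)%:E).
    apply/measurable_EFinP; apply: measurable_funD.
      exact: measurableT_comp (mcq i) measurable_snd.
    by apply: measurable_funM => //; exact: measurableT_comp (mdist i) measurable_fst.
  have F0 x y : 0 <= c (q i) y + C * `|x - q i| by rewrite addr_ge0// mulr_ge0.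
  apply: (@le_trans _ _ (\int[(Q i \x rho i)%E]_z (c (q i) z.2 + C * `|z.1 - q i|)%:E)%E).
    (* The Lipschitz estimate of the cost holds inside the box, hence the restriction to a product
       of full measure. *)
    have kiXY : (Q i \x rho i)%E (X `*` Y) = 1%E.
      apply: etrans (product_measure1E (Q i) (rho i) mX mY) _.
      by rewrite -[RHS]mule1; congr (_ * _)%E; [exact: QX|exact: rhoY].
    rewrite -!(ge0_integral_full mXY kiXY)//.
    + apply: ge0_le_integral => //.
      * by move=> z _; rewrite lee_fin.
      * by apply/measurable_funTS/measurable_EFinP.
      * exact: measurable_funTS.
      * move=> z [Xz Yz]; rewrite lee_fin.
        have := half_sqdist_lipl (XB Xz) (XB (pX i)) (YB Yz).
        by rewrite ler_norml => /andP[_]; rewrite lerBlDl /C.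
    + by move=> z; rewrite lee_fin.
    + exact/measurable_EFinP.
    + by move=> z; rewrite lee_fin.
  rewrite fubini_tonelli1//; last by move=> z; rewrite lee_fin.
  rewrite /fubini_F/=.
  under eq_integral.
    move=> x _; under eq_integral do rewrite EFinD.
    rewrite ge0_integralD//; last 3 first.
    - by move=> y _; rewrite lee_fin.
    - by apply/measurable_EFinP.
    - by move=> y _; rewrite lee_fin mulr_ge0.
    rewrite integral_cst// [X in (_ + _ * X)%E]probability_setT mule1.
    over.
  rewrite ge0_integralD//; last 3 first.
  - by move=> x _; apply: integral_ge0 => y _; rewrite lee_fin.
  - by move=> x _; rewrite lee_fin mulr_ge0.
  - by apply/measurable_EFinP; exact: measurable_funM.
  rewrite integral_cst// [X in (_ * X + _)%E]probability_setT mule1.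
  under [X in (_ + X)%E]eq_integral do rewrite EFinM.
  rewrite ge0_integralZl_EFin//; exact/measurable_EFinP.
rewrite (eq_bigr (fun i => (m.+1%:R^-1)%:E * \int[rho i]_y (c (q i) y)%:E +
   C%:E * \int[mu]_(x in X) (`|x - q i| * t i x)%:E)%E); last first.
  move=> i _; rewrite ge0_muleDr ?integral_ge0//; last 2 first.
  - by move=> y _; rewrite lee_fin.
  - by rewrite mule_ge0// integral_ge0// => y _; rewrite lee_fin.
  congr (_ + _)%E; rewrite muleCA; congr (_ * _)%E.
  rewrite QE; [|exact/measurable_EFinP|by move=> x; rewrite lee_fin].
  rewrite -ge0_integralZl_EFin//.
  - by apply: eq_integral => x _; rewrite -!EFinM mulrCA mulKf.
  - by move=> x _; rewrite -EFinM lee_fin mulr_ge0.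
  - apply: emeasurable_funM; apply/measurable_EFinP; exact: measurable_funTS.
rewrite big_split/= leeD2l// -ge0_sume_distrr; last first.
  by move=> i _; apply: integral_ge0 => x _; rewrite lee_fin mulr_ge0.
by rewrite [leRHS]EFinM; apply: lee_wpmul2l; rewrite ?lee_fin.
Qed.
End coupling.

End fixed_weights.

End transport_consequences.

(** * Relative entropy of a mixture *)

(** Raised by 1, the entropy integrand is nonnegative, so its integral is monotone and additive even
    when infinite. *)
Lemma mul_ln_ge0 (R : realType) (r : R) : 0 <= r -> 0 <= ln r * r + 1.
Proof. by move=> r0; have := mul_ln_ge r0; lra. Qed.

Section entropy.
Context (R : realType) (n : nat).
Local Notation E := 'rV[R]_n.
Context (Y : set E) (nu : probability E R).
Hypotheses (mY : measurable Y) (nuY : nu Y = 1%E).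

Lemma relative_entropyE (beta : probability E R) : beta `<< nu -> beta Y = 1%E ->
  exists r : E -> R, [/\ measurable_fun setT r, (forall y, 0 <= r y),
    (\int[nu]_(y in Y) (r y)%:E = 1)%E,
    (forall g : E -> R, measurable_fun Y g -> (forall y, Y y -> 0 <= g y) ->
      (\int[beta]_(y in Y) (g y)%:E = \int[nu]_(y in Y) (g y * r y)%:E)%E) &
    (relative_entropy Y nu beta =
      \int[nu]_(y in Y) (ln (r y) * r y + 1)%:E - 1%:E)%E].
Proof.
move=> bnu bY; have [r [mr r0 rE rI]] := density_of_dominated bnu.
have rI' (g : E -> R) : measurable_fun Y g -> (forall y, Y y -> 0 <= g y) ->
    (\int[beta]_(y in Y) (g y)%:E = \int[nu]_(y in Y) (g y * r y)%:E)%E.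
  (* [g] is nonnegative only on [Y], whereas [rI] asks for it everywhere. *)
  move=> mg g0; pose gp y := Num.max (g y) 0.
  rewrite (eq_integral (fun y => (gp y)%:E)); last first.
    by move=> y /[!inE] Yy; rewrite /gp max_l// g0.
  rewrite rI//.
  - apply: eq_integral => y /[!inE] Yy.
    by rewrite -EFinM /gp max_l// g0.
  - by apply/measurable_EFinP; exact: measurable_maxr.
  - by move=> y; rewrite lee_fin /gp le_max lexx orbT.
exists r; split => //.
  have /esym := rI' (fun=> 1) (measurable_cst _) (fun _ _ => ler01).
  rewrite (integral_cst_full mY bY 1%E) => <-.
  by apply: eq_integral => y _; rewrite mul1r.
have mh : measurable_fun Y (fun y => ln (r y) * r y).
  apply: measurable_funTS; apply: measurable_funM => //.
  exact: measurableT_comp (@measurable_ln R) mr.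
rewrite -(integral_shift mY nuY)//; last first.
  by move=> y _; exact: mul_ln_ge0.
rewrite /relative_entropy; case: asboolP => // _.
apply: ae_eq_integral => //.
- apply/measurable_EFinP; apply: measurable_funTS.
  have mRN : measurable_fun setT (fun y => fine (('d (charge_of_finite_measure beta) '/d nu) y)).
    by apply: measurableT_comp => //; apply: measurable_int; exact: Radon_Nikodym_integrable.
  apply: measurable_funM => //.
  exact: measurableT_comp (@measurable_ln R) mRN.
- exact/measurable_EFinP.
- apply: filterS rE => y /(_ I) rE _ /=.
  by rewrite -rE.
Qed.

(** A log-sum inequality. With [r] the density of [beta], integrate [ln (m.+1%:R * w i * r) <=
    m.+1%:R * w i * r - 1] against [rho i] and average over [i]: the right sides average to 0,
    because [r] has [nu]-integral 1. *)
Lemma relative_entropy_mixture_le m (w : 'I_m.+1 -> R)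
    (rho : 'I_m.+1 -> probability E R) (beta : probability E R) :
  (forall i, 0 < w i) -> (forall i, rho i Y = 1%E) -> beta Y = 1%E ->
  (forall A, measurable A -> nu A = \sum_i (w i)%:E * rho i A)%E ->
  (forall A, measurable A -> beta A = \sum_i (m.+1%:R^-1)%:E * rho i A)%E ->
  (relative_entropy Y nu beta <=
    (- (m.+1%:R^-1 * \sum_i ln (m.+1%:R * w i)))%:E)%E.
Proof.
move=> w0 rhoY bY nuE betaE.
have Nn0 : m.+1%:R != 0 :> R by rewrite pnatr_eq0.
have N0 : 0 < m.+1%:R :> R by rewrite ltr0n.
have iN0 : 0 <= m.+1%:R^-1 :> R by rewrite invr_ge0.
have bnu : beta `<< nu.
  apply/null_content_dominatesP => A mA /(etrans (esym (nuE A mA)))/eqP.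
  rewrite seq_psume_eq0 => [/allP A0|i _]; last by rewrite mule_ge0// lee_fin ltW.
  apply: etrans (betaE A mA) _; apply: big1 => i _; have := A0 i (mem_index_enum _).
  by rewrite /= mule_eq0 eqe gt_eqF//= => /eqP ->; rewrite mule0.
have [r [mr r0 r1 rI ->]] := relative_entropyE bnu bY.
set K := - _.
set I1 := (\int[nu]_(y in Y) (ln (r y) * r y + 1)%:E)%E.
(* Since [ln (r y)] is not bounded below, [r] is truncated from below at [eta]; this costs [eta] in
   the estimate. *)
suff H eta : 0 < eta <= 1 -> (I1 <= (K + 1 + eta)%:E)%E.
  have : (I1 <= (K + 1)%:E)%E.
    apply/lee_addgt0Pr => e e0; rewrite -EFinD.
    apply: le_trans (H (Num.min e 1) _) _.
      by rewrite lt_min e0 ltr01 ge_min lexx orbT.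
    by rewrite lee_fin lerD2l ge_min lexx.
  move=> I1K; apply: le_trans (leeB I1K (lexx 1%:E)) _.
  by rewrite -EFinB addrK.
move=> /andP[eta0 eta1].
pose Le : R := - ln eta.
have Le0 : 0 <= Le by rewrite /Le oppr_ge0 -ln1 ler_ln ?posrE.
(* Adding [Le = - ln eta] makes the truncated logarithm nonnegative; the constant is subtracted
   again at the end. *)
pose l y := ln (Num.max (r y) eta) + Le.
have mx0 y : 0 < Num.max (r y) eta by rewrite lt_max eta0 orbT.
have l0 y : 0 <= l y.
  by rewrite /l /Le subr_ge0 ler_ln ?posrE// le_max lexx orbT.
have ml : measurable_fun setT l.
  apply: measurable_funD => //; apply: measurableT_comp (@measurable_ln R) _.
  exact: measurable_maxr.
have mE (f : E -> R) (D : set E) : measurable_fun setT f -> measurable_fun D (EFin \o f).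
  by move=> mf; apply/measurable_funTS/measurable_EFinP.
have mlr : measurable_fun setT (fun y => ln (r y) * r y).
  by apply: measurable_funM => //; exact: measurableT_comp (@measurable_ln R) mr.
have h0 y : 0 <= ln (r y) * r y + 1.
  exact: mul_ln_ge0.
have step1 : (I1 + Le%:E <= \int[beta]_(y in Y) (l y)%:E + 1%:E)%E.
  rewrite rI//; last exact: measurable_funTS.
  rewrite -[X in (_ + X <= _)%E](_ : \int[nu]_(y in Y) (Le * r y)%:E = _)%E; last first.
    under eq_integral do rewrite EFinM.
    rewrite ge0_integralZl_EFin// ?r1 ?mule1//; last exact: mE.
    by move=> y _; rewrite lee_fin.
  rewrite -[X in (_ <= _ + X)%E](integral_cst_full mY nuY) -!ge0_integralD//.
  - apply: ge0_le_integral => //.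
    + by move=> y _; rewrite adde_ge0// lee_fin// mulr_ge0.
    + by apply: emeasurable_funD; apply: mE;
        [exact: measurable_funD|exact: measurable_funM].
    + by apply: emeasurable_funD => //; apply: mE; exact: measurable_funM.
    + move=> y _; rewrite -!EFinD lee_fin addrAC lerD2r -mulrDl.
      have [->|ry0] := eqVneq (r y) 0; first by rewrite !mulr0.
      have ry : 0 < r y by rewrite lt0r ry0 r0.
      by rewrite ler_wpM2r// lerD2r ler_ln ?posrE// le_max lexx.
  - by move=> y _; rewrite lee_fin mulr_ge0.
  - by apply: mE; exact: measurable_funM.
  - by move=> y _; rewrite lee_fin.
  - by apply: mE; exact: measurable_funD.
  - by move=> y _; rewrite lee_fin mulr_ge0.
  - by apply: mE; exact: measurable_funM.
pose k i := Le - 1 - ln (m.+1%:R * w i).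
have step2 i : (\int[rho i]_(y in Y) (l y)%:E <=
    (m.+1%:R * w i)%:E * \int[rho i]_(y in Y) (r y + eta)%:E + (k i)%:E)%E.
  have Nw : 0 < m.+1%:R * w i by rewrite mulr_gt0.
  rewrite -ge0_integralZl_EFin//; last 3 first.
  - by move=> y _; rewrite lee_fin addr_ge0// ltW.
  - by apply: mE; exact: measurable_funD.
  - exact: ltW.
  under [in leRHS]eq_integral do rewrite -EFinM.
  apply: (ge0_le_integral_shift mY (rhoY i)) => //.
  - exact: measurable_funTS.
  - by apply: measurable_funTS; apply: measurable_funM => //; exact: measurable_funD.
  - by move=> y _; apply: mulr_ge0; [exact: ltW|apply: addr_ge0 => //; exact: ltW].
  - move=> y _; rewrite /l /k.
    have : ln (m.+1%:R * w i * Num.max (r y) eta) <= m.+1%:R * w i * Num.max (r y) eta - 1.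
      by apply: ln_le_sub1; rewrite mulr_gt0.
    rewrite lnM ?posrE//.
    have : m.+1%:R * w i * Num.max (r y) eta <= m.+1%:R * w i * (r y + eta).
      by rewrite ler_pM2l// ge_max lerDl lerDr ltW ?r0.
    lra.
have step3 : (\int[beta]_(y in Y) (l y)%:E <=
    \sum_i (w i)%:E * \int[rho i]_(y in Y) (r y + eta)%:E + (Le - 1 + K)%:E)%E.
  rewrite (integral_mixture (fun=> iN0) betaE mY); last 2 first.
  - exact: mE.
  - by move=> y _; rewrite lee_fin.
  apply: (@le_trans _ _ (\sum_i ((w i)%:E * \int[rho i]_(y in Y) (r y + eta)%:E +
      (m.+1%:R^-1 * k i)%:E))%E).
    apply: lee_sum => i _; apply: le_trans (lee_wpmul2l _ (step2 i)) _.
      by rewrite lee_fin.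
    rewrite muleDr//; last by rewrite fin_num_adde_defl.
    by rewrite muleA -EFinM mulKf// EFinM.
  rewrite big_split/= leeD2l// sumEFin lee_fin -mulr_sumr /k.
  rewrite sumrB (_ : \sum_(i < m.+1) (Le - 1) = m.+1%:R * (Le - 1)).
    by rewrite mulrBr mulKf.
  by rewrite sumr_const card_ord mulr_natl.
rewrite -(integral_mixture _ nuE mY) in step3; last 3 first.
- by move=> i; exact: ltW.
- by apply: mE; exact: measurable_funD.
- by move=> y _; rewrite lee_fin addr_ge0// ltW.
have r1e : (\int[nu]_(y in Y) (r y + eta)%:E = (1 + eta)%:E)%E.
  under eq_integral do rewrite EFinD.
  rewrite ge0_integralD//.
  - by rewrite r1 integral_cst_full.
  - by move=> y _; rewrite lee_fin.
  - exact: mE.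
  - by move=> y _; rewrite lee_fin ltW.
have := le_trans step1 (leeD2r _ step3).
rewrite r1e -!EFinD -leeBrDr// -EFinB => /le_trans; apply.
by rewrite lee_fin; lra.
Qed.

End entropy.

(** * Duality for the limit problem *)

(** The lower bound [L0] excludes infinite [I] and [W], after which the claim is linear
    arithmetic. *)
Lemma ereal_dual_bound (R : realType) (L0 c e J : R) (I W : \bar R) :
  (0 <= I -> 0 <= W -> c%:E <= W + e%:E + J%:E -> L0%:E <= - (I - 1%:E) - W ->
   I <= (1 - L0 + e + J - c)%:E)%E.
Proof.
move: I W => [i| |] // [w| |] // _ _ /=.
rewrite -?EFinB -?EFinN -?EFinB -?EFinD !lee_fin; lra.
Qed.

Lemma ereal_affine_bound (R : realType) (a b c u : R) (D I : \bar R) :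
  0 < a -> (0 <= D -> 0 <= I -> a%:E * D + b%:E <= I + c%:E -> I <= u%:E ->
   D <= ((u + c - b) / a)%:E)%E.
Proof.
move=> a0; move: D I => [x| |] // [i| |] // _ _ /=.
  by rewrite -!EFinM -!EFinD !lee_fin ler_pdivlMr// (mulrC x); lra.
by rewrite gt0_muley ?lte_fin.
Qed.

Section weak_duality.
Context (R : realType) (n : nat).
Local Notation E := 'rV[R]_n.
Context (X Y : set E) (mu nu : probability E R).
Hypotheses (mX : measurable X) (mY : measurable Y).
Hypotheses (muX : mu X = 1%E) (nuY : nu Y = 1%E).
Context (psi gam : E -> R) (C K : R).
Hypotheses (mpsi : measurable_fun setT psi) (mgam : measurable_fun setT gam).
Hypothesis psiC : forall x, X x -> `|psi x| <= C.
Hypothesis gamK : forall y, Y y -> `|gam y| <= K.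
Hypothesis dual : forall x y, X x -> Y y -> - psi x - gam y <= sqdist x y / 2.

Let mE (f : E -> R) (D : set E) : measurable_fun setT f -> measurable_fun D (EFin \o f).
Proof. by move=> mf; apply/measurable_funTS/measurable_EFinP. Qed.

Let psi0 x : X x -> 0 <= psi x + C.
Proof. by move=> /psiC; rewrite ler_norml => /andP[+ _]; rewrite -subr_ge0 opprK. Qed.

Let gam0 y : Y y -> 0 <= gam y + K.
Proof. by move=> /gamK; rewrite ler_norml => /andP[+ _]; rewrite -subr_ge0 opprK. Qed.

Let mpsiC : measurable_fun setT (fun x => psi x + C). Proof. exact: measurable_funD. Qed.
Let mgamK : measurable_fun setT (fun y => gam y + K). Proof. exact: measurable_funD. Qed.

Let ge0_integral_marginal (D : set E) (m : probability E R) (f : E * E -> E)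
    (k : probability (E * E)%type R) (g : E -> R) :
  measurable D -> measurable_fun setT f -> k (X `*` Y) = 1%E ->
  (forall A, measurable A -> pushforward k f A = m A) ->
  (forall z, (X `*` Y) z -> D (f z)) -> measurable_fun setT g ->
  (forall x, D x -> 0 <= g x) ->
  (\int[k]_(z in X `*` Y) (g (f z))%:E <= \int[m]_(x in D) (g x)%:E)%E.
Proof.
move=> mD mf kXY km XYD mg g0.
have mfD : measurable (f @^-1` D) by rewrite -[X in measurable X]setTI; exact: mf.
rewrite -(@eq_measure_integral _ _ _ D m (@measure_function_pushforward__canonical__measure_function_Measure
    _ _ _ _ _ k _ mf)); last by move=> A mA _; exact: km.
rewrite ge0_integral_pushforward//; last 2 first.
- exact: mE.
- by move=> x /[!inE] Dx; rewrite lee_fin g0.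
apply: ge0_subset_integral => //.
- exact: measurableX.
- apply/measurable_EFinP; apply: measurable_funTS; exact: measurableT_comp.
- by move=> z Dz; rewrite lee_fin g0.
Qed.

(** Kantorovich's weak duality for the potentials [- psi] and [- gam]. The shifts by [C] and [K]
    make the integrands nonnegative, so that integrals add up even for a coupling of infinite
    cost. *)
Lemma transport_cost_dual (beta : probability E R) : beta Y = 1%E ->
  ((C + K)%:E <= transport_cost X Y mu beta + \int[mu]_(x in X) (psi x + C)%:E +
    \int[beta]_(y in Y) (gam y + K)%:E)%E.
Proof.
move=> bY.
have f1 : (\int[mu]_(x in X) (psi x + C)%:E \is a fin_num)%E.
  apply: (integrable_fin_num mX).
  apply: (@bounded_integrable _ _ _ _ _ mX _ (C + C)); first exact: measurable_funTS.
  move=> x Xx; apply: le_trans (ler_normD _ _) _.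
  by rewrite lerD ?psiC// ger0_norm// (le_trans _ (psiC Xx)).
have f2 : (\int[beta]_(y in Y) (gam y + K)%:E \is a fin_num)%E.
  apply: (integrable_fin_num mY).
  apply: (@bounded_integrable _ _ _ _ _ mY _ (K + K)); first exact: measurable_funTS.
  move=> y Yy; apply: le_trans (ler_normD _ _) _.
  by rewrite lerD ?gamK// ger0_norm// (le_trans _ (gamK Yy)).
rewrite -leeBlDr// -leeBlDr//; apply/ereal_infP => _ [k [kXY kmu kbeta] <-].
rewrite leeBlDr// leeBlDr//.
have mXY : measurable (X `*` Y) by exact: measurableX.
have mc : measurable_fun setT (fun z : E * E => sqdist z.1 z.2 / 2).
  exact: measurable_half_sqdist.
have mEE (D : set (E * E)) (f : E * E -> R) : measurable_fun setT f ->
    measurable_fun D (EFin \o f).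
  by move=> mf; apply/measurable_funTS/measurable_EFinP.
rewrite -(ge0_integral_full mXY kXY); last 2 first.
- exact: mEE.
- by move=> z; rewrite lee_fin half_sqdist_ge0.
have mp1 : measurable_fun setT (fun z : E * E => psi z.1 + C).
  exact: measurableT_comp mpsiC measurable_fst.
have mp2 : measurable_fun setT (fun z : E * E => gam z.2 + K).
  exact: measurableT_comp mgamK measurable_snd.
apply: (@le_trans _ _ (\int[k]_(z in X `*` Y) (sqdist z.1 z.2 / 2)%:E +
  \int[k]_(z in X `*` Y) (psi z.1 + C)%:E + \int[k]_(z in X `*` Y) (gam z.2 + K)%:E)%E).
  have q1 z : (X `*` Y) z -> (0 <= (sqdist z.1 z.2 / 2)%:E)%E.
    by move=> _; rewrite lee_fin half_sqdist_ge0.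
  have q2 z : (X `*` Y) z -> (0 <= (psi z.1 + C)%:E)%E.
    by move=> [Xz _]; rewrite lee_fin psi0.
  have q3 z : (X `*` Y) z -> (0 <= (gam z.2 + K)%:E)%E.
    by move=> [_ Yz]; rewrite lee_fin gam0.
  have q4 z : (X `*` Y) z -> (0 <= (sqdist z.1 z.2 / 2)%:E + (psi z.1 + C)%:E)%E.
    by move=> XYz; rewrite adde_ge0 ?q1 ?q2.
  have n1 := mEE (X `*` Y) _ mc.
  have n2 := mEE (X `*` Y) _ mp1.
  have n3 := mEE (X `*` Y) _ mp2.
  have n4 := emeasurable_funD n1 n2.
  have n5 := emeasurable_funD n4 n3.
  rewrite -!ge0_integralD// -(integral_cst_full mXY kXY (C + K)%:E).
  apply: ge0_le_integral => //.
  - move=> z [Xz Yz]; rewrite lee_fin.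
    by rewrite addr_ge0// ?(le_trans _ (psiC Xz))// (le_trans _ (gamK Yz)).
  - move=> z [Xz Yz]; rewrite -!EFinD lee_fin.
    have := dual Xz Yz; move: (sqdist _ _ / 2) => c; lra.
rewrite leeD//.
  rewrite leeD2l//; apply: ge0_integral_marginal => //.
  by move=> z [].
apply: ge0_integral_marginal => //.
by move=> z [].
Qed.

Lemma transport_cost_ge0 (beta : probability E R) : (0 <= transport_cost X Y mu beta)%E.
Proof.
apply/ereal_infP => _ [k _ <-]; apply: integral_ge0 => z _.
by rewrite lee_fin half_sqdist_ge0.
Qed.

Hypothesis gam1 : (\int[nu]_(y in Y) (expR (gam y))%:E <= 1)%E.

(* The gap in the weak duality between [limit_objective] and the potentials
   [psi], [gam] controls the distance from [beta] to [expR gam * nu]. *)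
Lemma limit_objective_stability (beta : probability E R) (L0 : R) (f : E -> R) (Bf dl : R) :
  beta Y = 1%E -> (L0%:E <= limit_objective X Y mu nu beta)%E ->
  measurable_fun Y f -> (forall y, Y y -> `|f y| <= Bf) -> 0 < dl ->
  `|\int[beta]_(y in Y) f y - \int[nu]_(y in Y) (f y * expR (gam y))| <=
  Bf * ((\int[mu]_(x in X) psi x - L0) / (2 * dl) + 2 * dl).
Proof.
move=> bY L0le mf fB dl0.
(* Otherwise the entropy is [+oo] and the objective is [-oo], below [L0]. *)
have bnu : beta `<< nu.
  have := L0le; rewrite /limit_objective /relative_entropy.
  by case: asboolP => // _; rewrite /= addNye.
have [r [mr r0 r1 rI HE]] := relative_entropyE mY nuY bnu bY.
set g := fun y => expR (gam y).
have mg : measurable_fun setT g by exact: measurableT_comp (@measurable_expR R) mgam.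
have g0 y : 0 < g y by exact: expR_gt0.
have mlr : measurable_fun setT (fun y => ln (r y) * r y).
  by apply: measurable_funM => //; exact: measurableT_comp (@measurable_ln R) mr.
set I1 := (\int[nu]_(y in Y) (ln (r y) * r y + 1)%:E)%E in HE.
set W := transport_cost X Y mu beta.
have W0 : (0 <= W)%E by exact: transport_cost_ge0.
have K0 : 0 <= K by have [y Yy] := full_measure_nonempty nuY; exact: le_trans (gamK Yy).
have C0 : 0 <= C by have [x Xx] := full_measure_nonempty muX; exact: le_trans (psiC Xx).
set J := (\int[beta]_(y in Y) (gam y + K)%:E)%E.
have Jfin : J \is a fin_num.
  apply: (integrable_fin_num mY).
  apply: (@bounded_integrable _ _ _ _ _ mY _ (K + K)); first exact: measurable_funTS.
  by move=> y Yy; apply: le_trans (ler_normD _ _) _; rewrite lerD ?gamK// ger0_norm.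
have ipsi : mu.-integrable X (EFin \o psi).
  by apply: (@bounded_integrable _ _ _ _ _ mX _ C) => //; exact: measurable_funTS.
set e := \int[mu]_(x in X) psi x.
have IC : (\int[mu]_(x in X) (psi x + C)%:E = (e + C)%:E)%E.
  have iC : mu.-integrable X (EFin \o (cst C : E -> R)).
    apply: (@bounded_integrable _ _ _ _ _ mX _ C) => // x _.
    by rewrite /= ger0_norm.
  under eq_integral do rewrite EFinD.
  rewrite (integralD mX ipsi iC) EFinD; congr (_ + _)%E.
    by rewrite /e /Rintegral fineK//; exact: integrable_fin_num ipsi.
  exact: (integral_cst_full mX muX C%:E).
have Wge := transport_cost_dual bY; rewrite -/W IC -/J -(fineK Jfin) in Wge.
have I1le : (I1 <= (1 - L0 + e - K + fine J)%:E)%E.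
  have I10 : (0 <= I1)%E.
    by apply: integral_ge0 => y _; rewrite lee_fin mul_ln_ge0.
  have h := ereal_dual_bound I10 W0 Wge.
  have := h L0; rewrite -HE => /(_ L0le) /le_trans; apply.
  by rewrite lee_fin; lra.
have Gfin : (\int[nu]_(y in Y) (g y)%:E)%E \is a fin_num.
  rewrite ge0_fin_numE; first exact: le_lt_trans gam1 (ltry _).
  by apply: integral_ge0 => y _; rewrite lee_fin ltW.
set G := fine (\int[nu]_(y in Y) (g y)%:E)%E.
have GE : (\int[nu]_(y in Y) (g y)%:E = G%:E)%E by rewrite fineK.
have G1 : G <= 1 by rewrite -lee_fin -GE.
have mrg : measurable_fun setT (fun y => `|r y - g y|).
  by apply: measurableT_comp => //; exact: measurable_funB.
set D := (\int[nu]_(y in Y) (`|r y - g y|)%:E)%E.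
have D0 : (0 <= D)%E by apply: integral_ge0 => y _; rewrite lee_fin.
have mgr : measurable_fun setT (fun y => (gam y + K) * r y) by exact: measurable_funM.
(* This is [dist_le_entropy] with [g = expR gam], multiplied by [2 * dl] and integrated. The same
   terms [(gam y + K) * r y + r y + 1] are first added to both sides to make every integrand
   nonnegative. *)
have key : ((2 * dl)%:E * D + (J + 1%:E + 1%:E) <=
    I1 + (K%:E + G%:E + (2 * dl ^+ 2)%:E * (1%:E + G%:E)))%E.
  have c0 : 0 <= 2 * dl ^+ 2 by rewrite mulr_ge0// exprn_ge0// ltW.
  have c1 : 0 <= 2 * dl by rewrite mulr_ge0// ltW.
  have JE : J = (\int[nu]_(y in Y) ((gam y + K) * r y)%:E)%E.
    by rewrite /J rI//; exact: measurable_funTS.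
  have i1 : (\int[nu]_(y in Y) (1:R)%:E = 1%:E)%E := integral_cst_full mY nuY 1%:E.
  have iK : (\int[nu]_(y in Y) (K * r y)%:E = K%:E)%E.
    under eq_integral do rewrite EFinM.
    rewrite ge0_integralZl_EFin// ?r1 ?mule1//; last exact: mE.
    by move=> y _; rewrite lee_fin.
  have irg : (\int[nu]_(y in Y) (r y + g y)%:E = 1%:E + G%:E)%E.
    under eq_integral do rewrite EFinD.
    rewrite ge0_integralD// ?r1 ?GE//.
    + by move=> y _; rewrite lee_fin.
    + exact: mE.
    + by move=> y _; rewrite lee_fin ltW.
    + exact: mE.
  have irg2 : (\int[nu]_(y in Y) (2 * dl ^+ 2 * (r y + g y))%:E =
      (2 * dl ^+ 2)%:E * (1%:E + G%:E))%E.
    under eq_integral do rewrite EFinM.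
    rewrite ge0_integralZl_EFin// ?irg//.
    + by move=> y _; rewrite lee_fin addr_ge0// ltW.
    + by apply: mE; exact: measurable_funD.
  have iD : ((2 * dl)%:E * D = \int[nu]_(y in Y) (2 * dl * `|r y - g y|)%:E)%E.
    under [RHS]eq_integral do rewrite EFinM.
    by rewrite ge0_integralZl_EFin//; exact: mE.
  have mh : measurable_fun setT (fun y => ln (r y) * r y + 1) by exact: measurable_funD.
  have m3 : measurable_fun setT (fun y => K * r y) by exact: measurable_funM.
  have m4 : measurable_fun setT (fun y => r y + g y) by exact: measurable_funD.
  have m5 : measurable_fun setT (fun y => 2 * dl ^+ 2 * (r y + g y)) by exact: measurable_funM.
  have m6 : measurable_fun setT (fun y => 2 * dl * `|r y - g y|) by exact: measurable_funM.
  have addI (a b : E -> R) : measurable_fun setT a -> measurable_fun setT b ->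
      (forall y, Y y -> 0 <= a y) -> (forall y, Y y -> 0 <= b y) ->
      (\int[nu]_(y in Y) (a y)%:E + \int[nu]_(y in Y) (b y)%:E =
       \int[nu]_(y in Y) (a y + b y)%:E)%E.
    move=> ma mb a0 b0; rewrite -ge0_integralD//; first exact: mE.
    exact: mE.
  have p2 y : Y y -> 0 <= (gam y + K) * r y by move=> Yy; rewrite mulr_ge0 ?gam0.
  have p3 y : Y y -> 0 <= K * r y by move=> Yy; rewrite mulr_ge0.
  have p5 y : Y y -> 0 <= 2 * dl ^+ 2 * (r y + g y).
    by move=> _; rewrite mulr_ge0// addr_ge0// ltW.
  have p6 y : Y y -> 0 <= 2 * dl * `|r y - g y| by move=> _; rewrite mulr_ge0.
  have p7 y : Y y -> 0 <= g y by move=> _; rewrite ltW.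
  have p8 y : Y y -> 0 <= ln (r y) * r y + 1 by move=> _; rewrite mul_ln_ge0.
  have p9 y : Y y -> 0 <= r y by [].
  have mc1 : measurable_fun setT (fun _ : E => 1 : R) by exact: measurable_cst.
  have m10 : measurable_fun setT (fun y => (gam y + K) * r y + r y) by exact: measurable_funD.
  have m11 : measurable_fun setT (fun y => (gam y + K) * r y + r y + 1) by exact: measurable_funD.
  have m12 : measurable_fun setT (fun y => K * r y + g y) by exact: measurable_funD.
  have m13 : measurable_fun setT (fun y => K * r y + g y + 2 * dl ^+ 2 * (r y + g y)).
    exact: measurable_funD.
  have p1 y : Y y -> 0 <= (1 : R) by [].
  have p10 y : Y y -> 0 <= (gam y + K) * r y + r y by move=> Yy; rewrite addr_ge0 ?p2.
  have p11 y : Y y -> 0 <= (gam y + K) * r y + r y + 1 by move=> Yy; rewrite addr_ge0 ?p10.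
  have p12 y : Y y -> 0 <= K * r y + g y by move=> Yy; rewrite addr_ge0 ?p3 ?p7.
  have p13 y : Y y -> 0 <= K * r y + g y + 2 * dl ^+ 2 * (r y + g y).
    by move=> Yy; rewrite addr_ge0 ?p12 ?p5.
  have lE := addI _ _ m6 m11 p6 p11.
  rewrite -(addI _ _ m10 mc1 p10 p1) -(addI _ _ mgr mr p2 p9) r1 i1 -iD -JE in lE.
  have rE := addI _ _ mh m13 p8 p13.
  rewrite -(addI _ _ m12 m5 p12 p5) -(addI _ _ m3 mg p3 p7) iK GE irg2 -/I1 in rE.
  rewrite lE rE.
  apply: ge0_le_integral => //.
  - by move=> y Yy; rewrite lee_fin addr_ge0 ?p6 ?p11.
  - by apply: mE; exact: measurable_funD m6 m11.
  - by apply: mE; exact: measurable_funD mh m13.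
  - move=> y Yy; rewrite lee_fin.
    have := dist_le_entropy (r0 y) (g0 y) dl0; rewrite {2 3}/g expRK -/(g y).
    have d2 : 0 < 2 * dl by rewrite mulr_gt0.
    move: (ln (r y) * r y) (g y) => h gy; move: (`|r y - gy|) => ab hab.
    rewrite -(ler_pM2l d2) in hab.
    have eab : 2 * dl * ((h - r y * gam y - r y + gy) / (2 * dl) + dl * (r y + gy)) =
       h - r y * gam y - r y + gy + 2 * dl ^+ 2 * (r y + gy) by field; rewrite gt_eqF.
    by rewrite eab in hab; lra.
have Dle : (D <= ((e - L0) / (2 * dl) + 2 * dl)%:E)%E.
  have I10 : (0 <= I1)%E.
    by apply: integral_ge0 => y _; rewrite lee_fin mul_ln_ge0.
  have d2 : 0 < 2 * dl by rewrite mulr_gt0.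
  have key' : ((2 * dl)%:E * D + (fine J + 1 + 1)%:E <=
      I1 + (K + G + 2 * dl ^+ 2 * (1 + G))%:E)%E by move: key; rewrite -{1}(fineK Jfin).
  apply: le_trans (ereal_affine_bound d2 D0 I10 key' I1le) _.
  rewrite lee_fin ler_pdivrMr//.
  have -> : ((e - L0) / (2 * dl) + 2 * dl) * (2 * dl) = e - L0 + 4 * dl ^+ 2.
    by field; rewrite gt_eqF.
  have : 2 * dl ^+ 2 * (1 + G) <= 2 * dl ^+ 2 * 2.
    by rewrite ler_wpM2l ?mulr_ge0 ?exprn_ge0 ?(ltW dl0)//; lra.
  lra.
have ir : nu.-integrable Y (EFin \o r).
  apply/integrableP; split; first exact: mE.
  by under eq_integral do rewrite /= ger0_norm//; rewrite r1 ltry.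
have ig : nu.-integrable Y (EFin \o g).
  apply/integrableP; split; first exact: mE.
  by under eq_integral do rewrite /= ger0_norm ?(ltW (g0 _))//; rewrite GE ltry.
have Bf0 : 0 <= Bf by have [y Yy] := full_measure_nonempty nuY; exact: le_trans (fB _ Yy).
have intf (h : E -> R) : measurable_fun setT h -> (forall y, 0 <= h y) ->
    nu.-integrable Y (EFin \o h) -> nu.-integrable Y (EFin \o (fun y => f y * h y)).
  move=> mh h0 ih; apply: (le_integrable mY (g := EFin \o (fun y => Bf * h y))).
  - by apply/measurable_EFinP; apply: measurable_funM => //; exact: measurable_funTS.
  - move=> y Yy /=; rewrite lee_fin !normrM (ger0_norm Bf0).
    by rewrite ler_wpM2r// fB.
  - by under [EFin \o _]eq_fun do rewrite /= EFinM; exact: integrableZl.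
have ifr := intf _ mr r0 ir.
have ifg := intf _ mg (fun y => ltW (g0 y)) ig.
have fE : \int[beta]_(y in Y) f y = \int[nu]_(y in Y) (f y * r y).
  have fB0 y : Y y -> 0 <= f y + Bf.
    by move=> /fB; rewrite ler_norml => /andP[+ _]; rewrite -subr_ge0 opprK.
  rewrite /Rintegral (integral_shift mY bY mf Bf0 fB0) rI//; last exact: measurable_funD.
  congr fine; under [X in (X - _)%E]eq_integral do rewrite mulrDl EFinD.
  have iBr : nu.-integrable Y (EFin \o (fun y => Bf * r y)).
    by under [EFin \o _]eq_fun do rewrite /= EFinM; exact: integrableZl.
  rewrite integralD//.
  rewrite [X in (_ + X - _)%E](_ : _ = Bf%:E)%E; last first.
    under eq_integral do rewrite EFinM.
    rewrite ge0_integralZl_EFin// ?r1 ?mule1//; last exact: mE.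
    by move=> y _; rewrite lee_fin.
  by rewrite addeK.
rewrite fE -RintegralB//.
have iB : nu.-integrable Y (EFin \o (fun y => f y * r y - f y * g y)).
  by under [EFin \o _]eq_fun do rewrite /= EFinB; exact: integrableB.
apply: le_trans (le_normr_Rintegral mY iB) _.
have iD : nu.-integrable Y (EFin \o (fun y => `|r y - g y|)).
  apply/integrableP; split; first exact: mE.
  by under eq_integral do rewrite /= normr_id; exact: le_lt_trans Dle (ltry _).
apply: (@le_trans _ _ (\int[nu]_(y in Y) (Bf * `|r y - g y|))).
  apply: le_Rintegral => //.
  - exact: integrable_norm.
  - by under [EFin \o _]eq_fun do rewrite /= EFinM; exact: integrableZl.
  - by move=> y Yy; rewrite -mulrBr normrM ler_wpM2r// fB.
rewrite RintegralZl//; apply: ler_wpM2l => //.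
by rewrite -lee_fin /Rintegral fineK//; exact: integrable_fin_num iD.
Qed.

End weak_duality.

(** * Structure of the maximizers *)

Section nash.
Context (R : realType) (n : nat).
Local Notation E := 'rV[R]_n.
Context (Y : set E) (nu : probability E R) (m : nat) (q : 'I_m.+1 -> E) (B : R).
Hypotheses (mY : measurable Y) (nuY : nu Y = 1%E) (q_inj : injective q).
Hypotheses (B0 : 0 < B) (qB : forall i j, `|q i ord0 j| <= B).
Hypothesis YB : forall y, Y y -> forall j, `|y ord0 j| <= B.

Local Notation N := (m.+1%:R : R).
Local Notation D i := ([set q i] `*` Y).
Local Notation ES := (range q `*` Y).

Let mq i : measurable [set q i]. Proof. exact: measurable_rV_set1. Qed.

Let mD i : measurable (D i). Proof. exact: measurableX. Qed.

Let ESE : ES = \big[setU/set0]_(i < m.+1) D i.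
Proof.
apply/seteqP; split => [[x y] [/= [i _ <-] Yy]|].
  by rewrite (bigD1 i)//=; left.
move=> z; elim/big_ind : _ => // [S1 S2 h1 h2 [/h1|/h2]//|i _ [/= -> Yz]].
by split => //; exists i.
Qed.

Let mES : measurable ES.
Proof. by rewrite ESE; apply: bigsetU_measurable => i _. Qed.

Let surplus_gt0 (x y : E) : 0 < surplus x y. Proof. exact: expR_gt0. Qed.

Let surplus_le1 (x y : E) : surplus x y <= 1.
Proof. by rewrite /surplus -[leRHS]expR0 ler_expR oppr_le0 half_sqdist_ge0. Qed.

Let msurplus d (T : measurableType d) (f g : T -> E) :
  measurable_fun setT f -> measurable_fun setT g ->
  measurable_fun setT (fun t => surplus (f t) (g t)).
Proof.
move=> mf mg; apply: measurableT_comp (@measurable_expR R) _.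
by apply: measurableT_comp => //; exact: measurable_half_sqdist.
Qed.

Let ms : measurable_fun setT (fun z : E * E => surplus z.1 z.2).
Proof. exact: msurplus. Qed.

Let mEE (S : set (E * E)) (f : E * E -> R) :
  measurable_fun setT f -> measurable_fun S (EFin \o f).
Proof. by move=> mf; apply/measurable_funTS/measurable_EFinP. Qed.

Let integral_split (pi : probability (E * E)%type R) (f : E * E -> R) :
  pi ES = 1%E -> measurable_fun setT f -> (forall z, 0 <= f z) ->
  (\int[pi]_z (f z)%:E = \sum_i \int[pi]_(z in D i) (f z)%:E)%E.
Proof.
move=> pS mf f0; rewrite -(ge0_integral_full mES pS); last 2 first.
- exact: mEE.
- by move=> z; rewrite lee_fin.
rewrite ESE ge0_integral_bigsetU//.
- exact: index_enum_uniq.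
- move=> i j _ _ [z [[/= zi _] [/= zj _]]]; apply: q_inj.
  by rewrite -zi -zj.
- exact: mEE.
- by move=> z _; rewrite lee_fin.
Qed.

Let payoff (pi : probability (E * E)%type R) i : R :=
  fine (\int[pi]_(z in D i) (surplus z.1 z.2)%:E).

Let payoff_le_mass (pi : probability (E * E)%type R) i :
  (\int[pi]_(z in D i) (surplus z.1 z.2)%:E <= pi (D i))%E.
Proof.
apply: (@le_trans _ _ (\int[pi]_(z in D i) 1%:E)%E); last first.
  by rewrite integral_cst// mul1e.
apply: ge0_le_integral => //.
- by move=> z _; rewrite lee_fin ltW.
- exact: mEE.
- by move=> z _; rewrite lee_fin.
Qed.

Let payoffE (pi : probability (E * E)%type R) i :
  (\int[pi]_(z in D i) (surplus z.1 z.2)%:E = (payoff pi i)%:E)%E.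
Proof.
rewrite /payoff fineK// ge0_fin_numE.
  by apply: le_lt_trans (payoff_le_mass _ _) _; rewrite -ge0_fin_numE// fin_num_measure.
by apply: integral_ge0 => z _; rewrite lee_fin ltW.
Qed.

Let payoff_ge0 (pi : probability (E * E)%type R) i : 0 <= payoff pi i.
Proof.
by rewrite -lee_fin -payoffE; apply: integral_ge0 => z _; rewrite lee_fin ltW.
Qed.

Let nash_objectiveE (pi : probability (E * E)%type R) :
  (forall i, 0 < payoff pi i) ->
  nash_objective q Y pi = (ln N + N^-1 * \sum_i ln (payoff pi i))%:E.
Proof.
move=> p0; rewrite /nash_objective EFinD EFinM -sumEFin; congr (_ + _ * _)%E.
by apply: eq_bigr => i _; rewrite payoffE lne_EFin.
Qed.

Let nash_objective_Ny (pi : probability (E * E)%type R) i :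
  payoff pi i = 0 -> nash_objective q Y pi = -oo%E.
Proof.
move=> p0; rewrite /nash_objective (bigD1 i)//= payoffE p0 le0_lneNy//.
by rewrite addNye gt0_muleNy ?addeNy// lte_fin invr_gt0 ltr0n.
Qed.

(** The product of the empirical measure and [nu] has positive payoffs because the surplus is
    bounded below on the box. Its finite objective forces every payoff of a maximizer to be
    positive. *)
Let plans_positive : exists2 pi, plans q Y nu pi & forall i, 0 < payoff pi i.
Proof.
have mpair i : measurable_fun setT (fun y : E => (q i, y)).
  by apply: measurable_fun_pair.
pose Q i := sval (cid (probability_pushforward nu (mpair i))).
have QE i A : Q i A = nu ((fun y => (q i, y)) @^-1` A).
  by rewrite /Q; case: cid => /= ? [].
have w0 (i : 'I_m.+1) : 0 <= N^-1 by rewrite invr_ge0.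
have w1 : \sum_(i < m.+1) N^-1 = 1.
  by rewrite sumr_const card_ord -[_^-1 *+ _]mulr_natl divff// pnatr_eq0.
have [pi [piE _]] := probability_mixture Q w0 w1.
have sum_const : (\sum_(i < m.+1) (N^-1)%:E * 1%:E = 1%:E :> \bar R)%E.
  by under eq_bigr do rewrite mule1; rewrite sumEFin w1.
exists pi.
  split.
    rewrite /prob_on/= piE -[RHS]sum_const; apply: eq_bigr => i _.
    rewrite QE (_ : _ @^-1` _ = Y) ?nuY//.
    by apply/seteqP; split => [y []//|y Yy]; split => //; exists i.
  move=> A mA; rewrite /pushforward piE.
  rewrite (eq_bigr (fun i => (N^-1)%:E * nu A)%E); last by move=> i _; rewrite QE.
  by rewrite -ge0_sume_distrl ?sumEFin ?w1 ?mul1e// => i _; rewrite lee_fin.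
move=> i; rewrite -lte_fin -payoffE.
have piD : ((N^-1)%:E <= pi (D i))%E.
  rewrite piE (bigD1 i)//= -[leLHS]adde0; apply: leeD.
    rewrite QE (_ : _ @^-1` _ = Y) ?nuY ?mule1//.
    by apply/seteqP; split => [y []//|y Yy].
  by apply: sume_ge0 => j _; rewrite mule_ge0// lee_fin.
pose c := expR (- (n%:R * (2 * B) ^+ 2)).
apply: (@lt_le_trans _ _ (\int[pi]_(z in D i) c%:E)%E).
  rewrite integral_cst// mule_gt0 ?lte_fin ?expR_gt0//.
  by apply: lt_le_trans piD; rewrite lte_fin invr_gt0 ltr0n.
apply: ge0_le_integral => //.
- by move=> z _; rewrite lee_fin ltW ?expR_gt0.
- exact: mEE.
- move=> z [/= -> Yz]; rewrite lee_fin ler_expR lerN2.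
  by apply: half_sqdist_box => //; exact: YB.
Qed.

Let plans_mixture (pi pi' : probability (E * E)%type R) (e : R) : 0 <= e <= 1 ->
  plans q Y nu pi -> plans q Y nu pi' ->
  exists2 pe, plans q Y nu pe &
    forall i, payoff pe i = (1 - e) * payoff pi i + e * payoff pi' i.
Proof.
move=> /andP[e0 e1] [piS pinu] [piS' pinu'].
pose w (i : 'I_2) := if i == ord0 then 1 - e else e.
pose P (i : 'I_2) := if i == ord0 then pi else pi'.
have w0 (i : 'I_2) : 0 <= w i by rewrite /w; case: ifP => _ //; rewrite subr_ge0.
have w1 : \sum_(i < 2) w i = 1 by rewrite !big_ord_recl big_ord0 /w/= addr0 subrK.
have [pe [peE _]] := probability_mixture P w0 w1.
have pe2 A : pe A = ((1 - e)%:E * pi A + e%:E * pi' A)%E.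
  by rewrite peE !big_ord_recl big_ord0 /w /P/= adde0.
exists pe.
  split; first by rewrite /prob_on/= pe2 piS piS' !mule1 -EFinD subrK.
  move=> A mA; have := pinu _ mA; have := pinu' _ mA.
  rewrite /pushforward pe2 => -> ->; rewrite -ge0_muleDl ?lee_fin ?subr_ge0//.
  by rewrite -EFinD subrK mul1e.
move=> i; apply: EFin_inj; rewrite -payoffE.
rewrite (integral_mixture w0 (fun A _ => peE A))//; last 2 first.
- exact: mEE.
- by move=> z _; rewrite lee_fin ltW.
by rewrite !big_ord_recl big_ord0 /w /P/= adde0 !payoffE.
Qed.

Section maximizer.
Variable pi : probability (E * E)%type R.
Hypothesis pi_max : maximizer (plans q Y nu) (nash_objective q Y) pi.

Local Notation a := (payoff pi).

Let pi_plan : plans q Y nu pi. Proof. by case: pi_max. Qed.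

Let a_gt0 i : 0 < a i.
Proof.
rewrite lt0r payoff_ge0 andbT; apply/negP => /eqP ai0.
have [pi0 pi0_plan pi0_gt0] := plans_positive.
have := pi_max.2 _ pi0_plan.
by rewrite (nash_objective_Ny ai0) nash_objectiveE.
Qed.

(* The derivative of the objective at [pi] in the direction of [pi'] is at most 0. *)
Let first_order pi' : plans q Y nu pi' -> \sum_i payoff pi' i / a i <= N.
Proof.
move=> pi'_plan; pose x i := payoff pi' i / a i - 1.
have x_ge i : - 1 <= x i.
  by rewrite /x -subr_ge0 opprK subrK divr_ge0// ltW.
suff : \sum_i x i <= 0.
  by rewrite sumrB sumr_const card_ord subr_le0.
apply/ler_addgt0Pr => eta eta0; rewrite add0r.
pose S := \sum_i x i ^+ 2.
have S0 : 0 <= S by apply: sumr_ge0 => i _; exact: sqr_ge0.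
(* As [x i >= - 1], the bound [1 / 2] keeps [e * x i] above [- 1 / 2], and the other bound makes the
   second-order term [2 * e * S] at most [eta]. *)
pose e := Num.min (1 / 2) (eta / (2 * (S + 1))).
have S1 : 0 < 2 * (S + 1) by rewrite mulr_gt0// ltr_wpDl.
have e0 : 0 < e by rewrite /e lt_min !divr_gt0.
have e12 : e <= 1 / 2 by rewrite /e ge_min lexx.
have eS : e * (2 * (S + 1)) <= eta.
  by rewrite -ler_pdivlMr// /e ge_min lexx orbT.
have [|pe pe_plan peE] := plans_mixture _ pi_plan pi'_plan (e := e).
  by rewrite ltW//=; lra.
have pe_E i : payoff pe i = a i * (1 + e * x i).
  by rewrite peE /x; field; rewrite gt_eqF.
have ex_gt0 i : 0 < 1 + e * x i.
  have : e * (- 1) <= e * x i by rewrite ler_pM2l.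
  lra.
have pe_gt0 i : 0 < payoff pe i by rewrite pe_E mulr_gt0.
have := pi_max.2 _ pe_plan; rewrite !nash_objectiveE// lee_fin lerD2l.
rewrite ler_pM2l ?invr_gt0 ?ltr0n//.
have -> : \sum_i ln (payoff pe i) = \sum_i ln (a i) + \sum_i ln (1 + e * x i).
  by rewrite -big_split; apply: eq_bigr => i _; rewrite pe_E lnM ?posrE.
rewrite gerDl => ln_le0.
(* Uses [ln (1 + u) >= u - 2 * u ^+ 2] for [u >= - 1 / 2]; dividing the sum by [e] gives the
   claim. *)
have : \sum_i (e * x i - 2 * e ^+ 2 * x i ^+ 2) <= 0.
  apply: le_trans ln_le0; apply: ler_sum => i _.
  apply: le_trans (ln_ge_1subV (ex_gt0 i)).
  have -> : 1 - (1 + e * x i)^-1 = e * x i / (1 + e * x i) by field; rewrite gt_eqF.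
  rewrite ler_pdivlMr//.
  have : e * (- 1) <= e * x i by rewrite ler_pM2l.
  have -> : 2 * e ^+ 2 * x i ^+ 2 = 2 * (e * x i) ^+ 2 by ring.
  move: (e * x i) => u ue.
  have : 0 <= u ^+ 2 * (1 + 2 * u) by apply: mulr_ge0; [exact: sqr_ge0|lra].
  lra.
rewrite sumrB -!mulr_sumr -/S -[e ^+ 2]/(e * e).
have -> : e * \sum_i x i - 2 * (e * e) * S = e * (\sum_i x i - e * (2 * S)) by ring.
rewrite pmulr_rle0// subr_le0 => /le_trans; apply; apply: le_trans eS.
by rewrite ler_pM2l//; lra.
Qed.

(** [alpha] is [(a i)^-1] at [q i] and 0 off the points. It makes [ratio] a measurable function of
    all pairs, whose integral against a plan is the sum in [first_order]. *)
Let alpha (x : E) : R := \sum_l (a l)^-1 * \1_[set q l] x.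
Let ratio (z : E * E) : R := surplus z.1 z.2 * alpha z.1.

Let alphaE i : alpha (q i) = (a i)^-1.
Proof.
rewrite /alpha (bigD1 i)//= indicE mem_set// mulr1 big1 ?addr0// => j ji.
rewrite indicE memNset ?mulr0// => /= /q_inj ij.
by move: ji; rewrite ij eqxx.
Qed.

Let malpha : measurable_fun setT alpha.
Proof.
by apply: measurable_sum => l; apply: measurable_funM.
Qed.

Let alpha_ge0 x : 0 <= alpha x.
Proof. by apply: sumr_ge0 => l _; rewrite mulr_ge0// invr_ge0 ltW. Qed.

Let mratio : measurable_fun setT ratio.
Proof.
by apply: measurable_funM => //; exact: measurableT_comp malpha measurable_fst.
Qed.

Let ratio_ge0 z : 0 <= ratio z.
Proof. by rewrite mulr_ge0// ltW. Qed.

Let integral_ratio pi' : plans q Y nu pi' ->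
  (\int[pi']_z (ratio z)%:E = (\sum_i payoff pi' i / a i)%:E)%E.
Proof.
move=> [pS _]; rewrite integral_split//.
rewrite -sumEFin; apply: eq_bigr => i _.
rewrite (eq_integral (fun z => (a i)^-1%:E * (surplus z.1 z.2)%:E)%E); last first.
  by move=> z /[!inE] -[/= zi _]; rewrite /ratio zi alphaE mulrC EFinM.
rewrite ge0_integralZl_EFin ?payoffE//.
- by rewrite -EFinM mulrC.
- by move=> z _; rewrite lee_fin ltW.
- exact: mEE.
- by rewrite invr_ge0 ltW.
Qed.

(* Sending the points [z] of this set to [(q j, z.2)] gives a plan which would
   otherwise violate [first_order]. *)
Let ratio_max j : pi [set z | ratio z < surplus (q j) z.2 / a j] = 0%E.
Proof.
pose T (z : E * E) : E * E := if ratio z < surplus (q j) z.2 / a j then (q j, z.2) else z.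
have msj : measurable_fun setT (fun z : E * E => surplus (q j) z.2 / a j).
  by apply: measurable_funM => //; apply: msurplus => //; exact: measurable_snd.
have mlt : measurable_fun setT (fun z => ratio z < surplus (q j) z.2 / a j).
  exact: measurable_fun_ltr.
have mT : measurable_fun setT T.
  apply: measurable_fun_ifT => //.
  by apply: measurable_fun_pair => //; exact: measurable_snd.
have [pi' [pi'E pi'I]] := probability_pushforward pi mT.
have pi'_plan : plans q Y nu pi'.
  split.
    apply/eqP; rewrite eq_le probability_le1//= pi'E.
    rewrite -pi_plan.1; apply: le_measure; rewrite ?inE//.
      by rewrite -[X in measurable X]setTI; exact: mT.
    move=> z [z1 z2]; rewrite /T/=; case: ifP => _; last by split.
    by split => //=; exists j.
  move=> A mA; rewrite /pushforward pi'E -(pi_plan.2 _ mA) /pushforward.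
  congr (pi _); apply/seteqP; split => z /=; rewrite /T; by case: ifP.
have ratioT z : ratio (T z) = Num.max (ratio z) (surplus (q j) z.2 / a j).
  rewrite /T; case: ltP => // h; rewrite /ratio/= alphaE//.
(* The gain made by [T] is nonnegative, and by [first_order] its integral is at most 0, so it
   vanishes almost everywhere; on the set in question it is positive. *)
pose gap z := ratio (T z) - ratio z.
have gap_ge0 z : 0 <= gap z by rewrite subr_ge0 ratioT le_max lexx.
have mratioT : measurable_fun setT (ratio \o T) by exact: measurableT_comp.
have mgap : measurable_fun setT gap by exact: measurable_funB.
have Na : (\int[pi]_z (ratio z)%:E = N%:E)%E.
  rewrite integral_ratio//; congr EFin; rewrite (eq_bigr (fun=> 1)).
    by rewrite sumr_const card_ord.
  by move=> i _; rewrite divff// gt_eqF.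
have gap_le0 : (\int[pi]_z (gap z)%:E <= 0)%E.
  have : (\int[pi]_z (ratio z)%:E + \int[pi]_z (gap z)%:E <= N%:E)%E.
    rewrite -ge0_integralD//; last 4 first.
    - by move=> z _; rewrite lee_fin.
    - exact: mEE.
    - by move=> z _; rewrite lee_fin.
    - exact: mEE.
    under eq_integral do rewrite -EFinD subrKC.
    rewrite -(pi'I (fun z => (ratio z)%:E)); last 2 first.
    - exact: mEE.
    - by move=> z; rewrite lee_fin.
    by rewrite integral_ratio// lee_fin first_order.
  by rewrite Na -[leRHS]adde0 leeD2lE.
have gap0 : (\int[pi]_z `|(gap z)%:E| = 0)%E.
  apply/eqP; rewrite eq_le integral_ge0// andbT.
  by under eq_integral do rewrite /= ger0_norm//.
have [+ _] := @ae_eq_integral_abs _ _ _ pi setT measurableT _ (@mEE setT _ mgap).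
move=> /(_ gap0) [A [mA A0 gapA]]; apply: (subset_measure0 _ mA _ A0).
  by rewrite -[X in measurable X]setTI; exact: (mlt measurableT [set true] I).
move=> z /= zlt; apply: gapA => /= /(_ I) /eqP; rewrite eqe /gap subr_eq0 ratioT.
by rewrite max_r ?ltW// gt_eqF.
Qed.

(* By [ratio_max], [pi] sends almost every [y] to the points [q i] maximizing
   [surplus (q i) y / a i], where [a i] is the payoff of [q i]; this says that
   [y] is in the Laguerre cell of [phi i = ln (a i) + half_sq (q i)]. *)
Lemma maximizer_structure : exists (w phi : 'I_m.+1 -> R) (rho : 'I_m.+1 -> probability E R),
  [/\ forall i, 0 < w i,
    forall i, rho i (laguerre_cell q Y phi i) = 1%E,
    forall A, measurable A -> (nu A = \sum_i (w i)%:E * rho i A)%E,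
    forall i A, measurable A -> (pi ([set q i] `*` A) = (w i)%:E * rho i A)%E &
    forall i, (expR (phi i - half_sq (q i)))%:E =
      ((w i)%:E * \int[rho i]_y (surplus (q i) y)%:E)%E].
Proof.
pose w i := fine (pi (D i)).
have wE i : pi (D i) = (w i)%:E by rewrite /w fineK// fin_num_measure.
have w0 i : 0 < w i.
  apply: lt_le_trans (a_gt0 i) _; rewrite -lee_fin -wE -payoffE.
  exact: payoff_le_mass.
(* The density, relative to [pi], of [pi] conditioned on player [i]; [rho i] is the second marginal
   of this conditional measure. *)
pose dens i (z : E * E) : R := \1_(D i) z / w i.
have mdens i : measurable_fun setT (dens i).
  by apply: measurable_funM => //; exact: measurable_indic.
have dens0 i z : 0 <= dens i z by rewrite divr_ge0// ltW.
have dens_int i (g : E * E -> R) : measurable_fun setT g -> (forall z, 0 <= g z) ->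
    (\int[pi]_z ((g z)%:E * (dens i z)%:E) = (w i)^-1%:E * \int[pi]_(z in D i) (g z)%:E)%E.
  move=> mg g0.
  rewrite [in RHS]integral_mkcond -ge0_integralZl_EFin//.
  - apply: eq_integral => z _; rewrite /dens patchE indicE.
    by case: ifPn => _; rewrite ?mul1r ?mul0r ?mule0// muleC.
  - by move=> z _; rewrite patchE; case: ifP => _ //; rewrite lee_fin.
  - by apply/(measurable_restrictT _ (mD i)); exact: mEE.
  - by rewrite invr_ge0 ltW.
have dens1 i : (\int[pi]_z (dens i z)%:E = 1)%E.
  have := dens_int i (fun=> 1) (measurable_cst _) (fun _ => ler01).
  rewrite integral_cst// mul1e [X in (_ * X)%E]wE -EFinM mulVf ?gt_eqF// => <-.
  by apply: eq_integral => z _; rewrite mul1e.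
pose Q i := sval (cid (probability_density (mdens i) (dens0 i) (dens1 i))).
have QE i := svalP (cid (probability_density (mdens i) (dens0 i) (dens1 i))).
pose rho i := sval (cid (probability_pushforward (Q i) (@measurable_snd _ _ E E))).
have rhoE i := svalP (cid (probability_pushforward (Q i) (@measurable_snd _ _ E E))).
have rhoI i (g : E -> R) : measurable_fun setT g -> (forall y, 0 <= g y) ->
    ((w i)%:E * \int[rho i]_y (g y)%:E = \int[pi]_(z in D i) (g z.2)%:E)%E.
  move=> mg g0; have mg2 : measurable_fun setT (fun z : E * E => g z.2).
    exact: measurableT_comp mg measurable_snd.
  rewrite (rhoE i).2; last 2 first.
  - exact/measurable_EFinP.
  - by move=> y; rewrite lee_fin.
  rewrite (QE i); last 2 first.
  - exact: mEE.
  - by move=> z; rewrite lee_fin.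
  by rewrite dens_int// muleA -EFinM divff ?gt_eqF// mul1e.
have rhoA i A : measurable A -> ((w i)%:E * rho i A = pi (D i `&` (setT `*` A)))%E.
  move=> mA; rewrite -[rho i A](_ : \int[rho i]_y (\1_A y)%:E = _)%E; last first.
    by rewrite integral_indic// setIT.
  have mind : measurable_fun setT (\1_A : E -> R) by exact: measurable_indic.
  rewrite (rhoI i _ mind (fun _ => ler0n _ _)).
  rewrite [in RHS]setIC -(@integral_indic _ _ _ pi (D i) (mD i) (setT `*` A)); last first.
    exact: measurableX.
  by apply: eq_integral => -[x y] _; rewrite !indicE in_setX in_setT.
pose phi i := ln (a i) + half_sq (q i).
have rhoY i : rho i Y = 1%E.
  have h := rhoA i Y mY; have wi : (w i)%:E != 0%E by rewrite eqe gt_eqF.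
  rewrite (_ : D i `&` _ = D i) ?wE in h; last first.
    by apply/seteqP; split => [z []//|z [z1 z2]]; split.
  have := fineK (fin_num_measure (rho i) Y mY) => rE; rewrite -rE in h *.
  move: h; rewrite -EFinM => -[h]; congr EFin.
  by apply: (mulfI (lt0r_neq0 (w0 i))); rewrite h mulr1.
have pi_setI A : measurable A -> pi A = pi (A `&` ES).
  by move=> mA; rewrite (probability_setI_full mES pi_plan.1).
have rho_setI i A : measurable A -> rho i (A `&` Y) = rho i A.
  by move=> mA; rewrite (probability_setI_full mY (rhoY i)).
have DiA i A : D i `&` (setT `*` A) = [set q i] `*` (A `&` Y).
  by apply/seteqP; split => -[x y] /=; tauto.
have piA i A : measurable A -> pi ([set q i] `*` A) = ((w i)%:E * rho i A)%E.
  move=> mA; rewrite rhoA// DiA (pi_setI _ (measurableX (mq i) mA)); congr (pi _).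
  apply/seteqP; split => [[x y] [[/= xi Ay] [_ Yy]] //|[x y] [/= xi [Ay Yy]]].
  by split => //; split => //; exists i.
have mbad i j : measurable [set y | surplus (q i) y / a i < surplus (q j) y / a j].
  have mlt : measurable_fun setT (fun y => surplus (q i) y / a i < surplus (q j) y / a j).
    by apply: measurable_fun_ltr; apply: measurable_funM => //; exact: msurplus.
  by rewrite -[X in measurable X]setTI; exact: (mlt measurableT [set true] I).
have bad0 i j : rho i [set y | surplus (q i) y / a i < surplus (q j) y / a j] = 0%E.
  have h := rhoA i _ (mbad i j).
  have : pi (D i `&` (setT `*` [set y | surplus (q i) y / a i < surplus (q j) y / a j])) = 0%E.
    apply: (subset_measure0 _ _ _ (ratio_max j)).
    - by apply: measurableI => //; exact: measurableX.
    - have mlt : measurable_fun setT (fun z : E * E => ratio z < surplus (q j) z.2 / a j).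
        apply: measurable_fun_ltr => //; apply: measurable_funM => //.
        by apply: msurplus => //; exact: measurable_snd.
      by rewrite -[X in measurable X]setTI; exact: (mlt measurableT [set true] I).
    - by move=> [x y] /= [[-> _] [_ h']]; rewrite /ratio/= alphaE.
  rewrite -h => /eqP; rewrite mule_eq0 eqe gt_eqF//= => /eqP.
  exact.
exists w, phi, rho; split => //.
- move=> i.
  have cellE : laguerre_cell q Y phi i = Y `&` ~` \big[setU/set0]_(j < m.+1)
      [set y | surplus (q i) y / a i < surplus (q j) y / a j].
    (* After logarithms and expansion of the squares, [half_sq y] cancels and the comparison becomes
       affine in [y]. *)
    have le_iff j y : (phi i + dotv (q j - q i) y <= phi j) =
        (surplus (q j) y / a j <= surplus (q i) y / a i).
      rewrite -ler_ln ?posrE ?divr_gt0// !ln_div ?posrE//.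
      rewrite /surplus !expRK !half_sqdist dotvBl /phi.
      by apply/idP/idP; lra.
    rewrite -bigcup_seq; apply/seteqP; split => [y [Yy h]|y [Yy h]].
      split=> // -[j _ /=]; apply/negP; rewrite -leNgt -le_iff; exact: h.
    split=> // j; rewrite le_iff leNgt; apply/negP => hj; apply: h.
    by exists j => //=; exact: mem_index_enum.
  have mU : measurable (\big[setU/set0]_(j < m.+1)
      [set y | surplus (q i) y / a i < surplus (q j) y / a j]).
    by apply: bigsetU_measurable => j _; exact: mbad.
  rewrite cellE setIC probability_setI_full//; last exact: measurableC.
  rewrite probability_setC// (_ : rho i _ = 0%E) ?sube0//.
  suff [] : measurable (\big[setU/set0]_(j < m.+1)
      [set y | surplus (q i) y / a i < surplus (q j) y / a j]) /\
    rho i (\big[setU/set0]_(j < m.+1)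
      [set y | surplus (q i) y / a i < surplus (q j) y / a j]) = 0%E by [].
  elim/big_ind : _ => [|S1 S2 [m1 h1] [m2 h2]|j _]; first by rewrite measure0.
    split; first exact: measurableU.
    apply/eqP; rewrite eq_le measure_ge0 andbT.
    apply: le_trans (measureU2 _ m1 m2) _; rewrite -[leRHS]adde0.
    by apply: leeD; [move/eqP: h1|move/eqP: h2]; rewrite eq_le => /andP[].
  by split; [exact: mbad|exact: bad0].
- move=> A mA; rewrite -(pi_plan.2 _ mA) /pushforward.
  have mA2 : measurable (@snd E E @^-1` A).
    by rewrite -[X in measurable X]setTI; exact: measurable_snd.
  have mind : measurable_fun setT (\1_A : E -> R) by exact: measurable_indic.
  transitivity (\int[pi]_z ((\1_A : E -> R) z.2)%:E)%E.
    rewrite -[X in pi X]setIT -(integral_indic pi measurableT mA2).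
    by apply: eq_integral.
  rewrite (integral_split pi_plan.1); last 2 first.
  - exact: measurableT_comp mind measurable_snd.
  - by [].
  apply: eq_bigr => i _; rewrite -rhoI//; congr (_ * _)%E.
  by rewrite integral_indic// setIT.
- move=> i; rewrite rhoI//; last first.
  + by move=> y; rewrite ltW.
  + exact: msurplus.
  rewrite addrK lnK ?posrE// -payoffE; apply: eq_integral => z /[!inE] -[/= -> _].
  by [].
Qed.

End maximizer.

End nash.

(** * Estimates for the discrete problem *)

Section potential.
Context (R : realType) (n : nat).
Local Notation E := 'rV[R]_n.
Context (Y : set E) (B : R) (m : nat) (q : 'I_m.+1 -> E) (phi : 'I_m.+1 -> R).
Hypotheses (mY : measurable Y) (Y0 : Y !=set0) (B0 : 0 < B).
Hypotheses (qB : forall i j, `|q i ord0 j| <= B).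
Hypothesis YB : forall y, Y y -> forall j, `|y ord0 j| <= B.

Local Notation cell i := (laguerre_cell q Y phi i).

(** The convex conjugate of [phi], viewed as a function on the finite set of points; on the cell of
    [q i] its maximum is attained by the piece of index [i]. *)
Definition affine_max (y : E) : R :=
  \big[Num.max/dotv (q ord0) y - phi ord0]_j (dotv (q j) y - phi j).

(* The Legendre transform of [affine_max] over [Y]: the largest convex
   function with slopes in [Y] that is at most [phi] on the points [q i]. *)
Definition potential (x : E) : R := sup [set dotv x y - affine_max y | y in Y].

Lemma affine_max_ge j y : dotv (q j) y - phi j <= affine_max y.
Proof. exact: le_bigmax. Qed.

Lemma affine_max_le y c : (forall j, dotv (q j) y - phi j <= c) -> affine_max y <= c.
Proof. by move=> h; apply/bigmax_leP; split=> // j _; exact: h. Qed.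

Lemma affine_max_cell i y : cell i y -> affine_max y = dotv (q i) y - phi i.
Proof.
move=> [Yy h]; apply/eqP; rewrite eq_le affine_max_ge andbT.
by apply: affine_max_le => j; have := h j; rewrite dotvBl; lra.
Qed.

Lemma measurable_affine_max : measurable_fun setT affine_max.
Proof.
apply: measurable_bigmax => j; apply: measurable_funB => //.
exact: measurable_dotv.
Qed.

Lemma measurable_laguerre_cell i : measurable (cell i).
Proof.
rewrite (_ : cell i = Y `&` \bigcap_(j in [set: 'I_m.+1])
    [set y | phi i + dotv (q j - q i) y <= phi j]); last first.
  apply/seteqP; split => [y [Yy h]|y [Yy h]]; split=> // j; first by move=> _; exact: h.
  exact: (h j I).
apply: measurableI => //; apply: fin_bigcap_measurable => // j _.
have mle : measurable_fun setT (fun y : E => phi i + dotv (q j - q i) y <= phi j).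
  apply: measurable_fun_ler => //; apply: measurable_funD => //.
  exact: measurable_dotv.
by rewrite -[X in measurable X]setTI; exact: (mle measurableT [set true] I).
Qed.

Lemma affine_max_bounded : exists C : R, forall y, Y y -> `|affine_max y| <= C.
Proof.
pose C := n%:R * B * B + \sum_j `|phi j|.
exists C => y Yy.
have H j : `|dotv (q j) y - phi j| <= C.
  apply: le_trans (ler_normB _ _) _; apply: lerD.
    apply: le_trans (ler_dotv _ (YB Yy)) _; rewrite ler_wpM2l//.
      by rewrite mulr_ge0// ltW.
    by apply: norm_le_box => //; exact: qB.
  by rewrite (bigD1 j)//= lerDl sumr_ge0.
rewrite ler_norml; apply/andP; split.
  apply: le_trans (affine_max_ge ord0 y).
  by have := H ord0; rewrite ler_norml => /andP[].
by apply: affine_max_le => j; apply: le_trans (ler_norm _) (H j).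
Qed.

Let has_sup_potential x : has_sup [set dotv x y - affine_max y | y in Y].
Proof.
split; first by have [y Yy] := Y0; exists (dotv x y - affine_max y); exists y.
have [C hC] := affine_max_bounded.
exists (n%:R * B * `|x| + C) => _ [y Yy <-].
apply: lerD; first exact: le_trans (ler_norm _) (ler_dotv x (YB Yy)).
by rewrite lerNl; have := hC _ Yy; rewrite ler_norml => /andP[].
Qed.

Lemma potential_ge x y : Y y -> dotv x y - affine_max y <= potential x.
Proof. by move=> Yy; apply: (sup_upper_bound (has_sup_potential x)); exists y. Qed.

Lemma potential_le x c : (forall y, Y y -> dotv x y - affine_max y <= c) ->
  potential x <= c.
Proof.
move=> h; apply: ge_sup; first by case: (has_sup_potential x).
by move=> _ [y Yy <-]; exact: h.
Qed.

Lemma potential_le_point i : potential (q i) <= phi i.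
Proof.
by apply: potential_le => y Yy; have := affine_max_ge i y; lra.
Qed.

(** The right notion of subgradient here uses [phi i], of which [potential (q i)] is a priori only a
    lower bound; the two agree as soon as the cell is nonempty. *)
Lemma potential_subgradient i x y : cell i y -> phi i + dotv (x - q i) y <= potential x.
Proof.
move=> cy; have := potential_ge x cy.1; rewrite (affine_max_cell cy) dotvBl; lra.
Qed.

Lemma potential_lip x x' : `|potential x - potential x'| <= n%:R * B * `|x - x'|.
Proof.
suff H u v : potential u <= potential v + n%:R * B * `|u - v|.
  have := H x x'; have := H x' x; rewrite (distrC x') ler_norml.
  by move: (`|x - x'|) => d h1 h2; apply/andP; split; lra.
apply: potential_le => y Yy.
have := potential_ge v Yy; have := ler_dotv (u - v) (YB Yy); rewrite dotvBl.
move=> /(le_trans (ler_norm _)); move: (`|u - v|) => d; lra.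
Qed.

Lemma potential_convex k t x : 0 <= second_diff potential k t x.
Proof.
rewrite /second_diff subr_ge0 -ler_pdivlMl//; apply: potential_le => y Yy.
have := potential_ge (x + t *: delta_mx ord0 k) Yy.
have := potential_ge (x - t *: delta_mx ord0 k) Yy.
by rewrite dotvBl dotvDl; lra.
Qed.

(* The points of the cell are subgradients of [potential] at [q i]. *)
Lemma cell_width i k t y y' : 0 < t -> cell i y -> cell i y' ->
  `|y ord0 k - y' ord0 k| <= second_diff potential k t (q i) / t.
Proof.
move=> t0.
suff H z z' : cell i z -> cell i z' ->
    z ord0 k - z' ord0 k <= second_diff potential k t (q i) / t.
  by move=> cy cy'; rewrite ler_norml lerNl opprB !H.
move=> cz cz'; rewrite ler_pdivlMr// /second_diff.
have h1 := potential_subgradient (q i + t *: delta_mx ord0 k) cz.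
have h2 := potential_subgradient (q i - t *: delta_mx ord0 k) cz'.
rewrite addrAC subrr add0r dotvZl dotv_delta in h1.
rewrite addrAC subrr add0r -scaleNr dotvZl dotv_delta in h2.
by have := potential_le_point i; rewrite -scaleNr; lra.
Qed.

Lemma cell_cost_osc i (t : 'I_n -> R) y y' : (forall k, 0 < t k) ->
  cell i y -> cell i y' ->
  sqdist (q i) y / 2 - sqdist (q i) y' / 2 <=
  2 * B * \sum_k second_diff potential k (t k) (q i) / t k.
Proof.
move=> t0 cy cy'.
apply: le_trans (half_sqdist_osc (qB i) (YB cy.1) (YB cy'.1)) _.
rewrite ler_pM2l ?mulr_gt0//; apply: ler_sum => k _.
exact: cell_width.
Qed.

End potential.

Section discrete_problem.
Context (R : realType) (n : nat).
Local Notation E := 'rV[R]_n.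
Context (X Y : set E) (mu nu : probability E R) (B : R).
Hypotheses (mX : measurable X) (mY : measurable Y) (B0 : 0 < B).
Hypotheses (muX : mu X = 1%E) (nuY : nu Y = 1%E).
Hypothesis XB : forall x, X x -> forall j, `|x ord0 j| <= B.
Hypothesis YB : forall y, Y y -> forall j, `|y ord0 j| <= B.

(** The conclusion of [limit_objective_stability] as a property of the dual value [e] and of [gam]
    alone, so that the convergence argument does not handle potentials. *)
Definition stability_bound (e : R) (gam : E -> R) :=
  forall (b : probability E R) (L0 : R) (f : E -> R) (Bf dl : R),
  b Y = 1%E -> (L0%:E <= limit_objective X Y mu nu b)%E ->
  measurable_fun Y f -> (forall y, Y y -> `|f y| <= Bf) -> 0 < dl ->
  `|\int[b]_(y in Y) f y - \int[nu]_(y in Y) (f y * expR (gam y))| <=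
  Bf * ((e - L0) / (2 * dl) + 2 * dl).

Context (eta : R) (t : 'I_n -> R).
(** The summand 1 keeps the Lipschitz constant positive also for [n = 0], as [second_diff_small]
    requires. *)
Let L : R := n%:R * B + 1.
Hypotheses (t0 : forall k, 0 < t k).
Hypothesis t_small : forall k (phi : E -> R),
  (forall x y, `|phi x - phi y| <= L * `|x - y|) ->
  (forall k t x, 0 <= second_diff phi k t x) ->
  (\int[mu]_(x in X) (second_diff phi k (t k) x)%:E <= (eta * t k)%:E)%E.

Context (m : nat) (p : forall N : nat, 'I_N -> E) (eps : R).
Arguments p : clear implicits.
Local Notation q := (p m.+1).
Local Notation N := (m.+1%:R : R).
Hypotheses (qX : forall i, X (q i)) (q_inj : injective q) (eps0 : 0 <= eps).
Hypothesis weights : exists tau : 'I_m.+1 -> E -> R, transport_weights X mu p eps tau.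
Context (pi : probability (E * E)%type R) (beta : probability E R).
Hypothesis pi_max : maximizer (plans q Y nu) (nash_objective q Y) pi.
Hypothesis beta_assoc : associated_measure q Y pi beta.

(* [e] is the dual value of the potentials [psi] and [gam] built from the
   Lagrange multipliers [phi]; the cells enter the error only through their
   widths, which are small on average over the points. *)
Lemma discrete_estimate : exists e gam, stability_bound e gam /\
  ((e - (4 * n%:R * B * eps + 4 * B * \sum_k (eta + 4 * L * eps / t k)))%:E <=
    limit_objective X Y mu nu beta)%E.
Proof.
have qB i : forall j, `|q i ord0 j| <= B by exact: XB.
have [w [phi [rho [w0 rho_cell nuE piE aE]]]] :=
  maximizer_structure mY nuY q_inj B0 qB YB pi_max.
have [tau Htau] := weights.
have Y0 := full_measure_nonempty nuY.
have nB0 : 0 <= n%:R * B by rewrite mulr_ge0// ltW.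
have Nn0 : N != 0 by rewrite pnatr_eq0.
have iN0 : 0 <= N^-1 by rewrite invr_ge0.
have sumN : \sum_(i < m.+1) N^-1 = 1.
  by rewrite sumr_const card_ord -[_^-1 *+ _]mulr_natl divff.
have mcell i : measurable (laguerre_cell q Y phi i) by exact: measurable_laguerre_cell.
have rhoY i : rho i Y = 1%E.
  apply/eqP; rewrite eq_le probability_le1//= -(rho_cell i).
  by apply: le_measure; rewrite ?inE//; move=> y [].
pose Phi := potential Y q phi.
have Phi_lip x y : `|Phi x - Phi y| <= n%:R * B * `|x - y| by exact: potential_lip.
have mPhi : measurable_fun setT Phi by exact: lipschitz_measurable_rV Phi_lip.
have mhs : measurable_fun setT (@half_sq R n) by exact: measurable_half_sq.
(* With these signs, [dual] is the Fenchel inequality between [Phi] and [affine_max]; the two terms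
   [ln N] cancel there. *)
pose gam y := affine_max q phi y - half_sq y - ln N.
pose psi x := Phi x - half_sq x + ln N.
have mgam : measurable_fun setT gam.
  apply: measurable_funB => //; apply: measurable_funB => //.
  exact: measurable_affine_max.
have mpsi : measurable_fun setT psi.
  by apply: measurable_funD => //; exact: measurable_funB.
have [C hC] := affine_max_bounded phi B0 qB YB.
have gam_bd y : Y y -> `|gam y| <= C + n%:R * B ^+ 2 + `|ln N|.
  move=> Yy; apply: le_trans (ler_normB _ _) _; rewrite lerD2r.
  apply: le_trans (ler_normB _ _) _; apply: lerD; first exact: hC.
  exact: half_sq_box (YB Yy).
have psi_bd x : X x -> `|psi x| <= (`|Phi 0| + n%:R * B * B) + n%:R * B ^+ 2 + `|ln N|.
  move=> Xx; apply: le_trans (ler_normD _ _) _; rewrite lerD2r.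
  apply: le_trans (ler_normB _ _) _; apply: lerD; last exact: half_sq_box (XB Xx).
  rewrite -[Phi x](subrK (Phi 0)) addrC; apply: le_trans (ler_normD _ _) _.
  rewrite lerD2l; apply: le_trans (Phi_lip _ _) _; rewrite subr0 ler_wpM2l//.
  by apply: norm_le_box => //; exact: XB.
have dual x y : X x -> Y y -> - psi x - gam y <= sqdist x y / 2.
  move=> _ Yy; rewrite half_sqdist /psi /gam.
  by have := @potential_ge _ _ Y B _ q phi Y0 B0 qB YB x y Yy; rewrite -/Phi; lra.
(* On the cell of [q i], [expR gam] is [N^-1 * surplus (q i)] divided by the payoff of [q i]. By
   [aE] each cell thus receives mass [N^-1], which is the purpose of the term [ln N]. *)
have gam1 : (\int[nu]_(y in Y) (expR (gam y))%:E <= 1)%E.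
  have mexp : measurable_fun setT (fun y => expR (gam y)).
    exact: measurableT_comp (@measurable_expR R) mgam.
  have ms i : measurable_fun setT (surplus (q i)).
    apply: measurableT_comp (@measurable_expR R) _.
    by apply: measurableT_comp => //; exact: measurable_half_sqdist.
  rewrite (integral_mixture (fun i => ltW (w0 i)) nuE mY); last 2 first.
  - by apply/measurable_funTS/measurable_EFinP.
  - by move=> y _; rewrite lee_fin expR_ge0.
  rewrite (eq_bigr (fun=> (N^-1)%:E)) ?sumEFin ?sumN// => i _.
  rewrite (ge0_integral_full mY (rhoY i)); last 2 first.
  - exact/measurable_EFinP.
  - by move=> y; rewrite lee_fin expR_ge0.
  rewrite -(ge0_integral_full (mcell i) (rho_cell i)); last 2 first.
  - exact/measurable_EFinP.
  - by move=> y; rewrite lee_fin expR_ge0.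
  pose c := N^-1 * expR (- (phi i - half_sq (q i))).
  have c0 : 0 <= c by rewrite mulr_ge0// expR_ge0.
  rewrite (eq_integral (fun y => c%:E * (surplus (q i) y)%:E)%E); last first.
    move=> y /[!inE] cy; rewrite -EFinM; congr EFin.
    rewrite /gam (affine_max_cell cy) expRD expRN lnK ?posrE ?ltr0n//.
    rewrite /c mulrC -mulrA; congr (_ * _); rewrite /surplus half_sqdist -expRD.
    by congr expR; lra.
  rewrite ge0_integralZl_EFin//; last 2 first.
  - by move=> y _; rewrite lee_fin expR_ge0.
  - by apply/measurable_funTS/measurable_EFinP.
  rewrite (ge0_integral_full (mcell i) (rho_cell i)); last 2 first.
  - exact/measurable_EFinP.
  - by move=> y; rewrite lee_fin expR_ge0.
  rewrite muleCA -aE -EFinM /c -mulrA -expRD addNr expR0 mulr1//.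
pose e := \int[mu]_(x in X) psi x.
exists e, gam; split.
  move=> b L0 f Bf dl bY L0le mf fB dl0.
  exact: (limit_objective_stability mX mY muX nuY mpsi mgam psi_bd gam_bd dual gam1 bY L0le).
have e_le : e <= N^-1 * \sum_i psi (q i) + 2 * n%:R * B * eps.
  apply: (Rintegral_le_mean mX B0 XB qX Htau mpsi); first by rewrite -mulrA mulr_ge0.
  move=> x y Xx Xy.
  have -> : psi x - psi y = (Phi x - Phi y) - (half_sq x - half_sq y) by rewrite /psi; lra.
  apply: le_trans (ler_normB _ _) _.
  have := Phi_lip x y; have := half_sq_lip (XB Xx) (XB Xy).
  by move: (`|x - y|) (`|Phi x - _|) (`|half_sq x - _|) => d1 d2 d3; lra.
pose osc i := 2 * B * \sum_k second_diff Phi k (t k) (q i) / t k.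
pose c i y := sqdist (q i) y / 2.
have mc i : measurable_fun setT (c i) by exact: measurable_half_sqdist.
(* A reverse Jensen inequality: the mean of the cost over a cell exceeds minus the logarithm of the
   mean surplus by at most twice the oscillation. That mean surplus is
   [expR (phi i - half_sq (q i)) / w i]. *)
have cell_est i : (\int[rho i]_y (c i y)%:E <=
    (ln (w i) - (phi i - half_sq (q i)) + 2 * osc i)%:E)%E.
  have [y0 cy0] := full_measure_nonempty (rho_cell i).
  have c_osc y : laguerre_cell q Y phi i y -> `|c i y - c i y0| <= osc i.
    move=> cy; rewrite ler_norml lerNl opprB.
    by apply/andP; split; apply: (cell_cost_osc Y0 B0 qB YB t0).
  have up : (\int[rho i]_y (c i y)%:E <= (c i y0 + osc i)%:E)%E.
    rewrite -(ge0_integral_full (mcell i) (rho_cell i)); last 2 first.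
    - exact/measurable_EFinP.
    - by move=> y; rewrite lee_fin half_sqdist_ge0.
    rewrite -[leRHS](integral_cst_full (mcell i) (rho_cell i)).
    apply: ge0_le_integral => //.
    - by move=> y _; rewrite lee_fin half_sqdist_ge0.
    - by apply/measurable_funTS/measurable_EFinP.
    - move=> y cy; rewrite lee_fin; have := c_osc _ cy.
      by rewrite ler_norml => /andP[_]; rewrite lerBlDl.
  have lo : expR (phi i - half_sq (q i)) <= w i * expR (- (c i y0 - osc i)).
    rewrite -lee_fin aE EFinM; apply: lee_wpmul2l; first by rewrite lee_fin ltW.
    have ms : measurable_fun setT (surplus (q i)).
      apply: measurableT_comp (@measurable_expR R) _.
      by apply: measurableT_comp => //; exact: mc.
    rewrite -(ge0_integral_full (mcell i) (rho_cell i)); last 2 first.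
    - exact/measurable_EFinP.
    - by move=> y; rewrite lee_fin expR_ge0.
    rewrite -[leRHS](integral_cst_full (mcell i) (rho_cell i)).
    apply: ge0_le_integral => //.
    - by move=> y _; rewrite lee_fin expR_ge0.
    - by apply/measurable_funTS/measurable_EFinP.
    - move=> y cy; rewrite lee_fin /surplus ler_expR lerN2 -/(c i y).
      have := c_osc _ cy; rewrite ler_norml => /andP[+ _].
      by rewrite lerBrDl lerBlDr addrC -lerBlDr.
  apply: le_trans up _; rewrite lee_fin.
  move: lo; rewrite -ler_ln ?posrE ?mulr_gt0 ?expR_gt0// lnM ?posrE ?expR_gt0//.
  by rewrite !expRK; lra.
have bE A : measurable A -> (beta A = \sum_i (N^-1)%:E * rho i A)%E.
  move=> mA; have [bY bF] := beta_assoc.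
  rewrite -(probability_setI_full mY bY mA) bF; [|exact: measurableI|by move=> y []].
  rewrite ge0_sume_distrr; last first.
    by move=> i _; rewrite mule_ge0// inve_ge0.
  apply: eq_bigr => i _; congr (_ * _)%E; rewrite !piE//; last exact: measurableI.
  rewrite rhoY mule1 (probability_setI_full mY (rhoY i) mA).
  rewrite -(fineK (fin_num_measure (rho i) A mA)) inver gt_eqF// -!EFinM.
  by congr EFin; rewrite mulrAC divff ?gt_eqF// mul1r.
have bY : beta Y = 1%E by case: beta_assoc.
have H1 := relative_entropy_mixture_le mY nuY w0 rhoY bY nuE bE.
have H2 := transport_cost_le_mean mX B0 XB muX qX Htau mY rhoY YB bE.
have H2' : (transport_cost X Y mu beta <=
   (N^-1 * \sum_i (ln (w i) - (phi i - half_sq (q i)) + 2 * osc i) + 2 * n%:R * B * eps)%:E)%E.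
  apply: le_trans H2 _; rewrite EFinD leeD2r// mulr_sumr -sumEFin.
  by apply: lee_sum => i _; rewrite EFinM; apply: lee_wpmul2l.
have osc_mean : N^-1 * \sum_i osc i <= 2 * B * \sum_k (eta + 4 * L * eps / t k).
  rewrite /osc -mulr_sumr mulrCA ler_pM2l ?mulr_gt0// exchange_big/= mulr_sumr.
  apply: ler_sum => k _; rewrite -mulr_suml mulrA ler_pdivrMr//.
  rewrite mulrDl divfK ?gt_eqF//.
  have Phi_L x y : `|Phi x - Phi y| <= L * `|x - y|.
    by apply: le_trans (Phi_lip _ _) _; rewrite ler_wpM2r// /L lerDl.
  have L0 : 0 <= L by rewrite addr_ge0.
  have Phi_cvx k' t' x : 0 <= second_diff Phi k' t' x.
    exact: (potential_convex phi Y0 B0 qB YB).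
  have msd : measurable_fun setT (second_diff Phi k (t k)).
    exact: measurable_second_diff Phi_L.
  have isd : mu.-integrable X (EFin \o second_diff Phi k (t k)).
    apply: (@bounded_integrable _ _ _ _ _ mX _ (2 * L * t k)) => //.
      exact: measurable_funTS.
    by move=> x _; rewrite ger0_norm// (second_diff_le (L := L)).
  (* The opposite sign makes [Rintegral_le_mean] bound the mean over the points; a second difference
     is Lipschitz with constant [4 * L]. *)
  have h1 : \int[mu]_(x in X) (- second_diff Phi k (t k) x) <=
      N^-1 * \sum_i (- second_diff Phi k (t k) (q i)) + 4 * L * eps.
    apply: (Rintegral_le_mean mX B0 XB qX Htau).
    - exact: measurableT_comp.
    - by rewrite mulr_ge0.
    move=> x y _ _; rewrite opprK addrC.
    pose v : E := t k *: delta_mx ord0 k.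
    have -> : second_diff Phi k (t k) y - second_diff Phi k (t k) x =
        (Phi (y + v) - Phi (x + v)) + (Phi (y - v) - Phi (x - v)) - 2 * (Phi y - Phi x).
      by rewrite /second_diff -/v; lra.
    apply: le_trans (ler_normB _ _) _; rewrite normrM (ger0_norm (_ : 0 <= 2))//.
    have := ler_normD (Phi (y + v) - Phi (x + v)) (Phi (y - v) - Phi (x - v)).
    have := Phi_L (y + v) (x + v); have := Phi_L (y - v) (x - v); have := Phi_L y x.
    have shift u : y + u - (x + u) = y - x by rewrite opprD addrACA subrr addr0.
    rewrite (distrC x y) !shift.
    move: (`|y - x|) (`|Phi y - _|) (`|Phi (y - v) - _|) (`|Phi (y + v) - _|).
    by move=> d1 d2 d3 d4; move: (`|_ + _|) => d5; lra.
  have h2 : \int[mu]_(x in X) (- second_diff Phi k (t k) x) =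
      - \int[mu]_(x in X) second_diff Phi k (t k) x.
    rewrite -[RHS]mulN1r -RintegralZl//.
    by apply: eq_Rintegral => x _; rewrite mulN1r.
  have h3 : \int[mu]_(x in X) second_diff Phi k (t k) x <= eta * t k.
    rewrite -lee_fin /Rintegral fineK ?t_small//; exact: integrable_fin_num isd.
  move: h1; rewrite h2 sumrN mulrN lerNl opprD opprK lerBlDr.
  by move=> /le_trans; apply; rewrite lerD2r.
have e_le' : N^-1 * \sum_i psi (q i) <= ln N + N^-1 * \sum_i (phi i - half_sq (q i)).
  have -> : ln N = N^-1 * \sum_(i < m.+1) ln N.
    by rewrite sumr_const card_ord -[ln _ *+ _]mulr_natl mulKf.
  rewrite -mulrDr -big_split ler_wpM2l//; apply: ler_sum => i _ /=.
  have := @potential_le_point _ _ Y B _ q phi Y0 B0 qB YB i; rewrite /psi -/Phi.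
  by move: (half_sq _) (ln _) => d1 d2; lra.
have lnsum : N^-1 * \sum_i ln (N * w i) = ln N + N^-1 * \sum_i ln (w i).
  rewrite (eq_bigr (fun i => ln N + ln (w i))); last first.
    by move=> i _; rewrite lnM ?posrE ?ltr0n.
  by rewrite big_split/= sumr_const card_ord -[ln _ *+ _]mulr_natl mulrDr mulKf.
(* The means of [ln (w i)] cancel between the entropy and the transport cost. What remains, [ln N]
   plus the mean of [phi i - half_sq (q i)], dominates the mean of [psi] over the points. *)
rewrite /limit_objective.
apply: (@le_trans _ _ (- (- (N^-1 * \sum_i ln (N * w i)))%:E - (N^-1 * \sum_i (ln (w i) -
  (phi i - half_sq (q i)) + 2 * osc i) + 2 * n%:R * B * eps)%:E)%E); last first.
  by apply: leeB => //; rewrite leeN2.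
rewrite -EFinN -EFinB lee_fin opprK lnsum.
rewrite (_ : \sum_i (ln (w i) - _ + _) = \sum_i ln (w i) -
    \sum_i (phi i - half_sq (q i)) + 2 * \sum_i osc i); last first.
  by rewrite mulr_sumr -sumrB -big_split.
move: osc_mean e_le' e_le; rewrite !mulrDr mulrN (mulrCA _ 2 (\sum_i osc i)).
move: (N^-1 * \sum_i osc i) (N^-1 * \sum_i ln (w i)) (N^-1 * \sum_i psi (q i))
  (N^-1 * \sum_i (phi i - half_sq (q i))) (ln N) e => d1 d2 d3 d4 d5 d6.
move: (\sum_k _) => d7; lra.
Qed.

End discrete_problem.

(** * Convergence *)

Section convergence.
Context (R : realType) (n : nat).
Local Notation E := 'rV[R]_n.
Context (X Y : set E) (mu nu : probability E R) (B : R).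
Hypotheses (mX : measurable X) (mY : measurable Y) (B0 : 0 < B).
Hypotheses (muX : mu X = 1%E) (nuY : nu Y = 1%E).
Hypothesis XB : forall x, X x -> forall j, `|x ord0 j| <= B.
Hypothesis YB : forall y, Y y -> forall j, `|y ord0 j| <= B.
Hypothesis mu_ac : mu `<< lebesgue_rV R n.

(** Weak duality is recovered from the stability bound with [f = 0]: the right side must be
    nonnegative for every step, which fails at a small one if [L0 > e]. *)
Lemma stability_bound_le e gam (b : probability E R) (L0 : R) :
  stability_bound X Y mu nu e gam -> b Y = 1%E ->
  (L0%:E <= limit_objective X Y mu nu b)%E -> L0 <= e.
Proof.
move=> st bY L0b; rewrite leNgt; apply/negP => eL0.
pose dl := (L0 - e) / 4 + 1.
have dl0 : 0 < dl by rewrite addr_gt0// divr_gt0// subr_gt0.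
have z0 y : Y y -> `|(fun=> 0 : R) y| <= 1 by rewrite normr0.
(* At this step the right side equals [- (6 * s)]. *)
pose s := Num.sqrt ((L0 - e) / 16).
have s0 : 0 < s by rewrite sqrtr_gt0 divr_gt0// subr_gt0.
have := st b L0 (fun=> 0) 1 s bY L0b (measurable_cst _) z0 s0.
rewrite mul1r => /(le_trans (normr_ge0 _)).
have s2 : s ^+ 2 = (L0 - e) / 16 by rewrite sqr_sqrtr// ltW// divr_gt0// subr_gt0.
have -> : e - L0 = - (16 * s ^+ 2) by rewrite s2; lra.
rewrite (_ : - (16 * s ^+ 2) / (2 * s) + 2 * s = - (6 * s)); last first.
  by field; rewrite gt_eqF.
by rewrite oppr_ge0 leNgt mulr_gt0.
Qed.

Context (p : forall N : nat, 'I_N -> E).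
Arguments p : clear implicits.
Context (piN : nat -> probability (E * E)%type R) (beta : nat -> probability E R).
Hypotheses (pX : forall N i, X (p N i)) (p_inj : forall N, injective (p N)).
Hypothesis p_cvg : weak_cvg_on X (fun N => empirical (p N)) mu.
Hypothesis pi_max : forall N, (0 < N)%N ->
  maximizer (plans (p N) Y nu) (nash_objective (p N) Y) (piN N).
Hypothesis beta_assoc : forall N, (0 < N)%N ->
  associated_measure (p N) Y (piN N) (beta N).

Lemma asymptotic_estimate (tau : R) : 0 < tau -> \forall N \near \oo,
  exists e gam, stability_bound X Y mu nu e gam /\
    ((e - tau)%:E <= limit_objective X Y mu nu (beta N))%E.
Proof.
move=> tau0.
pose L : R := n%:R * B + 1.
have L0 : 0 < L by rewrite ltr_wpDl// mulr_ge0// ltW.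
(* Makes the part [4 * B * (n%:R * eta)] of the error at most [tau / 2]; [n.+1] avoids a division by
   0. *)
pose eta := tau / (8 * B * n.+1%:R).
have eta0 : 0 < eta by rewrite divr_gt0// !mulr_gt0.
pose t k := sval (cid2 (@second_diff_small R n X mu B L eta k mX B0 XB mu_ac L0 eta0)).
have t0 k : 0 < t k by rewrite /t; case: cid2.
have t_small k : forall phi : E -> R,
    (forall x y, `|phi x - phi y| <= L * `|x - y|) ->
    (forall k t x, 0 <= second_diff phi k t x) ->
    (\int[mu]_(x in X) (second_diff phi k (t k) x)%:E <= (eta * t k)%:E)%E.
  by rewrite /t; case: cid2.
pose K := 4 * n%:R * B + 4 * B * \sum_k (4 * L / t k).
have K0 : 0 <= K.
  apply: addr_ge0; first by rewrite mulr_ge0// ltW.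
  rewrite mulr_ge0//; first by rewrite mulr_ge0// ltW.
  by apply: sumr_ge0 => k _; rewrite divr_ge0// ltW// mulr_gt0.
(* [K] collects the coefficients of [eps] in the error, so [K * eps <= tau / 2]. It depends on the
   steps [t k], which are already fixed. *)
pose eps := tau / (2 * (K + 1)).
have eps0 : 0 < eps by rewrite divr_gt0// mulr_gt0// ltr_wpDl.
have err : 4 * n%:R * B * eps + 4 * B * \sum_k (eta + 4 * L * eps / t k) <= tau.
  have -> : 4 * n%:R * B * eps + 4 * B * \sum_k (eta + 4 * L * eps / t k) =
      K * eps + 4 * B * (n%:R * eta).
    rewrite big_split/= sumr_const card_ord -[eta *+ n]mulr_natl mulrDr.
    rewrite [RHS](_ : _ = 4 * n%:R * B * eps + (4 * B * (n%:R * eta) +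
        4 * B * ((\sum_k (4 * L / t k)) * eps))); last by rewrite /K; ring.
    congr (_ + (_ + _ * _)); rewrite mulr_suml.
    by apply: eq_bigr => k _; rewrite mulrAC.
  have h1 : K * eps <= tau / 2.
    rewrite /eps invfM !mulrA ler_pdivrMr; last by rewrite ltr_wpDl.
    by rewrite -mulrA [leLHS]mulrC ler_wpM2l ?lerDl ?divr_ge0 ?ltW//.
  have h2 : 4 * B * (n%:R * eta) <= tau / 2.
    rewrite /eta; have n0 : 0 < n.+1%:R :> R by [].
    rewrite (_ : 4 * B * (n%:R * (tau / (8 * B * n.+1%:R))) =
      tau / 2 * (n%:R / n.+1%:R)); last first.
      by field; rewrite !gt_eqF.
    by rewrite ler_piMr ?divr_ge0 ?ltW// ltr_pdivrMr// mul1r ltr_nat.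
  by rewrite [leRHS]splitr lerD.
have wts := transport_weights_exist mX B0 XB muX pX p_cvg eps0.
apply: filterS2 wts (nbhs_infty_gt 0) => -[//|m] wN _.
have [e [gam [st le]]] := discrete_estimate mX mY B0 muX nuY XB YB t0 t_small
  (@pX m.+1) (@p_inj m.+1) wN (@pi_max m.+1 isT) (@beta_assoc m.+1 isT).
exists e, gam; split => //; apply: le_trans le; rewrite lee_fin.
by rewrite lerD2l lerN2.
Qed.

Context (betah : probability E R).
Hypothesis betah_max : maximizer (prob_on Y) (limit_objective X Y mu nu) betah.

Let V := limit_objective X Y mu nu betah.

(** The dual value [e] depends on [N]; it confines both objective values to an interval of length
    [tau], and shows that [V] is finite. *)
Lemma limit_value_estimate (tau : R) : 0 < tau -> \forall N \near \oo,
  exists e gam, [/\ stability_bound X Y mu nu e gam,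
    ((e - tau)%:E <= limit_objective X Y mu nu (beta N) <= V)%E &
    ((e - tau)%:E <= V <= e%:E)%E].
Proof.
move=> tau0; near=> N.
have [e [gam [st le]]] : exists e gam, stability_bound X Y mu nu e gam /\
    ((e - tau)%:E <= limit_objective X Y mu nu (beta N))%E.
  by near: N; exact: asymptotic_estimate.
have bY : beta N Y = 1%E.
  have N0 : (0 < N)%N by near: N; exact: nbhs_infty_gt.
  by case: (beta_assoc N0).
have leV : (limit_objective X Y mu nu (beta N) <= V)%E by case: betah_max => _; exact.
exists e, gam; split => //; first by rewrite le.
rewrite (le_trans le)//=.
have hV := fun L0 => @stability_bound_le e gam betah L0 st betah_max.1.
have := le_trans le leV; rewrite -/V in hV *.
case: (V) hV => [v| |] hV _.
- by rewrite lee_fin hV.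
- by have := hV (e + 1) (leey _); rewrite gerDl ler10.
- by rewrite leNye.
Unshelve. all: by end_near.
Qed.

End convergence.

Lemma cvg_EFin_dist (R : realType) (u : nat -> \bar R) (v : R) :
  (forall e, 0 < e -> \forall N \near \oo, exists2 r, u N = r%:E & `|v - r| <= e) ->
  u N @[N --> \oo] --> v%:E.
Proof.
move=> H; apply/fine_cvgP; split.
  by apply: filterS (H 1 ltr01) => N [r -> _].
apply/cvgrPdist_le => e e0; apply: filterS (H e e0) => N [r].
by move=> /= ->.
Qed.

Theorem theorem1p1 (R : realType) (n : nat) (X Y : set 'rV[R]_n)
    (mu nu : probability 'rV[R]_n R)
    (p : forall N : nat, 'I_N -> 'rV[R]_n)
    (piN : nat -> probability ('rV[R]_n * 'rV[R]_n)%type R)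
    (beta : nat -> probability 'rV[R]_n R) (betah : probability 'rV[R]_n R)
    (hX : convex_region X) (hY : convex_region Y)
    (muX : prob_on X mu) (nuY : prob_on Y nu)
    (hmu : ac_bounded_below X mu) (hnu : ac_bounded_below Y nu)
    (pX : forall N i, X (p N i)) (p_inj : forall N, injective (p N))
    (p_cvg : weak_cvg_on X (fun N => empirical (p N)) mu)
    (pi_max : forall N, (0 < N)%N ->
       maximizer (plans (p N) Y nu) (nash_objective (p N) Y) (piN N))
    (beta_assoc : forall N, (0 < N)%N ->
       associated_measure (p N) Y (piN N) (beta N))
    (betah_max : unique_maximizer (prob_on Y) (limit_objective X Y mu nu) betah) :
  limit_objective X Y mu nu (beta N) @[N --> \oo]
    --> limit_objective X Y mu nu betah
  /\ weak_cvg_on Y (fun N => beta N) betah.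
Proof.
have [mX bX _ _] := hX; have [mY bY _ _] := hY.
have [B1 B10 XB1] := bounded_set_coord bX.
have [B2 B20 YB2] := bounded_set_coord bY.
pose B := B1 + B2.
have B0 : 0 < B by rewrite addr_gt0.
have XB x : X x -> forall j, `|x ord0 j| <= B.
  by move=> /XB1 h j; rewrite (le_trans (h j))// lerDl ltW.
have YB y : Y y -> forall j, `|y ord0 j| <= B.
  by move=> /YB2 h j; rewrite (le_trans (h j))// lerDr ltW.
have est := limit_value_estimate mX mY B0 muX nuY XB YB hmu.1 pX p_inj p_cvg
  pi_max beta_assoc betah_max.1.
have betahY : betah Y = 1%E := betah_max.1.1.
have betaY N : (0 < N)%N -> beta N Y = 1%E by move=> /beta_assoc[].
have [v vE] : exists v, limit_objective X Y mu nu betah = v%:E.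
  have [N [e [gam [_ _]]]] := @filter_ex _ \oo _ _ (est 1 ltr01).
  case: (limit_objective X Y mu nu betah) => [v| |]; first by exists v.
  - by rewrite leye_eq/= andbF.
  - by rewrite leeNy_eq.
rewrite vE in est *; split.
  apply: cvg_EFin_dist => d d0; apply: filterS (est d d0) => N [e [gam [_]]].
  case: limit_objective => [r| |]; [|by rewrite leye_eq andbF|by rewrite leeNy_eq].
  rewrite !lee_fin => /andP[le rv] /andP[_ ve]; exists r => //.
  by rewrite ger0_norm ?subr_ge0//; lra.
move=> f fc [M [_ Mf]].
pose Bf := `|M| + 1.
have Bf0 : 0 < Bf by rewrite ltr_wpDl.
have fB y : Y y -> `|f y| <= Bf.
  by apply: Mf; rewrite (le_lt_trans (ler_norm _))// ltrDl.
have mf : measurable_fun Y f by exact: within_continuous_measurable_rV.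
have fE (b : probability 'rV[R]_n R) :
    (\int[b]_(x in Y) (f x)%:E)%E = (\int[b]_(x in Y) f x)%:E.
  rewrite /Rintegral fineK//; apply: (integrable_fin_num mY).
  exact: (@bounded_integrable _ _ _ _ _ mY _ Bf).
rewrite fE; apply: cvg_EFin_dist => d d0.
(* With accuracy [4 * dl ^+ 2] the two terms of the stability bound are equal and add up to
   [4 * Bf * dl = d / 2]. The bound is used twice, for [beta N] and for [betah]. *)
pose dl := d / (8 * Bf).
have dl0 : 0 < dl by rewrite divr_gt0// mulr_gt0.
have tau0 : 0 < 4 * dl ^+ 2 by rewrite mulr_gt0// exprn_gt0.
near=> N; rewrite fE; eexists; first by [].
have [e [gam [st /andP[le1 _] /andP[le2 _]]]] : exists e gam, [/\
    stability_bound X Y mu nu e gam,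
    ((e - 4 * dl ^+ 2)%:E <= limit_objective X Y mu nu (beta N) <= v%:E)%E &
    ((e - 4 * dl ^+ 2)%:E <= v%:E <= e%:E)%E].
  by near: N; exact: est.
have bNY : beta N Y = 1%E.
  by apply: betaY; near: N; exact: nbhs_infty_gt.
rewrite -vE in le2.
have := st _ _ f Bf dl bNY le1 mf fB dl0; have := st _ _ f Bf dl betahY le2 mf fB dl0.
have -> : Bf * ((e - (e - 4 * dl ^+ 2)) / (2 * dl) + 2 * dl) = d / 2.
  by rewrite /dl; field; rewrite !gt_eqF.
move: (\int[_]_(x in Y) f x) (\int[_]_(x in Y) f x) (\int[_]_(x in Y) (_ * _)).
by move=> c1 c2 c3; rewrite !ler_norml => /andP[? ?] /andP[? ?]; apply/andP; split; lra.
Unshelve. all: by end_near.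
Qed.
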